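(* Let $n\ge 0$ and $m,r\ge 1$ be integers, $p\in[1,\infty)$, $[a,b]\subset\mathbb{R}$ a compact interval, and $\varepsilon_0>0$. For every $\varepsilon\in[0,\varepsilon_0)$ let $A_{r-j}(\cdot,\varepsilon)\in (W^n_p)^{m\times m}$, $j\in\{1,\dots,r\}$, be arbitrary matrix-valued functions and let $B(\varepsilon):(W^{n+r}_p)^m\to\mathbb{C}^{rm}$ be an arbitrary continuous linear operator (no regularity in $\varepsilon$ is assumed). Consider the boundary-value problem $$L(\varepsilon)y(t,\varepsilon)\equiv y^{(r)}(t,\varepsilon)+\sum_{j=1}^{r}A_{r-j}(t,\varepsilon)\,y^{(r-j)}(t,\varepsilon)=f(t,\varepsilon),\quad a\le t\le b,\qquad B(\varepsilon)y(\cdot,\varepsilon)=c(\varepsilon),$$ with unknown $y(\cdot,\varepsilon)\in(W^{n+r}_p)^m$ and right-hand sides $f(\cdot,\varepsilon)\in(W^n_p)^m$, $c(\varepsilon)\in\mathbb{C}^{rm}$. Then the solution to this problem depends continuously on the parameter $\varepsilon$ at $\varepsilon=0$ if and only if all of the following three conditions hold: (0) the homogeneous limiting problem $L(0)y(t)=0$, $a\le t\le b$, $B(0)y=0$ has only the trivial solution $y=0$ in $(W^{n+r}_p)^m$; (I) $A_{r-j}(\cdot,\varepsilon)\to A_{r-j}(\cdot,0)$ in $(W^n_p)^{m\times m}$ as $\varepsilon\to0+$ for each $j\in\{1,\dots,r\}$; (II) $B(\varepsilon)y\to B(0)y$ in $\mathbb{C}^{rm}$ as $\varepsilon\to0+$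 for every $y\in(W^{n+r}_p)^m$.
   Context: $W^n_p=W^n_p([a,b],\mathbb{C})$ is the complex Sobolev space with norm $\|x\|_{n,p}=\bigl(\sum_{j=0}^{n}\int_a^b|x^{(j)}(t)|^p\,dt\bigr)^{1/p}$; $W^0_p=L_p([a,b],\mathbb{C})$. $(W^n_p)^m$ and $(W^n_p)^{m\times m}$ are the spaces of $\mathbb{C}^m$-valued, respectively $\mathbb{C}^{m\times m}$-valued, functions on $[a,b]$ with all components in $W^n_p$; their norms are the sums of the norms in $W^n_p$ of all components (also denoted $\|\cdot\|_{n,p}$). Vectors are columns. The differential equation is understood at every $t\in[a,b]$ if $n\ge1$, and almost everywhere on $[a,b]$ if $n=0$. Definition. The solution to the boundary-value problem is said to depend continuously on the parameter $\varepsilon$ at $\varepsilon=0$ if the following two conditions hold: $(\ast)$ there exists a positive number $\varepsilon_1<\varepsilon_0$ such that for arbitrary $\varepsilon\in[0,\varepsilon_1)$, $f(\cdot,\varepsilon)\in(W^n_p)^m$ and $c(\varepsilon)\in\mathbb{C}^{rm}$ the problem has a unique solution $y(\cdot,\varepsilon)\in(W^{n+r}_p)^m$; $(\ast\ast)$ the convergence of the right-hand sides $f(\cdot,\varepsilon)\to f(\cdot,0)$ in $(W^n_p)^m$ and $c(\varepsilon)\to c(0)$ in $\mathbb{C}^{rm}$ as $\varepsilon\to0+$ implies the convergence of the solutions $y(\cdot,\varepsilon)\to y(\cdot,0)$ in $(W^{n+r}_p)^m$ as $\varepsilon\to0+$ (for all families of right-hand sides). *)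

(* Defs.v *)
From HB Require Import structures.
From mathcomp Require Import all_boot all_order all_algebra.
From mathcomp Require Import complex.
From mathcomp Require Import all_classical all_reals all_analysis.
Import Order.TTheory GRing.Theory Num.Theory.
Import numFieldNormedType.Exports.

Set Implicit Arguments.
Unset Strict Implicit.
Unset Printing Implicit Defensive.

Local Open Scope classical_set_scope.
Local Open Scope ring_scope.
Local Open Scope complex_scope.

(* Functions on [a, b] are represented by total functions on R; only their
   values on [a, b] are ever used, and equality of continuous functions means
   equality on [a, b].  Elements of L_p are represented by Borel functions. *)

(* Derivative relative to [a, b]: one-sided at the endpoints; an unspecified
   value where the limit does not exist. *)
Definition deriv_on (R : realType) (a b : R) (u : R -> R) (t : R) : R :=
  lim ((u s - u t) / (s - t) @[s --> within `[a, b] t^']).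

Definition cderiv_on (R : realType) (a b : R) (x : R -> R[i]) (t : R) : R[i] :=
  deriv_on a b (fun s => complex.Re (x s)) t
    +i* deriv_on a b (fun s => complex.Im (x s)) t.

Definition cderivn (R : realType) (a b : R) (j : nat) (x : R -> R[i]) :
    R -> R[i] :=
  iter j (cderiv_on a b) x.

Definition cintegral (R : realType) (a b : R) (x : R -> R[i]) : R[i] :=
  (\int[lebesgue_measure]_(t in `[a, b]) complex.Re (x t))
    +i* (\int[lebesgue_measure]_(t in `[a, b]) complex.Im (x t)).

Definition in_Lp (R : realType) (a b p : R) (x : R -> R[i]) : Prop :=
  [/\ measurable_fun `[a, b] (fun t => complex.Re (x t)),
      measurable_fun `[a, b] (fun t => complex.Im (x t)) &
      (\int[lebesgue_measure]_(t in `[a, b])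
         (Normc.normc (x t) `^ p)%:E < +oo)%E].

(* One-dimensional Sobolev space W^n_p([a, b], C): all derivatives up to order
   n are in L_p, and those of order < n are absolutely continuous, i.e. are
   the Lebesgue integrals of their a.e. derivatives.  For j + 1 < n the
   derivative of order j + 1 is thereby continuous, so that x^(j) is C^1 on the
   whole of [a, b]; only x^(n) is determined a.e. *)
Definition in_W (R : realType) (a b : R) (n : nat) (p : R) (x : R -> R[i]) :
    Prop :=
  (forall j, (j <= n)%N -> in_Lp a b p (cderivn a b j x)) /\
  (forall j, (j < n)%N -> forall t, a <= t <= b ->
     cderivn a b j x t =
     cderivn a b j x a + cintegral a t (cderivn a b j.+1 x)).

Definition normW (R : realType) (a b : R) (n : nat) (p : R) (x : R -> R[i]) :
    R :=
  (\sum_(0 <= j < n.+1)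
     \int[lebesgue_measure]_(t in `[a, b])
       (Normc.normc (cderivn a b j x t) `^ p))
  `^ p^-1.

(* Matrix-valued functions; column vectors are the case k = 1. *)
Definition mxderivn (R : realType) (a b : R) (m k j : nat)
    (X : R -> 'M[R[i]]_(m, k)) (t : R) : 'M[R[i]]_(m, k) :=
  \matrix_(i, l) cderivn a b j (fun s => X s i l) t.

Definition in_mxW (R : realType) (a b : R) (n : nat) (p : R) (m k : nat)
    (X : R -> 'M[R[i]]_(m, k)) : Prop :=
  forall i l, in_W a b n p (fun t => X t i l).

Definition mxnormW (R : realType) (a b : R) (n : nat) (p : R) (m k : nat)
    (X : R -> 'M[R[i]]_(m, k)) : R :=
  \sum_i \sum_l normW a b n p (fun t => X t i l).

Definition cvnorm (R : realType) (q : nat) (c : 'cV[R[i]]_q) : R :=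
  \sum_i Normc.normc (c i 0).

Definition cvgW (R : realType) (a b : R) (n : nat) (p : R) (m k : nat)
    (X : R -> R -> 'M[R[i]]_(m, k)) : Prop :=
  mxnormW a b n p (fun t => X eps t - X 0 t) @[eps --> 0^'+] --> (0 : R).

Definition cvgC (R : realType) (q : nat) (c : R -> 'cV[R[i]]_q) : Prop :=
  cvnorm (c eps - c 0) @[eps --> 0^'+] --> (0 : R).

(* Continuity forces B to take equal values at functions that agree on
   [a, b]. *)
Definition continuous_linear_on_W (R : realType) (a b : R) (n : nat) (p : R)
    (m q : nat) (B : (R -> 'cV[R[i]]_m) -> 'cV[R[i]]_q) : Prop :=
  (forall (alpha : R[i]) (y z : R -> 'cV[R[i]]_m),
     in_mxW a b n p y -> in_mxW a b n p z ->
     B (fun t => alpha *: y t + z t) = alpha *: B y + B z) /\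
  (forall y : R -> 'cV[R[i]]_m, in_mxW a b n p y ->
   forall e : R, 0 < e -> exists2 d : R, 0 < d &
   forall z : R -> 'cV[R[i]]_m, in_mxW a b n p z ->
     mxnormW a b n p (fun t => z t - y t) < d -> cvnorm (B z - B y) < e).

(* A k is the coefficient of y^(k). *)
Definition diff_op (R : realType) (a b : R) (m r : nat)
    (A : nat -> R -> 'M[R[i]]_m) (y : R -> 'cV[R[i]]_m) (t : R) :
    'cV[R[i]]_m :=
  mxderivn a b r y t +
  \sum_(1 <= j < r.+1) A (r - j)%N t *m mxderivn a b (r - j) y t.

Definition eqn_on (R : realType) (a b : R) (n m : nat)
    (g h : R -> 'cV[R[i]]_m) : Prop :=
  if n is 0 then {ae lebesgue_measure, forall t : R, a <= t <= b -> g t = h t}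
  else forall t : R, a <= t <= b -> g t = h t.

Definition solves (R : realType) (a b : R) (n : nat) (p : R) (m r : nat)
    (A : nat -> R -> 'M[R[i]]_m)
    (B : (R -> 'cV[R[i]]_m) -> 'cV[R[i]]_(r * m))
    (f : R -> 'cV[R[i]]_m) (c : 'cV[R[i]]_(r * m)) (y : R -> 'cV[R[i]]_m) :
    Prop :=
  [/\ in_mxW a b (n + r) p y, eqn_on a b n (diff_op a b r A y) f & B y = c].

Definition depends_continuously (R : realType) (a b : R) (n : nat) (p : R)
    (m r : nat) (eps0 : R) (A : nat -> R -> R -> 'M[R[i]]_m)
    (B : R -> (R -> 'cV[R[i]]_m) -> 'cV[R[i]]_(r * m)) : Prop :=
  let sol (eps : R) := solves a b n p (fun k => A k eps) (B eps) in
  exists eps1 : R, [/\ 0 < eps1 < eps0,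
    forall eps : R, 0 <= eps < eps1 ->
    forall (f : R -> 'cV[R[i]]_m) (c : 'cV[R[i]]_(r * m)), in_mxW a b n p f ->
      exists2 y : R -> 'cV[R[i]]_m, sol eps f c y &
        forall z : R -> 'cV[R[i]]_m, sol eps f c z ->
          forall t, a <= t <= b -> z t = y t
  & forall (f : R -> R -> 'cV[R[i]]_m) (c : R -> 'cV[R[i]]_(r * m))
      (y : R -> R -> 'cV[R[i]]_m),
      (forall eps : R, 0 <= eps < eps0 -> in_mxW a b n p (f eps)) ->
      (forall eps : R, 0 <= eps < eps1 -> sol eps (f eps) (c eps) (y eps)) ->
      cvgW a b n p f -> cvgC c -> cvgW a b (n + r) p y].

(* Main.v *)
(* Complex functions are split into real and imaginary parts, and the equation
   of order r is rewritten as a system u' + K u = F for the vector u of the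
   derivatives of order < r of y.  A fundamental matrix, obtained by Picard
   iteration, and its inverse yield
     |y|_{n+r,p} <= C (|u(a)| + |L(e) y|_{n,p}),
   uniformly for coefficients close to those at e = 0.

   If (0), (I) and (II) hold, then the B(e) are uniformly bounded near 0
   (Banach-Steinhaus), and comparing y with Y q, where Y is the fundamental
   matrix of the limiting equation and q = u(a), gives
     |y|_{n+r,p} <= C (|B(e) y| + |L(e) y|_{n,p}) for small e > 0.
   Applied to y(e) - y(0), this is continuous dependence; for f = 0 and c = 0
   it makes the boundary matrix B(e) Y(e) injective, hence solvability.

   Conversely, the solutions with f = 0 and c in the standard basis form
   matrices Y(e) -> Y(0).  Their states U(e) satisfy U' + K(e) U = 0 and U(0) is
   invertible, so that K(e) -> K(0), which is (I).  If x(e) solves L(e) x =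
   L(e) y and B(e) x = 0, then y - x(e) = Y(e) (B(e) y); as x(e) converges and
   U(0) is invertible at a, so does B(e) y, which is (II). *)
Require Import Defs.
From HB Require Import structures.
From mathcomp Require Import all_boot all_order all_algebra.
From mathcomp Require Import complex.
From mathcomp Require Import all_classical all_reals all_analysis.
From mathcomp Require Import measurable_realfun ring lra zify.
Import Order.TTheory GRing.Theory Num.Theory.
Import numFieldNormedType.Exports.
Set Implicit Arguments.
Unset Strict Implicit.
Unset Printing Implicit Defensive.
Local Open Scope classical_set_scope.
Local Open Scope ring_scope.

(** Derivatives are limits relative to [a, b] with a default value where the limit fails, and
    elements of L_p are genuine functions. The theory of W^k is therefore built on primitives: x has
    order k + 1 when it is the primitive of its derivative, and its norm is |x(a)| plus the norm of
    the derivative. Statements about all orders become inductions, and the norm of a primitive is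
    known exactly.

    The case n = 0 shapes the rest: equations hold a.e. and coefficients are in L_p only, hence
    possibly unbounded. Equality in W^k is a relation that means a.e. for k = 0, and the basic
    product estimate pairs a factor of order k with one of order k + 1. In the Picard iteration the
    primitive of |K| takes the place of a Lipschitz constant times a length.

    The convergence estimates invert only objects at e = 0. A term in which the unknown quantity
    returns with a small factor is moved to the left side, which is where the thresholds 1/2 come
    from. After the passage to real and imaginary parts, B(e) enters only as a real-linear bounded
    operator. *)

Section almost_everywhere_lebesgue.
Variable R : realType.
Local Notation mu := (@lebesgue_measure R).
Implicit Types P Q S : R -> Prop.

Lemma leb_aeS P Q : (forall t, P t -> Q t) ->
  {ae mu, forall t, P t} -> {ae mu, forall t, Q t}.
Proof.
by move=> PQ; apply: filterS => //; exact: (ae_filter_ringOfSetsType mu).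
Qed.

Lemma leb_aeS2 P Q S : (forall t, P t -> Q t -> S t) ->
  {ae mu, forall t, P t} -> {ae mu, forall t, Q t} -> {ae mu, forall t, S t}.
Proof.
by move=> PQS; apply: filterS2 => //; exact: (ae_filter_ringOfSetsType mu).
Qed.

End almost_everywhere_lebesgue.

(** * The space L_p *)

Section Lp.
Variables (R : realType) (a b p : R).
Hypotheses (ab : a < b) (p1 : 1 <= p).
Implicit Types u v : R -> R.
Local Notation mu := (@lebesgue_measure R).
Local Notation I := `[a, b]%classic.

Fact Lpow_key : unit. Proof. by []. Qed.

(* Locked: conversion tests that unfold the integral diverge. *)
Definition Lpow : (R -> R) -> \bar R := locked_with Lpow_key
  (fun u => \int[mu]_(t in I) (`|u t| `^ p)%:E)%E.

Lemma LpowE u : Lpow u = (\int[mu]_(t in I) (`|u t| `^ p)%:E)%E.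
Proof. by rewrite /Lpow unlock. Qed.

Record Lp u : Prop := LpI {
  Lp_measurable : measurable_fun I u;
  Lp_lty : (Lpow u < +oo)%E }.

Definition Lnm u : R := fine (Lpow u) `^ p^-1.

Let p_gt0 : 0 < p. Proof. exact: lt_le_trans ltr01 p1. Qed.

Lemma measurable_powR_norm (D : set R) u : measurable_fun D u ->
  measurable_fun D (fun t => `|u t| `^ p).
Proof.
move=> mu_; apply: (@measurableT_comp _ _ _ _ _ _ (@powR R ^~ p)) => //.
exact: measurableT_comp.
Qed.

Lemma emeasurable_powR_norm (D : set R) u : measurable_fun D u ->
  measurable_fun D (fun t => (`|u t| `^ p)%:E).
Proof. by move=> mu_; apply/measurable_EFinP; exact: measurable_powR_norm. Qed.

Lemma Lnm_ge0 u : 0 <= Lnm u. Proof. exact: powR_ge0. Qed.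

Lemma Lpow_ge0 u : (0 <= Lpow u)%E.
Proof. by rewrite LpowE integral_ge0// => t _; rewrite lee_fin powR_ge0. Qed.

Lemma Lpow_fin_num u : Lp u -> Lpow u \is a fin_num.
Proof. by move=> [_ fu]; rewrite ge0_fin_numE// Lpow_ge0. Qed.

Lemma Lnm_powR u : Lp u -> ((Lnm u) `^ p)%:E = Lpow u.
Proof.
move=> Lu; rewrite /Lnm -powRrM mulVf ?gt_eqF// powRr1 ?fine_ge0 ?Lpow_ge0//.
by rewrite fineK// Lpow_fin_num.
Qed.

(** Extension by zero turns the integral over I into the L_p norm on the whole line, for which
    Minkowski's inequality is available. *)
Lemma Lnorm_patch u :
  (Lnorm mu p%:E (EFin \o (u \_ I)) = Lpow u `^ p^-1)%E.
Proof.
rewrite LpowE unlock /Lnorm [in RHS]integral_mkcond; congr (poweR _ _).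
apply: eq_integral => t _ /=.
rewrite !patchE; case: ifPn => _ //; rewrite ?poweR_EFin//.
by rewrite normr0 powR0 ?gt_eqF.
Qed.

Lemma LnmE u : Lp u -> Lnorm mu p%:E (EFin \o (u \_ I)) = (Lnm u)%:E.
Proof.
move=> Lu; rewrite Lnorm_patch -Lnm_powR// poweR_EFin -powRrM mulfV ?gt_eqF//.
by rewrite powRr1// Lnm_ge0.
Qed.

Lemma Lnm_le_integral u (M : R) : Lp u -> 0 <= M ->
  (Lpow u <= (M `^ p)%:E)%E -> Lnm u <= M.
Proof.
move=> Lu M0; rewrite -Lnm_powR// lee_fin => h.
have pV0 : 0 <= p^-1 by rewrite invr_ge0 ltW.
have := ge0_ler_powR pV0 _ _ h; rewrite !nnegrE !powR_ge0 => /(_ isT isT).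
rewrite -(powRrM (Lnm u)) -(powRrM M) mulfV ?gt_eqF//.
by rewrite !powRr1 ?Lnm_ge0.
Qed.

Lemma Lp_le u v : measurable_fun I v -> Lp u ->
  {ae mu, forall t, I t -> `|v t| <= `|u t|} -> Lp v /\ Lnm v <= Lnm u.
Proof.
move=> mv Lu vu; have [mu_ fu] := Lu.
have h : (Lpow v <= Lpow u)%E.
  rewrite !LpowE; apply: ae_ge0_le_integral => //.
  - exact: emeasurable_powR_norm.
  - exact: emeasurable_powR_norm.
  - apply: leb_aeS vu => t vut It; rewrite lee_fin ge0_ler_powR ?nnegrE ?vut//.
    exact: ltW.
have Lv : Lp v by exact: LpI mv (le_lt_trans h fu).
split; first exact: Lv.
by apply: (Lnm_le_integral Lv (Lnm_ge0 u)); rewrite (Lnm_powR Lu); exact: h.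
Qed.

Lemma Lp_ae u v : measurable_fun I v -> Lp u ->
  {ae mu, forall t, I t -> u t = v t} -> Lp v /\ Lnm v = Lnm u.
Proof.
move=> mv Lu uv.
have [Lv h] : Lp v /\ Lnm v <= Lnm u.
  by apply: Lp_le => //; apply: leb_aeS uv => t h /h ->.
split=> //; apply/eqP; rewrite eq_le h/=.
have [] // := @Lp_le v u (Lp_measurable Lu) Lv.
by apply: leb_aeS uv => t h' /h' ->.
Qed.

Lemma Lp_eq u v : {in I, u =1 v} -> Lp u -> Lp v /\ Lnm v = Lnm u.
Proof.
move=> uv Lu; apply: (Lp_ae _ Lu).
  exact: eq_measurable_fun (Lp_measurable Lu).
by apply: aeW => t It; apply: uv; rewrite inE.
Qed.

Lemma Lp_add u v : Lp u -> Lp v ->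
  Lp (fun t => u t + v t) /\ Lnm (fun t => u t + v t) <= Lnm u + Lnm v.
Proof.
move=> Lu Lv; have [mu_ _] := Lu; have [mv _] := Lv.
have muv : measurable_fun I (fun t => u t + v t) by exact: measurable_funD.
have mp (w : R -> R) : measurable_fun I w -> measurable_fun setT (w \_ I).
  by move=> mw; apply/(measurable_restrictT _ _).1.
have := minkowski_EFin mu (mp _ mu_) (mp _ mv) p1.
rewrite (_ : (_ \+ _) = ((fun t => u t + v t) \_ I)); last first.
  by apply/funext => t /=; rewrite !patchE; case: ifPn => //; rewrite addr0.
rewrite (LnmE Lu) (LnmE Lv) -EFinD => h.
have Luv : Lp (fun t => u t + v t).
  split => //; move: (le_lt_trans h (ltry _)); rewrite Lnorm_patch.
  by move=> /lty_poweRy; apply; rewrite invr_neq0// gt_eqF.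
by split=> //; move: h; rewrite (LnmE Luv) lee_fin.
Qed.

Lemma Lp_scale c u : Lp u -> Lp (fun t => c * u t) /\
  Lnm (fun t => c * u t) = `|c| * Lnm u.
Proof.
move=> Lu; have [mu_ fu] := Lu.
have mcu : measurable_fun I (fun t => c * u t) by exact: measurable_funM.
have E : Lpow (fun t => c * u t) = ((`|c| * Lnm u) `^ p)%:E.
  rewrite powRM ?Lnm_ge0// EFinM (Lnm_powR Lu) !LpowE -ge0_integralZl//.
  - by apply: eq_integral => t _; rewrite normrM powRM// EFinM.
  - exact: emeasurable_powR_norm.
split; first by apply: LpI => //; rewrite E ltry.
rewrite /Lnm E/= -powRrM mulfV ?gt_eqF// powRr1//.
by rewrite mulr_ge0// Lnm_ge0.
Qed.

Lemma mu_itv : mu I = (b - a)%:E.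
Proof. by rewrite lebesgue_measure_itv/= lte_fin ab. Qed.

Lemma Lp_cst c : Lp (fun=> c).
Proof.
split; first exact: measurable_cst.
by rewrite LpowE (integral_cst mu)//= mu_itv ltry.
Qed.

Lemma Lp_mul_bounded (M : R) u v : measurable_fun I v -> Lp u ->
  (forall t, I t -> `|v t| <= M) ->
  Lp (fun t => v t * u t) /\ Lnm (fun t => v t * u t) <= M * Lnm u.
Proof.
move=> mv Lu vM.
have M0 : 0 <= M by apply: le_trans (vM a _) => //=; rewrite in_itv/= lexx ltW.
have [LMu EM] := Lp_scale M Lu.
have -> : M * Lnm u = Lnm (fun t => M * u t) by rewrite EM ger0_norm.
apply: Lp_le => //; first by apply: measurable_funM => //; exact: (Lp_measurable Lu).
apply: aeW => t It; rewrite !normrM ler_wpM2r// (ger0_norm M0); exact: vM.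
Qed.

Lemma Lp_integrable u : Lp u -> mu.-integrable I (EFin \o u).
Proof.
move=> [mu_ fu]; apply/integrableP; split; first exact/measurable_EFinP.
have h : (\int[mu]_(t in I) `|(EFin \o u) t| <=
   \int[mu]_(t in I) (1 + (`|u t| `^ p)%:E))%E.
  apply: ge0_le_integral => //.
  - by apply: measurableT_comp => //; exact/measurable_EFinP.
  - apply: emeasurable_funD => //.
    exact: emeasurable_powR_norm.
  - move=> t It /=; rewrite -EFinD lee_fin.
    have [u1|u1] := leP `|u t| 1.
      by rewrite (le_trans u1)// lerDl powR_ge0.
    by rewrite -[leLHS]powRr1// (le_trans (ler_powR (ltW u1) p1))// lerDr.
apply: le_lt_trans h _; rewrite ge0_integralD//.
- by rewrite -LpowE lte_add_pinfty// (integral_cst mu)//= mu_itv mul1e ltry.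
- exact: emeasurable_powR_norm.
Qed.

Definition L1c : R := b - a + 1.

Lemma L1c_gt0 : 0 < L1c. Proof. rewrite /L1c; move: ab; lra. Qed.

Lemma Lnm_eq0 u : Lp u -> Lnm u = 0 ->
  {ae mu, forall t, I t -> u t = 0}.
Proof.
move=> Lu u0; have := Lnm_powR Lu; rewrite u0 powR0 ?gt_eqF// => E.
have : (\int[mu]_(t in I) `|(`|u t| `^ p)%:E| = 0)%E.
  transitivity (Lpow u) => //; rewrite LpowE; apply: eq_integral => t _ /=.
  by rewrite ger0_norm ?powR_ge0.
move/(ae_eq_integral_abs mu (measurable_itv _)
  (emeasurable_powR_norm (Lp_measurable Lu))).
apply: leb_aeS => t h It; have /= [/eqP] := h It.
by rewrite powR_eq0 normr_eq0 => /andP[/eqP].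
Qed.

(** With s the L_p norm of u, w = |u| / s satisfies w <= 1 + w^p. Integrating s w gives s (b - a +
    1), which is where [L1c] comes from; this treats all p >= 1 alike. If s = 0, then u vanishes
    a.e. *)
Lemma int_abs_le_Lnm u : Lp u ->
  \int[mu]_(t in I) `|u t| <= L1c * Lnm u.
Proof.
move=> Lu; have [mu_ fu] := Lu.
have iu := Lp_integrable Lu.
have [s0|s0] := eqVneq (Lnm u) 0.
  have h := Lnm_eq0 Lu s0.
  rewrite s0 mulr0 /Rintegral (_ : integral _ _ _ = 0%E)//.
  rewrite (ae_eq_integral (cst 0%E)) ?integral0//.
    by apply/measurable_EFinP; exact: measurableT_comp.
  by apply: leb_aeS h => t h It /=; rewrite h// normr0.
have s_gt0 : 0 < Lnm u by rewrite lt_neqAle eq_sym s0 Lnm_ge0.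
suff : (\int[mu]_(t in I) `|u t|%:E <= (L1c * Lnm u)%:E)%E.
  move=> h; rewrite -lee_fin /Rintegral fineK// ge0_fin_numE ?integral_ge0//.
  exact: le_lt_trans h (ltry _).
have h : (\int[mu]_(t in I) `|u t|%:E <=
   \int[mu]_(t in I) ((Lnm u)%:E * (1 + ((Lnm u)^-1 `^ p * `|u t| `^ p)%:E)))%E.
  apply: ge0_le_integral => //.
  - by apply/measurable_EFinP; apply: measurableT_comp.
  - apply/measurable_EFinP/measurable_funM => //.
    apply: measurable_funD => //; apply: measurable_funM => //.
    exact: measurable_powR_norm.
  - move=> t It /=; rewrite -EFinD -EFinM lee_fin.
    rewrite -powRM// ?invr_ge0 ?Lnm_ge0//; set w := _ * `|u t|.
    have -> : `|u t| = Lnm u * w by rewrite /w mulrA mulfV// mul1r.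
    have w0 : 0 <= w by rewrite mulr_ge0// invr_ge0 Lnm_ge0.
    rewrite ler_pM2l//; have [w1|w1] := leP w 1.
      by rewrite (le_trans w1)// lerDl powR_ge0.
    by rewrite -[leLHS]powRr1// (le_trans (ler_powR (ltW w1) p1))// lerDr.
have mw : measurable_fun I (fun t => (Lnm u)^-1 `^ p * `|u t| `^ p).
  by apply: measurable_funM => //; exact: measurable_powR_norm.
apply: le_trans h _; rewrite ge0_integralZl//; last 3 first.
- by apply/measurable_EFinP; apply: measurable_funD.
- by move=> t _; rewrite lee_fin addr_ge0// mulr_ge0// powR_ge0.
- by rewrite lee_fin Lnm_ge0.
rewrite ge0_integralD//; last 2 first.
- by move=> t _; rewrite lee_fin mulr_ge0// powR_ge0.
- exact/measurable_EFinP.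
under [X in (_ + X)%E]eq_integral do rewrite EFinM.
rewrite ge0_integralZl//;
  [|exact: emeasurable_powR_norm|by rewrite lee_fin powR_ge0].
rewrite (integral_cst mu)//= mu_itv mul1e -LpowE -(Lnm_powR Lu) -EFinM -powRM ?Lnm_ge0//.
- by rewrite mulVf// powR1 lee_fin mulrC.
- by rewrite invr_ge0 Lnm_ge0.
Qed.

End Lp.

(** * Completeness of L_p *)

Section Lp_complete.
Variables (R : realType) (a b p : R).
Hypotheses (ab : a < b) (p1 : 1 <= p).
Local Notation mu := (@lebesgue_measure R).
Local Notation I := `[a, b]%classic.
Local Notation Lp := (Lp a b p).
Local Notation Lnm := (Lnm a b p).

(** Away from 0 the power is differentiable; at 0 it is squeezed by |y|^p <= |y| for |y| <= 1. *)
Lemma continuous_norm_powR : continuous (fun x : R => `|x| `^ p).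
Proof.
move=> x; have [->|x0] := eqVneq x 0.
  rewrite /continuous_at normr0 powR0 ?gt_eqF ?(lt_le_trans ltr01 p1)//.
  apply: (@squeeze_cvgr _ _ _ _ (cst 0) (fun x => `|x|)).
  - near=> y; rewrite powR_ge0/=.
    have y1 : `|y| <= 1.
      near: y; exists 1 => //= z.
      by rewrite /ball_/= sub0r normrN => /ltW.
    have [->|y0] := eqVneq y 0.
      by rewrite normr0 powR0// gt_eqF ?(lt_le_trans ltr01 p1).
    by rewrite ge1r_powR// normr_gt0 y0 y1.
  - exact: cvg_cst.
  - by have := @norm_continuous _ _ (0 : R); rewrite /continuous_at normr0.
apply: (@continuous_comp _ _ _ (@Num.norm _ R) (@powR R ^~ p)).
  exact: norm_continuous.
apply/differentiable_continuous/derivable1_diffP/derivable_powR.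
by rewrite in_itv/= andbT normr_gt0.
Unshelve. all: by end_near. Qed.

Lemma Lp_sub u v : Lp u -> Lp v ->
  Lp (fun t => u t - v t) /\ Lnm (fun t => u t - v t) <= Lnm u + Lnm v.
Proof.
move=> Lu Lv; have [LN EN] := Lp_scale p1 (-1) Lv.
have [LB EB] := Lp_add p1 Lu LN.
have E : (fun t => u t - v t) = (fun t => u t + -1 * v t).
  by apply/funext => t; rewrite mulN1r.
by rewrite E; split => //; rewrite (le_trans EB)// EN normrN normr1 mul1r.
Qed.

Lemma geo2_sum (C : R) i j : 0 <= C ->
  \sum_(i <= k < j) C * 2^-1 ^+ k <= 2 * C * 2^-1 ^+ i.
Proof.
move=> C0; have [ij|ji] := leqP i j; last first.
  by rewrite big_geq ?(ltnW ji)// !mulr_ge0// exprn_ge0// invr_ge0.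
suff -> : \sum_(i <= k < j) C * 2^-1 ^+ k =
    2 * C * 2^-1 ^+ i - 2 * C * 2^-1 ^+ j.
  by rewrite gerBl !mulr_ge0// exprn_ge0// invr_ge0.
rewrite -opprB -(telescope_sumr (fun k => 2 * C * 2^-1 ^+ k) ij) -sumrN.
apply: eq_bigr => k _; rewrite exprS; set x := _ ^+ k; by field.
Qed.

Lemma Lp_geo_cauchy (u_ : nat -> R -> R) (C : R) : 0 <= C ->
  (forall i, Lp (u_ i)) ->
  (forall i, Lnm (fun t => u_ i.+1 t - u_ i t) <= C * 2^-1 ^+ i) ->
  forall i j, (i <= j)%N ->
  Lp (fun t => u_ j t - u_ i t) /\ Lnm (fun t => u_ j t - u_ i t) <= 2 * C * 2^-1 ^+ i.
Proof.
move=> C0 Lu du i j ij; split; first exact: (Lp_sub (Lu j) (Lu i)).1.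
apply: le_trans (geo2_sum i j C0); rewrite -(subnKC ij).
elim: (j - i)%N => [|k IH]; rewrite ?addn0 ?addnS.
  rewrite big_geq// (_ : (fun t => _) = (fun t => 0 * u_ i t)); last first.
    by apply/funext => t; rewrite subrr mul0r.
  by rewrite (Lp_scale p1 0 (Lu i)).2 normr0 mul0r.
rewrite big_nat_recr ?leq_addr//=.
have [L1 _] := Lp_sub (Lu (i + k)%N) (Lu i).
have [L2 _] := Lp_sub (Lu (i + k).+1) (Lu (i + k)%N).
have [_] := Lp_add p1 L1 L2.
rewrite (_ : (fun t => _ + _) = (fun t => u_ (i + k).+1 t - u_ i t)); last first.
  by apply/funext => t; ring.
by move=> /le_trans; apply; rewrite lerD// du.
Qed.

(** Riesz-Fischer: the sum [S] of the absolute increments is integrable, hence finite a.e., so the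
    sequence converges absolutely off a null set. Fatou's lemma carries the norm bounds to the
    limit. *)
Lemma Lp_complete (u_ : nat -> R -> R) (C : R) : 0 <= C ->
  (forall i, Lp (u_ i)) ->
  (forall i, Lnm (fun t => u_ i.+1 t - u_ i t) <= C * 2^-1 ^+ i) ->
  exists2 u, Lp u &
    forall i, Lnm (fun t => u t - u_ i t) <= 2 * C * 2^-1 ^+ i.
Proof.
move=> C0 Lu du.
have mu_ i : measurable_fun I (u_ i) by exact: Lp_measurable (Lu i).
pose d (i : nat) (t : R) : R := `|u_ i.+1 t - u_ i t|.
have md i : measurable_fun I (fun t => (d i t)%:E).
  apply/measurable_EFinP; apply: measurableT_comp => //.
  exact: measurable_funB.
have d0 i t : (0 <= (d i t)%:E)%E by rewrite lee_fin normr_ge0.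
pose S t := (\sum_(0 <= i <oo) (d i t)%:E)%E.
have mS : measurable_fun I S.
  exact: ge0_emeasurable_sum.
have intd i : (\int[mu]_(t in I) (d i t)%:E <= (L1c a b * C * 2^-1 ^+ i)%:E)%E.
  have [Li _] := Lp_sub (Lu i.+1) (Lu i).
  have := int_abs_le_Lnm ab p1 Li; rewrite -lee_fin /Rintegral fineK; last first.
    have /integrableP[_] := Lp_integrable ab p1 Li.
    by rewrite ge0_fin_numE// integral_ge0.
  move=> /le_trans; apply; rewrite lee_fin -mulrA ler_wpM2l ?du//.
  exact/ltW/L1c_gt0.
have intS : mu.-integrable I S.
  apply/integrableP; split => //.
  under eq_integral.
    move=> t _; rewrite gee0_abs; first over.
    by apply: nneseries_ge0 => i _ _; rewrite lee_fin normr_ge0.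
  rewrite /S integral_nneseries; [|by []|exact: md|by move=> i t _; exact: d0].
  apply: (@le_lt_trans _ _ (2 * (L1c a b * C))%:E); last exact: ltry.
  apply: lime_le.
    by apply: is_cvg_nneseries => i _ _; apply: integral_ge0 => t _.
  apply: nearW => n; apply: (@le_trans _ _ (\sum_(0 <= i < n)
     (L1c a b * C * 2^-1 ^+ i)%:E)%E); first by apply: lee_sum => i _.
  rewrite sumEFin lee_fin; apply: le_trans (geo2_sum _ _ _) _.
    by rewrite mulr_ge0// ltW// L1c_gt0.
  by rewrite expr0 mulr1.
have Sfin : {ae mu, forall t, I t -> S t \is a fin_num}.
  exact: integrable_ae.
pose F := I `&` [set t | S t \is a fin_num].
have mF : measurable F by exact: emeasurable_fin_num.
have cvgF t : F t -> cvgn (u_ ^~ t).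
  move=> [_ /= St].
  have cd : cvgn [normed series (fun i => u_ i.+1 t - u_ i t)].
    apply: nondecreasing_is_cvgn.
      by apply: nondecreasing_series => i _ _ /=.
    exists (fine (S t)) => _ [n _ <-]; rewrite -lee_fin fineK//.
    rewrite /series/= -sumEFin; apply: nneseries_lim_ge => i _ _; exact: d0.
  have -> : u_ ^~ t = series (fun i => u_ i.+1 t - u_ i t) \+ cst (u_ 0%N t).
    by apply/funext => n /=; rewrite /series/= telescope_sumr// subrK.
  by apply: is_cvgD; [exact: normed_cvg|exact: is_cvg_cst].
(* Set to 0 off [F], the sequence converges at every point of I, so its limit is measurable. *)
pose w i := u_ i \_ F.
have wu : {ae mu, forall t, I t -> forall i, u_ i t = w i t}.
  by apply: leb_aeS Sfin => t St It i; rewrite /w patchE mem_set//; split=> //; exact: St.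
have mw i : measurable_fun I (w i).
  apply/(measurable_restrict _ _ _).1 => //.
  by apply: measurable_funS (mu_ i) => // t [[]].
pose u : R -> R := fun t => limn (w ^~ t).
have cu t : I t -> w ^~ t @ \oo --> u t.
  move=> It; rewrite /u.
  suff : cvgn (w ^~ t) by [].
  rewrite (_ : (fun i => _) = if t \in F then u_ ^~ t else cst 0); last first.
    by apply/funext => i; rewrite /w patchE; case: ifPn.
  case: ifPn => [/set_mem Ft|_]; first exact: cvgF.
  exact: is_cvg_cst.
have mu0 : measurable_fun I u by exact: (@measurable_fun_cvg _ _ _ _ w).
have Lw i : Lp (w i).
  apply: (Lp_ae p1 (mw i) (Lu i) _).1.
  by apply: leb_aeS wu => t h It; exact: h.
have key (i : nat) :
    (Lpow a b p (fun t => (u t - w i t)%R) <= ((2 * C * 2^-1 ^+ i) `^ p)%:E)%E.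
  pose f (j : nat) (t : R) := (`|w j t - w i t| `^ p)%:E.
  have mf j : measurable_fun I (f j).
    by apply: emeasurable_powR_norm; exact: measurable_funB.
  have f0 j t : I t -> (0 <= f j t)%E by move=> _; rewrite lee_fin powR_ge0.
  have -> : Lpow a b p (fun t => u t - w i t) =
      (\int[mu]_(t in I) limn_einf (f ^~ t))%E.
    rewrite LpowE; apply: eq_integral => t /set_mem It.
    apply/esym; apply: (cvg_limn_einf_sup _).1.
    apply: cvg_EFin; first exact: nearW.
    have cw : (w j t - w i t) @[j --> \oo] --> u t - w i t.
      by apply: cvgB; [exact: cu|exact: cvg_cst].
    exact: (cvg_comp _ _ cw (continuous_norm_powR (x := _))).
  apply: (le_trans (fatou mu _ mf f0)) => //.
  rewrite limn_einf_lim; apply: lime_le; first exact: is_cvg_einfs.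
  apply: nearW => n.
  (* The infimum over the tail from [n] on is at most its value at an index that is also at least
     [i], where the Cauchy bound applies. *)
  apply: (@le_trans _ _ (\int[mu]_(t in I) f (maxn n i) t)%E).
    by apply: ereal_inf_lbound; exists (maxn n i) => //=; rewrite leq_maxl.
  have [L E] := Lp_geo_cauchy C0 Lu du (leq_maxr n i).
  have [L1 E1] : Lp (fun t => w (maxn n i) t - w i t) /\
      Lnm (fun t => w (maxn n i) t - w i t) =
      Lnm (fun t => u_ (maxn n i) t - u_ i t).
    apply: (Lp_ae p1 _ L); first exact: measurable_funB.
    by apply: leb_aeS wu => t h It; rewrite !h.
  rewrite -(LpowE a b p (fun t => (w (maxn n i) t - w i t)%R)).
  rewrite -(Lnm_powR p1 L1) E1 lee_fin ge0_ler_powR ?nnegrE ?Lnm_ge0//.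
    by rewrite (le_trans ler01).
  by rewrite !mulr_ge0// exprn_ge0// invr_ge0.
have Ldi i : Lp (fun t => u t - w i t).
  apply: LpI; first exact: measurable_funB.
  exact: le_lt_trans (key i) (ltry _).
exists u.
  have [L _] := Lp_add p1 (Ldi 0%N) (Lw 0%N); apply: (Lp_eq p1 _ L).1 => t _.
  by rewrite subrK.
move=> i.
have [_ ->] : Lp (fun t => u t - u_ i t) /\
    Lnm (fun t => u t - u_ i t) = Lnm (fun t => u t - w i t).
  apply: (Lp_ae p1 _ (Ldi i)); first exact: measurable_funB.
  by apply: leb_aeS wu => t h It; rewrite h.
apply: (Lnm_le_integral p1 (Ldi i)) => //.
by rewrite !mulr_ge0// exprn_ge0// invr_ge0.
Qed.

End Lp_complete.

(** * Primitives *)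

Section primitive.
Variables (R : realType) (a b : R).
Hypothesis ab : a < b.
Implicit Types f g h x y : R -> R.
Local Notation mu := (@lebesgue_measure R).
Local Notation I := `[a, b]%classic.

Definition integ g := mu.-integrable I (EFin \o g).

Fact pint_key : unit. Proof. by []. Qed.

Definition pint : (R -> R) -> R -> R := locked_with pint_key
  (fun g t => \int[mu]_(s in `[a, t]) g s).

Lemma pintE g t : pint g t = \int[mu]_(s in `[a, t]) g s.
Proof. by rewrite /pint unlock. Qed.

Lemma ItvP t : I t <-> a <= t <= b.
Proof. by rewrite /= in_itv. Qed.

Lemma I_a : I a. Proof. by apply/ItvP; rewrite lexx ltW. Qed.
Lemma I_b : I b. Proof. by apply/ItvP; rewrite lexx ltW. Qed.

Lemma sub_itv t : I t -> `[a, t] `<=` I.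
Proof. by move=> /ItvP/andP[_ tb]; apply: subset_itvl; rewrite bnd_simp. Qed.

Lemma integS g t : integ g -> I t -> mu.-integrable `[a, t] (EFin \o g).
Proof. by move=> ig It; apply: integrableS ig => //; exact: sub_itv. Qed.

Lemma integ_measurable g : integ g -> measurable_fun I g.
Proof. by move=> /integrableP[] /measurable_EFinP. Qed.

Lemma integ_lin (c : R) f g : integ f -> integ g ->
  integ (fun t => c * f t + g t).
Proof.
move=> fi gi; rewrite /integ.
rewrite (_ : _ \o _ = (fun t => c%:E * (f t)%:E + (g t)%:E)%E)//.
by apply: integrableD => //; exact: integrableZl.
Qed.

Lemma integ_abs g : integ g -> integ (fun t => `|g t|).
Proof. by move=> ig; exact: integrable_norm ig. Qed.

Lemma EFin_pint g t : integ g -> I t ->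
  (\int[mu]_(s in `[a, t]) (g s)%:E)%E = (pint g t)%:E.
Proof.
move=> gi It; rewrite pintE /Rintegral fineK//.
by apply: integrable_fin_num => //; exact: integS.
Qed.

Lemma pint_a g : pint g a = 0.
Proof. by rewrite pintE set_itv1 Rintegral_set1. Qed.

Lemma pint_ae f g t : measurable_fun I f -> measurable_fun I g ->
  {ae mu, forall s, I s -> f s = g s} -> I t -> pint f t = pint g t.
Proof.
move=> mf mg fg It; rewrite !pintE; congr fine; apply: ae_eq_integral => //.
- by apply/measurable_EFinP; apply: measurable_funS mf => //; exact: sub_itv.
- by apply/measurable_EFinP; apply: measurable_funS mg => //; exact: sub_itv.
- by apply: leb_aeS fg => s h st; rewrite h//; apply: sub_itv st.
Qed.

Lemma pint_eq f g t : (forall s, I s -> f s = g s) -> I t ->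
  pint f t = pint g t.
Proof.
move=> fg It; rewrite !pintE; apply: eq_Rintegral => s; rewrite inE => st.
by rewrite fg//; apply: sub_itv st.
Qed.

Lemma pint_lin (c : R) f g t : integ f -> integ g -> I t ->
  pint (fun s => c * f s + g s) t = c * pint f t + pint g t.
Proof.
move=> fi gi It; rewrite !pintE RintegralD ?RintegralZl//; last 3 first.
- exact: integS.
- by apply: (integrableZl _ c (integS fi It)).
- exact: integS.
Qed.

Lemma integ0 : integ (fun=> 0). Proof. exact: integrable0. Qed.

Lemma pint0 t : pint (fun=> 0) t = 0.
Proof. by rewrite pintE Rintegral_cst// mul0r. Qed.

Lemma integZ c g : integ g -> integ (fun s => c * g s).
Proof. by move=> gi; exact: (integrableZl _ c gi). Qed.

Lemma pintZ c g t : integ g -> I t -> pint (fun s => c * g s) t = c * pint g t.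
Proof.
move=> gi It; rewrite -[RHS]addr0 -(pint0 t) -(pint_lin c gi integ0 It).
by apply: pint_eq It => s _; rewrite addr0.
Qed.

Lemma integD f g : integ f -> integ g -> integ (fun s => f s + g s).
Proof.
move=> fi gi; have := integ_lin 1 fi gi.
by congr integ; apply/funext => s; rewrite mul1r.
Qed.

Lemma pintD f g t : integ f -> integ g -> I t ->
  pint (fun s => f s + g s) t = pint f t + pint g t.
Proof.
move=> fi gi It; rewrite -[pint f t]mul1r -(pint_lin 1 fi gi It).
by apply: pint_eq It => s _; rewrite mul1r.
Qed.

Lemma pint_le f g t : integ f -> integ g -> (forall s, I s -> f s <= g s) ->
  I t -> pint f t <= pint g t.
Proof.
move=> fi gi fg It; rewrite !pintE; apply: le_Rintegral => //.
- exact: integS.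
- exact: integS.
- by move=> s st; apply: fg; apply: sub_itv st.
Qed.

Lemma pint_abs g t : integ g -> I t ->
  `|pint g t| <= pint (fun s => `|g s|) t.
Proof. by move=> gi It; rewrite !pintE; apply: le_normr_Rintegral => //; exact: integS. Qed.

Lemma pintB g s t : integ g -> I s -> I t -> s <= t ->
  pint g t - pint g s = \int[mu]_(u in `]s, t]) g u.
Proof.
move=> gi /ItvP/andP[as_ sb] It st; rewrite !pintE Rintegral_itvB//.
exact: integS.
Qed.

Lemma pint_mono g s t : integ g -> (forall u, I u -> 0 <= g u) ->
  I s -> I t -> s <= t -> pint g s <= pint g t.
Proof.
move=> gi g0 Is It st; rewrite -subr_ge0 pintB//; apply: Rintegral_ge0 => u.
move=> /=; rewrite in_itv/= => /andP[su ut]; apply: g0; apply/ItvP.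
move/ItvP: Is => /andP[as_ _]; move/ItvP: It => /andP[_ tb].
by rewrite (le_trans as_ (ltW su)) (le_trans ut tb).
Qed.

Lemma pint_ge0 g t : integ g -> (forall u, I u -> 0 <= g u) ->
  I t -> 0 <= pint g t.
Proof.
move=> gi g0 It; rewrite -(pint_a g); apply: pint_mono => //; first exact: I_a.
by move/ItvP: It => /andP[].
Qed.

Lemma pint_continuous g : integ g -> {within I, continuous (pint g)}.
Proof.
move=> gi.
rewrite (_ : pint g = (fun t => parameterized_integral mu a t g)).
  exact: (parameterized_integral_continuous (ltW ab) gi).
by apply/funext => t; rewrite pintE.
Qed.

End primitive.

(** * Integration by parts *)

Section integration_by_parts.
Variables (R : realType) (a b : R).
Hypothesis ab : a < b.
Implicit Types f g h x y : R -> R.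
Local Notation mu := (@lebesgue_measure R).
Local Notation I := `[a, b]%classic.
Local Notation integ := (integ a b).
Local Notation pint := (pint a).

Let triangle : set (R * R) := [set z | z.2 <= z.1].

Let measurable_triangle : measurable triangle.
Proof.
rewrite -[triangle]setTI.
rewrite (_ : triangle = (fun z : R * R => z.2 <= z.1) @^-1` [set true]); last first.
  by apply/seteqP; split.
exact: (measurable_fun_ler (measurable_snd) (measurable_fst)).
Qed.

(** Both sides are iterated integrals of f(x) g(y) over the triangle a <= y <= x <= t. *)
Lemma pint_parts_fubini f g t : integ f -> integ g -> I t ->
  \int[mu]_(s in `[a, t]) (f s * pint g s) =
  \int[mu]_(s in `[a, t]) (g s * (pint f t - pint f s)).
Proof.
move=> fi gi It.
pose J : set R := `[a, t]%classic.
have mJ : measurable J by exact: measurable_itv.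
have iJ h : integ h -> mu.-integrable setT (EFin \o (h \_ J)).
  move=> hi; rewrite -restrict_EFin.
  by apply/integrable_restrict => //; rewrite setTI; exact: integS hi It.
have fi' := iJ _ fi; have gi' := iJ _ gi.
have mf : measurable_fun setT (f \_ J) by move/integrableP : fi' => [] /measurable_EFinP.
have mg : measurable_fun setT (g \_ J) by move/integrableP : gi' => [] /measurable_EFinP.
pose H (z : R * R) := ((f \_ J) z.1 * (g \_ J) z.2 * \1_triangle z)%:E.
have mH : measurable_fun setT H.
  apply/measurable_EFinP; apply: measurable_funM; last exact: measurable_indic.
  apply: measurable_funM.
    exact: (measurableT_comp mf measurable_fst).
  exact: (measurableT_comp mg measurable_snd).
(* By Tonelli the double integral of |H| is at most the product of the two L_1 norms. *)
have iH : (mu \x mu)%E.-integrable setT H.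
  have [cr cE] : exists cr : R, (\int[mu]_y `|((g \_ J) y)%:E| = cr%:E)%E.
    move/integrableP : gi' => [_ ig]; exists (fine (\int[mu]_y `|((g \_ J) y)%:E|)%E).
    by rewrite fineK// ge0_fin_numE// integral_ge0.
  have cr0 : 0 <= cr by rewrite -lee_fin -cE integral_ge0.
  apply/integrable12ltyP; first exact: mH.
  apply: (@le_lt_trans _ _ (\int[mu]_x (cr%:E * `|((f \_ J) x)%:E|))%E).
    apply: ge0_le_integral => //.
    - by move=> x _; apply: integral_ge0.
    - apply: (@measurable_fun_fubini_tonelli_F _ _ _ _ R mu (abse \o H)).
        exact: measurableT_comp.
      by move=> z; exact: abse_ge0.
    - apply/measurable_EFinP; apply: measurable_funM => //; exact: measurableT_comp.
    - move=> x _; rewrite -cE muleC -ge0_integralZl//; last first.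
        by apply: measurableT_comp => //; exact/measurable_EFinP.
      apply: ge0_le_integral => //.
      - apply: measurableT_comp => //.
        exact: (measurableT_comp mH (pair1_measurable x)).
      - apply/measurable_EFinP/measurable_funM => //; exact: measurableT_comp.
      - move=> y _; rewrite /H/= -EFinM lee_fin !normrM.
        by rewrite ler_piMr// indicE; case: (_ \in _) => /=; rewrite ?normr1 ?normr0.
  rewrite ge0_integralZl//; last first.
    by apply: measurableT_comp => //; exact/measurable_EFinP.
  by move/integrableP : fi' => [_ ?]; rewrite lte_mul_pinfty.
have := Fubini iH.
under eq_integral => x _.
  rewrite (_ : integral _ _ _ =
      ((fun s => (f s * pint g s)%:E) \_ J) x); first over.
  rewrite patchE; case: ifPn => [/set_mem Jx|xJ]; last first.
    rewrite integral0_eq// => y _; rewrite /H /= patchE (negbTE xJ) !mul0r//.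
  have Ix : I x by exact: sub_itv Jx.
  rewrite EFinM -(EFin_pint gi Ix) -integralZl//; last exact: (integS gi Ix).
  rewrite [RHS]integral_mkcond; apply: eq_integral => y _.
  rewrite /H/= !patchE (mem_set Jx) indicE; move/ItvP : (Jx) => /andP[ax xt].
  have [yx|yx] := boolP (y \in `[a, x]%classic).
    have /ItvP/andP[ay yx'] := set_mem yx.
    rewrite (mem_set (_ : J y)) ?(mem_set (_ : triangle (x, y))) ?mulr1//.
    by apply/ItvP; rewrite ay (le_trans yx').
  have [ty|] := boolP ((x, y) \in triangle); rewrite ?mulr0//.
  rewrite ifF ?mulr0 ?mul0r//; apply/negP => /set_mem/ItvP/andP[ay yt].
  by case/negP : yx; rewrite inE; apply/ItvP; rewrite ay; exact: set_mem ty.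
under [X in _ = X -> _]eq_integral => y _.
  rewrite (_ : integral _ _ _ =
      ((fun s => (g s * (pint f t - pint f s))%:E) \_ J) y); first over.
  rewrite patchE; case: ifPn => [/set_mem Jy|yJ]; last first.
    by rewrite integral0_eq// => x _; rewrite /H /= [X in _ * X * _]patchE (negbTE yJ) mulr0 mul0r.
  have Iy : I y by exact: sub_itv Jy.
  move/ItvP : (Jy) => /andP[ay yt].
  have iyt : mu.-integrable `[y, t] (EFin \o f).
    apply: integrableS (integS fi It) => //.
    by apply: subset_itvr; rewrite bnd_simp.
  have -> : pint f t - pint f y = \int[mu]_(s in `[y, t]) f s.
    rewrite (pintB fi Iy It yt) Rintegral_itv_obnd_cbnd//.
    by apply: integrableS iyt => //; apply: subset_itvr; rewrite bnd_simp.
  rewrite /Rintegral EFinM fineK; last exact: integrable_fin_num.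
  rewrite -integralZl// [RHS]integral_mkcond; apply: eq_integral => x _.
  rewrite /H/= !patchE (mem_set Jy) indicE.
  have [yx|yx] := boolP (x \in `[y, t]%classic).
    have /ItvP/andP[ay' yx'] := set_mem yx.
    rewrite (mem_set (_ : J x)) ?(mem_set (_ : triangle (x, y))) ?mulr1//.
      by rewrite mulrC.
    by apply/ItvP; rewrite yx' (le_trans ay).
  have [ty|] := boolP ((x, y) \in triangle); rewrite ?mulr0//.
  rewrite ifF ?mulr0 ?mul0r//; apply/negP => /set_mem/ItvP/andP[ax xt].
  by case/negP : yx; rewrite inE; apply/ItvP; rewrite xt andbT; exact: set_mem ty.
move=> E; rewrite /Rintegral; congr fine.
by rewrite integral_mkcond [RHS]integral_mkcond.
Qed.

Lemma integ_mul_bounded (M : R) f g : integ f -> measurable_fun I g ->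
  (forall s, I s -> `|g s| <= M) -> integ (fun s => f s * g s).
Proof.
move=> fi mg gM; have mf := integ_measurable fi.
apply: (@le_integrable _ _ _ mu _ _ _ (fun s => (M * f s)%:E)) => //.
- by apply/measurable_EFinP; apply: measurable_funM.
- move=> s Is /=; rewrite lee_fin !normrM mulrC ler_wpM2r//.
  exact: le_trans (gM _ Is) (ler_norm _).
- exact: (integrableZl _ M fi).
Qed.

Lemma pint_measurable g : integ g -> measurable_fun I (pint g).
Proof.
by move=> gi; apply: subspace_continuous_measurable_fun => //; exact: pint_continuous.
Qed.

Lemma pint_bounded g s : integ g -> I s ->
  `|pint g s| <= pint (fun s => `|g s|) b.
Proof.
move=> gi Is; rewrite (le_trans (pint_abs gi Is))//.
apply: pint_mono (I_b ab) _ => //; first exact: integ_abs.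
by move/ItvP: Is => /andP[].
Qed.

(** In [pint_parts_fubini] the term with [pint f t] splits off as the product; what remains is the
    product rule in integrated form. *)
Lemma pint_parts f g t : integ f -> integ g -> I t ->
  pint f t * pint g t = pint (fun s => f s * pint g s + pint f s * g s) t.
Proof.
move=> fi gi It.
have ifg f' g' : integ f' -> integ g' -> integ (fun s => f' s * pint g' s).
  move=> fi' gi'; apply: integ_mul_bounded fi' (pint_measurable gi') _ => s Is.
  exact: pint_bounded.
have igf : integ (fun s => pint f s * g s).
  by have := ifg _ _ gi fi; congr integ; apply/funext => s; rewrite mulrC.
rewrite (pintD (ifg _ _ fi gi) igf It).
rewrite [X in _ = X + _]pintE (pint_parts_fubini fi gi It).
rewrite -(pintE a (fun s => g s * (pint f t - pint f s))).
rewrite -(pintD _ igf It); last first.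
  have := integ_lin (-1) igf (integZ (pint f t) gi).
  by congr integ; apply/funext => s; ring.
rewrite -(pintZ (pint f t) gi It); apply: pint_eq It => s _; ring.
Qed.

End integration_by_parts.

(** * Derivatives relative to [a, b] *)

Section derivative_on_itv.
Variables (R : realType) (a b : R).
Hypothesis ab : a < b.
Implicit Types f g h x y u v : R -> R.
Local Notation mu := (@lebesgue_measure R).
Local Notation I := `[a, b]%classic.
Local Notation D := (deriv_on a b).

Definition cont_on u := forall t, I t -> forall e, 0 < e ->
  exists2 d : R, 0 < d &
    forall s : R, I s -> `|s - t| < d -> `|u s - u t| < e.

Lemma cont_onP u : {within I, continuous u} -> cont_on u.
Proof.
move=> /subspace_continuousP cu t It e e0.
have /cvgrPdist_lt/(_ e e0) := cu t It.
move=> [d /= d0 dP]; exists d => // s Is st.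
by rewrite distrC; apply: dP => //=; rewrite distrC.
Qed.

Lemma deriv_on_eq u v t : (forall s, I s -> u s = v s) -> I t ->
  D u t = D v t.
Proof.
move=> uv It; rewrite /deriv_on; congr (lim _).
apply/seteqP; split; apply: near_eq_cvg;
  by apply: filterS (withinT I (dnbhs_filter t)) => s Is /=; rewrite !uv.
Qed.

(** Every point of I, endpoints included, is a limit of other points of I because a < b. Without
    this the limit in [deriv_on] would not be unique. *)
Lemma within_dnbhs_proper t : I t -> ProperFilter (within I t^').
Proof.
move=> It; apply: Build_ProperFilter_ex => P [d /= d0 dP].
(* A point of I on the right of t, or on the left if t = b, at distance at most d / 2 and cut off at
   the endpoint. *)
pose s : R := if t < b then Num.min b (t + d / 2) else Num.max a (t - d / 2).
have /andP[at_ tb] := (ItvP a b t).1 It.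
have s0 : s != t /\ I s /\ `|s - t| < d.
  rewrite /s; case: ifPn => tb'.
    rewrite /Num.min; case: ifPn => h.
      split; first by rewrite gt_eqF. 
      split; first exact: I_b.
      by rewrite gtr0_norm ?subr_gt0//; lra.
    rewrite -leNgt in h; split; first by rewrite gt_eqF//; lra.
    split; first by apply/ItvP; apply/andP; split => //; lra.
    by rewrite gtr0_norm; lra.
  have {}tb : t = b by apply/eqP; rewrite eq_le tb leNgt.
  have at' : a < t by rewrite tb.
  rewrite /Num.max; case: ifPn => h.
    split; first by rewrite lt_eqF//; lra.
    split; first by apply/ItvP; apply/andP; split => //; lra.
    by rewrite ltr0_norm; lra.
  rewrite -leNgt in h; split; first by rewrite lt_eqF//; lra.
  split; first exact: I_a.
  by rewrite ltr0_norm ?subr_lt0//; lra.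
case: s0 => st [Is sd]; exists s; apply: dP => //=; by rewrite distrC.
Qed.

Lemma deriv_onP u t l : I t ->
  (forall e, 0 < e -> exists2 d : R, 0 < d & forall s : R, I s -> s != t ->
     `|s - t| < d -> `|(u s - u t) / (s - t) - l| <= e) ->
  D u t = l.
Proof.
move=> It h; rewrite /deriv_on.
have PF := within_dnbhs_proper It.
apply: cvg_lim => //; apply/cvgrPdist_le => e e0.
have [d d0 dP] := h _ e0; exists d => //= s sd st Is.
by rewrite distrC; apply: dP => //; rewrite distrC.
Qed.

Lemma deriv_on_cauchy u t : I t ->
  cvg ((u s - u t) / (s - t) @[s --> within I t^']) ->
  forall e, 0 < e -> exists2 d : R, 0 < d & forall s s' : R,
    I s -> I s' -> s != t -> s' != t -> `|s - t| < d -> `|s' - t| < d ->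
   `|(u s - u t) / (s - t) - (u s' - u t) / (s' - t)| <= e.
Proof.
move=> It /cvg_ex[l /= /cvgrPdist_le hl] e e0.
have e20 : 0 < e / 2 by rewrite divr_gt0.
have [d /= d0 dP] := hl _ e20; exists d => // s s' Is Is' st s't sd s'd.
have H1 := dP s _ st Is; have H2 := dP s' _ s't Is'.
set X := _ / (s - t); set Y := _ / (s' - t).
have -> : X - Y = (l - Y) - (l - X) by ring.
rewrite (le_trans (ler_normB _ _))// [leRHS]splitr lerD//.
  by apply: H2 => /=; rewrite distrC.
by apply: H1 => /=; rewrite distrC.
Qed.

Lemma deriv_on_dvg u t :
  ~ cvg ((u s - u t) / (s - t) @[s --> within I t^']) -> D u t = point.
Proof. by move=> h; rewrite /deriv_on; apply: dvgP. Qed.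

Lemma integ_cst (c : R) : integ a b (fun=> c).
Proof. by apply: (Lp_integrable ab (lexx 1)); exact: Lp_cst. Qed.

Lemma pintB_near g (c e s1 s2 : R) : integ a b g -> I s1 -> I s2 -> s1 < s2 ->
  (forall u : R, s1 <= u <= s2 -> `|g u - c| <= e) ->
  `|(pint a g s2 - pint a g s1) / (s2 - s1) - c| <= e.
Proof.
move=> gi I1 I2 s12 gc; have ds : 0 < s2 - s1 by rewrite subr_gt0.
pose J := `]s1, s2]%classic.
have JI : J `<=` I.
  move=> u; rewrite /J /= in_itv/= => /andP[u1 u2]; apply/ItvP.
  have /andP[a1 _] := (ItvP a b s1).1 I1; have /andP[_ b2] := (ItvP a b s2).1 I2.
  by apply/andP; split; lra.
have iJ h : integ a b h -> mu.-integrable J (EFin \o h).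
  by move=> hi; apply: integrableS hi => //; exact: measurable_itv.
have mJ (k : R) : \int[mu]_(w in J) k = k * (s2 - s1).
  rewrite Rintegral_cst; last exact: measurable_itv.
  by rewrite /= lebesgue_measure_itv/= lte_fin s12.
have gci : integ a b (fun w => -1 * c + g w).
  by apply: integD => //; exact: integ_cst.
have E : pint a g s2 - pint a g s1 - c * (s2 - s1) =
    \int[mu]_(w in J) (-1 * c + g w).
  rewrite RintegralD; [|exact: measurable_itv|exact: (iJ _ (integ_cst _))|exact: iJ].
  rewrite mJ (pintB gi I1 I2 (ltW s12)) -/J; ring.
have -> : (pint a g s2 - pint a g s1) / (s2 - s1) - c =
    (pint a g s2 - pint a g s1 - c * (s2 - s1)) / (s2 - s1).
  by rewrite [RHS]mulrBl mulfK// gt_eqF.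
rewrite E normrM normfV (gtr0_norm ds) ler_pdivrMr//.
apply: (@le_trans _ _ (\int[mu]_(w in J) `|-1 * c + g w|)).
  by apply: le_normr_Rintegral (iJ _ gci); exact: measurable_itv.
rewrite -mJ; apply: le_Rintegral; first exact: measurable_itv.
- exact: (iJ _ (integ_abs gci)).
- exact: (iJ _ (integ_cst e)).
- move=> u; rewrite /J /= in_itv/= => /andP[u1 u2].
  by rewrite mulN1r addrC gc// u2 ltW.
Qed.

Lemma deriv_on_pint_cont g x : integ a b g -> cont_on g ->
  (forall t, I t -> x t = x a + pint a g t) ->
  forall t, I t -> D x t = g t.
Proof.
move=> gi cg xE t It; apply: deriv_onP => // e e0.
have [d d0 dP] := cg t It e e0; exists d => // s Is st sd.
have -> : x s - x t = pint a g s - pint a g t.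
  by rewrite (xE _ Is) (xE _ It); ring.
have /andP[at_ tb] := (ItvP a b t).1 It.
have /andP[as_ sb] := (ItvP a b s).1 Is.
have [ts|st'|/eqP] := ltgtP t s; last by rewrite eq_sym (negbTE st).
  apply: pintB_near => // u /andP[tu us]; apply/ltW/dP.
    by apply/ItvP/andP; split; lra.
  by rewrite ger0_norm; move: sd; rewrite ?gtr0_norm; lra.
rewrite -[X in `|X - _|]opprK -mulNr -mulrN -invrN !opprB.
apply: pintB_near => // u /andP[tu us]; apply/ltW/dP.
  by apply/ItvP/andP; split; lra.
by rewrite ler0_norm; move: sd; rewrite ?ltr0_norm; lra.
Qed.

(** The a.e. differentiation theorem is applied to integrals from -oo; extending g by zero outside I
    makes them agree with [pint] on I. *)
Lemma pint_patch g s : I s ->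
  \int[mu]_(w in `]-oo, s]) (g \_ I) w = pint a g s.
Proof.
move=> Is; rewrite pintE Rintegral_mkcond [RHS]Rintegral_mkcond.
have /andP[as_ sb] := (ItvP a b s).1 Is.
apply: eq_Rintegral => w _; rewrite !patchE.
have [wI|wI] := boolP (w \in I).
  congr (if _ then _ else _); have /ItvP/andP[aw wb] := set_mem wI.
  by apply/idP/idP; rewrite !inE /= !in_itv/= aw.
rewrite if_same; case: ifPn => // /set_mem/ItvP/andP[aw ws].
by case/negP: wI; rewrite inE; apply/ItvP; rewrite aw (le_trans ws).
Qed.

(** Lebesgue differentiation gives a two-sided derivative a.e.; the relative derivative uses a
    subset of the same quotients and has the same value. *)
Lemma deriv_on_pint_ae g x : integ a b g ->
  (forall t, I t -> x t = x a + pint a g t) ->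
  {ae mu, forall t, I t -> D x t = g t}.
Proof.
move=> gi xE.
have igI : mu.-integrable setT (EFin \o (g \_ I)).
  by rewrite -restrict_EFin; apply/integrable_restrict => //; rewrite setTI.
have := @FTC1Ny R (g \_ I) _ (integrable_locally _ gi).
have iNy (s : R) : mu.-integrable `]-oo, s] (EFin \o g \_ I).
  by apply: integrableS igI.
move=> /(_ iNy (measurable_itv _)) /=.
set F := (fun _ => Rintegral _ _ _).
apply: leb_aeS => t [dF F't] It; apply: deriv_onP => // e e0.
have : h^-1 *: ((F \o shift t) (h *: 1) - F t) @[h --> (0 : R)^'] --> g t.
  have -> : g t = (g \_ I) t by rewrite patchE mem_set.
  by rewrite -F't derive1E; exact: dF.
move=> /cvgrPdist_le/(_ _ e0)[d /= d0 dP]; exists d => // s Is st sd.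
have /= := dP (s - t).
rewrite sub0r normrN subr_eq0 => /(_ sd st).
have FE w : I w -> F w = pint a g w by exact: pint_patch.
rewrite /GRing.scale/= mulr1 subrK !FE// distrC.
rewrite (xE _ Is) (xE _ It) mulrC.
by rewrite (_ : x a + pint a g s - (x a + pint a g t) = pint a g s - pint a g t); last ring.
Qed.

End derivative_on_itv.

(** * Measurability of the relative derivative *)

Section measurable_derivative.
Variables (R : realType) (a b : R).
Hypothesis ab : a < b.
Local Notation mu := (@lebesgue_measure R).
Local Notation I := `[a, b]%classic.
Local Notation D := (deriv_on a b).

(** Projection onto [a, b]: composing with it extends [x] continuously to the line, so that
    difference quotients with any step are continuous functions. *)
Let clamp (t : R) : R := if t < a then a else if b < t then b else t.

Let clampI t : I (clamp t).
Proof.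
have ab' := ab; apply/ItvP/andP; rewrite /clamp.
by case: (ltP t a) => ?; case: (ltP b t) => ?; split; lra.
Qed.

Let clamp_id t : I t -> clamp t = t.
Proof. by move=> /ItvP/andP[at_ tb]; rewrite /clamp !ltNge at_ tb. Qed.

Let clamp_dist s t : `|clamp s - clamp t| <= `|s - t|.
Proof.
have ab' := ab; have h1 := ler_norm (s - t); have h2 := ler_norm (t - s).
rewrite distrC in h2; rewrite ler_norml /clamp; apply/andP.
by case: (ltP t a) => ?; case: (ltP b t) => ?; case: (ltP s a) => ?;
  case: (ltP b s) => ?; split; lra.
Qed.

Let continuous_clamp x : cont_on a b x -> continuous (x \o clamp).
Proof.
move=> cx t; apply/cvgrPdist_lt => e e0.
have [d d0 dP] := cx _ (clampI t) _ e0.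
exists d => //= s; rewrite /ball_/= => st; rewrite distrC; apply: dP => //.
by rewrite (le_lt_trans (clamp_dist _ _))// distrC.
Qed.

Variable x : R -> R.
Hypothesis cx : cont_on a b x.

Let q (h t : R) : R := (x (clamp (t + h)) - x (clamp t)) / h.

Let continuous_q h : continuous (q h).
Proof.
move=> t; rewrite /q; apply: cvgMl; apply: cvgB; last exact: continuous_clamp.
apply: (@continuous_comp _ _ _ (fun t => t + h) (x \o clamp)).
  by apply: cvgD; [exact: cvg_id|exact: cvg_cst].
exact: continuous_clamp.
Qed.

(** Points where any two quotients with steps below 1/(l+1) differ by at most 1/(k+1). Each pair of
    steps gives a closed condition, so this uncountable intersection is closed, and [E], where the
    quotients are Cauchy, is Borel. *)
Let E0 (k l : nat) : set R :=
  \bigcap_(h in [set h | h != 0 /\ `|h| < l.+1%:R^-1])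
  \bigcap_(h' in [set h | h != 0 /\ `|h| < l.+1%:R^-1])
    [set t : R | `|q h t - q h' t| <= k.+1%:R^-1].

Let E : set R := \bigcap_k \bigcup_l E0 k l.

Let measurable_E : measurable E.
Proof.
apply: bigcapT_measurable => k; apply: bigcupT_measurable => l.
apply: closed_measurable; apply: closed_bigI => h _; apply: closed_bigI => h' _.
rewrite (_ : [set _ | _] = (fun t => `|q h t - q h' t|) @^-1` [set y | y <= k.+1%:R^-1]);
  last by [].
apply: closed_comp; last exact: closed_le.
move=> t _; apply: (@continuous_comp _ _ _ (fun t => q h t - q h' t) (@Num.norm _ R)).
  by apply: cvgB; exact: continuous_q.
exact: norm_continuous.
Qed.

Let inv_lt (e : R) : 0 < e -> exists k, k.+1%:R^-1 < e.
Proof. by move=> /ltr_add_invr[k]; rewrite add0r; exists k. Qed.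

Let q_in_E t (k l n : nat) h : E0 k l t -> h != 0 -> `|h| < l.+1%:R^-1 ->
  (l < n)%N -> `|q h t - q n.+1%:R^-1 t| <= k.+1%:R^-1.
Proof.
move=> El h0 hl ln; apply: El => /=; first by split.
split; first by rewrite invr_eq0 pnatr_eq0.
by rewrite gtr0_norm ?invr_gt0// ltf_pV2 ?posrE// ltr_nat.
Qed.

Let q_cvg t : I t -> E t -> q n.+1%:R^-1 t @[n --> \oo] --> D x t.
Proof.
move=> It Et.
have : cvg (q n.+1%:R^-1 t @[n --> \oo]).
  apply: cauchy_cvg; apply: cauchy_exP => e e0.
  have [k ke] := inv_lt e0; have [l _ El] := Et k Logic.I.
  exists (q l.+2%:R^-1 t); exists l.+1 => // n /= ln.
  rewrite /ball/=; apply: le_lt_trans ke; apply: q_in_E El _ _ _ => //.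
  by rewrite gtr0_norm ?invr_gt0// ltf_pV2 ?posrE// ltr_nat.
move=> /cvg_ex[c qc]; rewrite (_ : D x t = c)//.
apply: (deriv_onP ab It) => e e0.
have e20 : 0 < e / 2 by rewrite divr_gt0.
have [k ke] := inv_lt e20; have [l _ El] := Et k Logic.I.
exists l.+1%:R^-1; first by rewrite invr_gt0.
move=> s Is st sd.
have -> : (x s - x t) / (s - t) = q (s - t) t.
  by rewrite /q [t + _]addrC subrK !clamp_id.
move/cvgrPdist_le : qc => /(_ _ e20)[N _ qN].
have := qN (maxn N l.+1) (leq_maxl _ _) => /= h1.
have h2 : `|q (s - t) t - q (maxn N l.+1).+1%:R^-1 t| <= k.+1%:R^-1.
  by apply: q_in_E El _ _ _ => //; [rewrite subr_eq0|exact: leq_maxr].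
rewrite -(subrKA (q (maxn N l.+1).+1%:R^-1 t)) (le_trans (ler_normD _ _))//.
rewrite [leRHS]splitr lerD//; first exact: le_trans h2 (ltW ke).
by rewrite distrC.
Qed.

(** At an interior point t + h stays in I for small steps, so clamping does not alter the
    quotients. *)
Let E_of_cvg t : a < t < b ->
  cvg ((x s - x t) / (s - t) @[s --> within I t^']) -> E t.
Proof.
move=> /andP[at_ tb]; have It : I t by apply/ItvP; rewrite !ltW.
move=> /(deriv_on_cauchy It) h k _.
have k0 : 0 < k.+1%:R^-1 :> R by rewrite invr_gt0.
have [d d0 dP] := h _ k0.
have r0 : 0 < Num.min d (Num.min (t - a) (b - t)).
  by rewrite !lt_min d0 !subr_gt0 at_ tb.
have [l lr] := inv_lt r0; exists l => // h1 [h10 h1l] h2 [h20 h2l] /=.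
have aux h' : `|h'| < l.+1%:R^-1 -> I (t + h') /\ `|h'| < d.
  move=> /lt_trans/(_ lr); rewrite !lt_min => /andP[hd /andP[ha hb]].
  split => //.
  have k1 := ler_norm h'; have k2 := ler_norm (- h'); rewrite normrN in k2.
  by apply/ItvP/andP; split; lra.
have [I1 d1] := aux _ h1l; have [I2 d2] := aux _ h2l.
have := dP (t + h1) (t + h2) I1 I2; rewrite /q !clamp_id//.
rewrite [t + h1 - t]addrAC [t + h2 - t]addrAC subrr !add0r.
have tne h' : h' != 0 -> t + h' != t.
  by apply: contra_neq => th; rewrite -(addKr t h') th addNr.
by apply => //; exact: tne.
Qed.

(** The two endpoints do not affect measurability. At interior points of [E] the derivative is the
    limit of the quotients with step 1/(n+1); off [E] the defining limit does not exist and the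
    derivative is the default value [point]. *)
Lemma measurable_deriv_on : measurable_fun I (D x).
Proof.
apply: (@measurable_fun_itv_cc _ _ _ false true).
pose hn (n : nat) t := \1_E t * (q n.+1%:R^-1 t - point) + point.
apply: (@measurable_fun_cvg _ _ _ _ hn).
  move=> n; apply: (@measurable_funS _ _ _ _ setT) => //.
  apply: measurable_funD => //; apply: measurable_funM.
    exact: measurable_indic.
  apply: measurable_funB => //; exact: continuous_measurable_fun.
move=> t; rewrite /= in_itv /= => tab.
have It : I t by move/andP : tab => [? ?]; apply/ItvP; rewrite !ltW.
rewrite /hn indicE; have [/set_mem Et|Et] := boolP (t \in E).
  under eq_fun do rewrite mul1r subrK.
  exact: q_cvg.
under eq_fun do rewrite mul0r add0r.
rewrite deriv_on_dvg; first exact: cvg_cst.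
by move=> /(E_of_cvg tab) Et'; case/negP : Et; rewrite inE.
Qed.

End measurable_derivative.

(** * Sobolev spaces of real functions *)

Section Sobolev.
Variables (R : realType) (a b p : R).
Hypotheses (ab : a < b) (p1 : 1 <= p).
Implicit Types f g x y : R -> R.
Local Notation mu := (@lebesgue_measure R).
Local Notation I := `[a, b]%classic.
Local Notation D := (deriv_on a b).
Local Notation Lp := (Lp a b p).
Local Notation Lnm := (Lnm a b p).
Local Notation pint := (pint a).
Local Notation integ := (integ a b).
Local Notation L1c := (L1c a b).

(** Recursive form of the Sobolev space; [W_iter] unfolds it into conditions on all iterated
    derivatives. *)
Fixpoint W k x : Prop :=
  if k is k'.+1 then (forall t, I t -> x t = x a + pint (D x) t) /\ W k' (D x)
  else Lp x.

(* Equivalent to the usual Sobolev norm, and better suited to induction on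
   the order. *)
Fixpoint NW k x : R := if k is k'.+1 then `|x a| + NW k' (D x) else Lnm x.

(** Equality of elements of W^k: a.e. in L_p, pointwise on I for k >= 1, where functions are
    continuous. It is also the sense in which the differential equation holds. *)
Definition eqW (T : Type) k (x y : R -> T) : Prop :=
  if k is 0 then {ae mu, forall t, I t -> x t = y t}
  else forall t, I t -> x t = y t.

Lemma NW_ge0 k x : 0 <= NW k x.
Proof. by elim: k x => [|k IH] x /=; [exact: Lnm_ge0|rewrite addr_ge0]. Qed.

Lemma eqW_pt (T : Type) k (x y : R -> T) : (forall t, I t -> x t = y t) -> eqW k x y.
Proof. by case: k => [|k] //= h; apply: aeW. Qed.

Lemma eqW_sym (T : Type) k (x y : R -> T) : eqW k x y -> eqW k y x.
Proof.
by case: k => [|k] /= h; [apply: leb_aeS h => t h It|move=> t It]; rewrite h.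
Qed.

Lemma eqW_trans (T : Type) k (x y z : R -> T) : eqW k x y -> eqW k y z -> eqW k x z.
Proof.
case: k => [|k] /= h1 h2; last by move=> t It; rewrite h1// h2.
by apply: leb_aeS2 h1 h2 => t h1 h2 It; rewrite h1// h2.
Qed.

Lemma eqW_comp (T U : Type) k (op : T -> U) (x x' : R -> T) : eqW k x x' ->
  eqW k (fun t => op (x t)) (fun t => op (x' t)).
Proof.
case: k => [|k] /= h1; last by move=> t It; rewrite h1.
by apply: leb_aeS h1 => t h1 It; rewrite h1.
Qed.

Lemma eqW_comp2 (T U V : Type) k (op : T -> U -> V) (x x' : R -> T)
    (y y' : R -> U) : eqW k x x' -> eqW k y y' ->
  eqW k (fun t => op (x t) (y t)) (fun t => op (x' t) (y' t)).
Proof.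
case: k => [|k] /= h1 h2; last by move=> t It; rewrite h1// h2.
by apply: leb_aeS2 h1 h2 => t h1 h2 It; rewrite h1// h2.
Qed.

Lemma eqW_le (T : Type) j k (x y : R -> T) : (j <= k)%N -> eqW k x y -> eqW j x y.
Proof.
case: k => [|k]; first by rewrite leqn0 => /eqP ->.
by move=> _ h; exact: eqW_pt.
Qed.

Lemma pint_integ g : integ g -> integ (pint g).
Proof.
move=> gi; have := integ_mul_bounded (integ_cst ab 1) (pint_measurable ab gi)
  (fun s => pint_bounded ab gi (s := s)).
by congr integ; apply/funext => t; rewrite mul1r.
Qed.

Lemma integ_eq f g : (forall t, I t -> f t = g t) -> integ f -> integ g.
Proof.
move=> fg; apply: eq_integrable => // t /set_mem It /=.
by rewrite fg.
Qed.

Lemma W_integ k x : W k x -> integ x.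
Proof.
elim: k x => [|k IH] x /=; first exact: Lp_integrable.
move=> [xE /IH ix]; have := integD (integ_cst ab (x a)) (pint_integ ix).
by apply: integ_eq => t It; rewrite -xE.
Qed.

Lemma W_measurable k x : W k x -> measurable_fun I x.
Proof. by move/W_integ/integ_measurable. Qed.

Lemma cont_on_pint g : integ g -> cont_on a b (pint g).
Proof. by move=> gi; apply: cont_onP; exact: pint_continuous. Qed.

Lemma cont_on_prim g x : integ g -> (forall t, I t -> x t = x a + pint g t) ->
  cont_on a b x.
Proof.
move=> gi xE t It e e0; have [d d0 dP] := cont_on_pint gi It e0.
exists d => // s Is sd; rewrite (xE _ Is) (xE _ It).
by rewrite [X in `|X|](_ : _ = pint g s - pint g t) ?dP//; ring.
Qed.

Lemma W_cont k x : W k.+1 x -> cont_on a b x.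
Proof. by move=> [xE /W_integ ix]; exact: cont_on_prim xE. Qed.

Lemma W_pt k x y : (forall t, I t -> x t = y t) -> W k x ->
  W k y /\ NW k y = NW k x.
Proof.
elim: k x y => [|k IH] x y xy /=.
  by move=> Lx; apply: (Lp_eq p1) Lx => t /set_mem; exact: xy.
move=> [xE Wx].
have Dxy t : I t -> D x t = D y t by exact: deriv_on_eq.
have xya : x a = y a by apply: xy; exact: I_a.
have [Wy ->] := IH _ _ Dxy Wx.
rewrite -xya; split => //; split => // t It.
by rewrite -xy// -(pint_eq Dxy)// -xE.
Qed.

Lemma W_eqW k x y : W k x -> eqW k x y -> measurable_fun I y ->
  W k y /\ NW k y = NW k x.
Proof.
case: k => [|k] Wx xy my; last exact: W_pt xy Wx.
exact: (Lp_ae p1 my Wx xy).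
Qed.

(** The derivative of a primitive is its integrand: a.e. by Lebesgue differentiation for k = 0,
    everywhere by continuity of g otherwise. For k = 0 the derivative must also be measurable on the
    points where it may differ from g. *)
Lemma W_prim k g x : W k g -> (forall t, I t -> x t = x a + pint g t) ->
  [/\ W k.+1 x, eqW k (D x) g & NW k.+1 x = `|x a| + NW k g].
Proof.
move=> Wg xE; have gi := W_integ Wg.
have mDx : measurable_fun I (D x).
  by apply: measurable_deriv_on => //; exact: cont_on_prim gi xE.
have eDx : eqW k (D x) g.
  case: k Wg => [|k] Wg; first exact: deriv_on_pint_ae.
  by move=> t It; apply: deriv_on_pint_cont => //; exact: W_cont Wg.
have [WDx NDx] := W_eqW Wg (eqW_sym eDx) mDx.
split => //=; last by rewrite NDx.
split=> // t It; rewrite xE//; congr (_ + _).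
by apply: pint_ae It => //; [exact: integ_measurable|exact: (eqW_le (leq0n k) (eqW_sym eDx))].
Qed.

Lemma W_lin_le k (c : R) x y : W k x -> W k y ->
  [/\ W k (fun t => c * x t + y t),
      NW k (fun t => c * x t + y t) <= `|c| * NW k x + NW k y &
      k != 0%N -> eqW k.-1 (D (fun t => c * x t + y t))
        (fun t => c * D x t + D y t)].
Proof.
elim: k x y => [|k IH] x y.
  move=> /= Lx Ly; have [Lcx Ncx] := Lp_scale p1 c Lx.
  by have [L E] := Lp_add p1 Lcx Ly; split => //; rewrite -Ncx.
move=> [xE Wx] [yE Wy]; have [W1 N1 _] := IH _ _ Wx Wy.
have [|W2 e2 N2] := W_prim (x := fun t => c * x t + y t) W1.
  move=> t It; rewrite (xE _ It) (yE _ It).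
  by rewrite (pint_lin c (W_integ Wx) (W_integ Wy) It) /= ; ring.
split => //; rewrite N2 /=.
have := ler_normD (c * x a) (y a); rewrite normrM; move: N1; rewrite mulrDr; lra.
Qed.

Lemma W_lin k (c : R) x y : W k x -> W k y -> W k (fun t => c * x t + y t).
Proof. by move=> Wx Wy; have [] := W_lin_le c Wx Wy. Qed.

Lemma NW_lin k (c : R) x y : W k x -> W k y ->
  NW k (fun t => c * x t + y t) <= `|c| * NW k x + NW k y.
Proof. by move=> Wx Wy; have [] := W_lin_le c Wx Wy. Qed.

Lemma D_lin k (c : R) x y : W k.+1 x -> W k.+1 y ->
  eqW k (D (fun t => c * x t + y t)) (fun t => c * D x t + D y t).
Proof. by move=> Wx Wy; have [_ _] := W_lin_le c Wx Wy; exact. Qed.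

Lemma W_cst_le k (c : R) : [/\ W k (fun=> c),
  NW k (fun=> c) <= (1 + Lnm (fun=> 1)) * `|c| & eqW k (D (fun=> c)) (fun=> 0)].
Proof.
have D0 (c' : R) : eqW 1 (D (fun=> c')) (fun=> 0).
  move=> t It; apply: (deriv_on_pint_cont ab (integ0 _ _)) It => //.
    by move=> t' _ e e0; exists 1 => // s _ _; rewrite subrr normr0.
  by move=> t' It'; rewrite pint0 addr0.
elim: k c => [|k IH] c /=.
  split; [exact: Lp_cst| |by apply: aeW; exact: (D0 c)].
  have [_ E] := Lp_scale p1 c (Lp_cst p ab 1).
  rewrite (_ : (fun=> c) = (fun=> c * 1)); last by apply/funext => t; rewrite mulr1.
  by rewrite E mulrC ler_wpM2r// lerDr.
have [W0 N0 _] := IH 0; rewrite normr0 mulr0 in N0.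
have [W1 N1] := W_pt (fun t It => esym (D0 c t It)) W0.
split.
- by split => // t It; rewrite (pint_eq (D0 c) It) pint0 addr0.
- rewrite N1 mulrDl mul1r lerD// (le_trans N0)// mulr_ge0//; exact: Lnm_ge0.
- exact: D0.
Qed.

Lemma W_cst k (c : R) : W k (fun=> c).
Proof. by have [] := W_cst_le k c. Qed.

Lemma NW0 k : NW k (fun=> 0) = 0.
Proof.
have [_ + _] := W_cst_le k 0; rewrite normr0 mulr0 => h.
by apply/eqP; rewrite eq_le h NW_ge0.
Qed.

Lemma W_scale k (c : R) x : W k x -> W k (fun t => c * x t) /\
  NW k (fun t => c * x t) <= `|c| * NW k x.
Proof.
move=> Wx; have [W1 N1 _] := W_lin_le c Wx (W_cst k 0).
rewrite NW0 addr0 in N1; rewrite -[X in W k X](_ : (fun t => c * x t + 0) = _).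
  by rewrite -[X in NW k X](_ : (fun t => c * x t + 0) = _)//; apply/funext => t; rewrite addr0.
by apply/funext => t; rewrite addr0.
Qed.

Lemma W_add k x y : W k x -> W k y -> W k (fun t => x t + y t) /\
  NW k (fun t => x t + y t) <= NW k x + NW k y.
Proof.
move=> Wx Wy; have := conj (W_lin 1 Wx Wy) (NW_lin 1 Wx Wy).
rewrite normr1 mul1r.
by rewrite (_ : (fun t => 1 * x t + y t) = (fun t => x t + y t))//; apply/funext => t;
  rewrite mul1r.
Qed.

Lemma W_sub k x y : W k x -> W k y -> W k (fun t => x t - y t) /\
  NW k (fun t => x t - y t) <= NW k x + NW k y.
Proof.
move=> Wx Wy; have := conj (W_lin (-1) Wy Wx) (NW_lin (-1) Wy Wx).
rewrite normrN normr1 mul1r addrC.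
by rewrite (_ : (fun t => -1 * y t + x t) = (fun t => x t - y t))//; apply/funext => t;
  rewrite mulN1r addrC.
Qed.

Lemma D_sub k x y : W k.+1 x -> W k.+1 y ->
  eqW k (D (fun t => x t - y t)) (fun t => D x t - D y t).
Proof.
move=> Wx Wy; have := D_lin (-1) Wy Wx.
rewrite (_ : (fun t => -1 * y t + x t) = (fun t => x t - y t)); last first.
  by apply/funext => t; rewrite mulN1r addrC.
move=> /eqW_trans; apply; apply: eqW_pt => t _; by rewrite mulN1r addrC.
Qed.

Lemma W_sum k (J : Type) (r : seq J) (F : J -> R -> R) :
  (forall j, W k (F j)) ->
  W k (fun t => \sum_(j <- r) F j t) /\
  NW k (fun t => \sum_(j <- r) F j t) <= \sum_(j <- r) NW k (F j).
Proof.
move=> WF; elim: r => [|j r [IH1 IH2]].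
  rewrite big_nil (_ : (fun _ => _) = (fun=> 0)); last first.
    by apply/funext => t; rewrite big_nil.
  by rewrite NW0; split => //; exact: W_cst.
rewrite big_cons (_ : (fun _ => _) = (fun t => F j t + \sum_(j <- r) F j t)).
  have [W1 N1] := W_add (WF j) IH1; split => //.
  by rewrite (le_trans N1)// lerD2l.
by apply/funext => t; rewrite big_cons.
Qed.

Lemma D_sum k (J : Type) (r : seq J) (F : J -> R -> R) :
  (forall j, W k.+1 (F j)) ->
  eqW k (D (fun t => \sum_(j <- r) F j t)) (fun t => \sum_(j <- r) D (F j) t).
Proof.
move=> WF; elim: r => [|j r IH].
  have [_ _ e] := W_cst_le k 0.
  apply: (eqW_trans _ (eqW_trans e _)); apply: eqW_pt => t _.
    by congr D; apply/funext => s; rewrite big_nil.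
  by rewrite big_nil.
have := D_lin 1 (WF j) (W_sum r WF).1.
move=> /(eqW_trans _) e; apply: (eqW_trans (e _ _)).
  apply: eqW_pt => t _; congr D; apply/funext => s.
  by rewrite big_cons mul1r.
have := eqW_comp2 (fun u v => u + v) (eqW_pt k (fun t _ => erefl (D (F j) t))) IH.
move=> e2; apply: (eqW_trans _ (eqW_trans e2 _)); apply: eqW_pt => t _.
  by rewrite mul1r.
by rewrite big_cons.
Qed.

Definition Csup : R := 1 + L1c.

Lemma Csup_ge1 : 1 <= Csup. Proof. by rewrite lerDl ltW// L1c_gt0. Qed.

Lemma W_sup x t : W 1 x -> I t -> `|x t| <= Csup * NW 1 x.
Proof.
move=> [xE Wx] It; rewrite (xE _ It) (le_trans (ler_normD _ _))//=.
have ix := W_integ (k := 0) Wx.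
have h1 := pint_bounded ab ix It.
have : pint (fun s => `|D x s|) b <= L1c * Lnm (D x).
  by rewrite pintE; apply: int_abs_le_Lnm.
move=> /(le_trans h1) h2; rewrite /Csup mulrDl mul1r mulrDr.
have := Lnm_ge0 a b p (D x).
have h4 := L1c_gt0 ab; have h3 : 0 <= L1c * `|x a| by rewrite mulr_ge0// ltW.
lra.
Qed.

(** [NW] contains the L_p norm of the highest derivative only, so lowering the order is not a
    termwise comparison: at the bottom the sup bound [W_sup] recovers the L_p norm of x itself. *)
Lemma W_embed k : exists2 C : R, 0 <= C & forall x, W k.+1 x ->
  W k x /\ NW k x <= C * NW k.+1 x.
Proof.
elim: k => [|k [C C0 IH]].
  exists (Csup * Lnm (fun=> 1)).
    by rewrite mulr_ge0 ?Lnm_ge0// (le_trans ler01 Csup_ge1).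
  move=> x Wx; have mx := W_measurable Wx.
  have [Lc Nc] := Lp_scale p1 (Csup * NW 1 x) (Lp_cst p ab 1).
  have [|L1 N1] := Lp_le p1 mx Lc.
    apply: aeW => t It; rewrite mulr1 (le_trans (W_sup Wx It))//; exact: ler_norm.
  split => //; rewrite [NW 0 x]/= (le_trans N1)// Nc ger0_norm.
    by rewrite mulrAC.
  by rewrite mulr_ge0 ?NW_ge0// (le_trans ler01 Csup_ge1).
exists (1 + C); first by rewrite addr_ge0.
move=> x [xE Wx]; have [W1 N1] := IH _ Wx; split => //.
rewrite [NW k.+1 x]/= [NW k.+2 x]/=.
rewrite mulrDl mul1r -addrA lerD2l mulrDr; have h0 := NW_ge0 k.+1 (D x).
have h1 : 0 <= C * `|x a| by rewrite mulr_ge0.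
move: N1 h0 h1 => /=; lra.
Qed.

Lemma W_S k x : W k.+1 x -> W k x.
Proof. by have [C _ h] := W_embed k => /h[]. Qed.

Lemma W_le j k x : (j <= k)%N -> W k x -> W j x.
Proof.
move=> /subnKC <-; elim: (k - j)%N => [|i IH]; rewrite ?addn0// addnS => /W_S.
exact: IH.
Qed.

Lemma W_mul0 x y : W 0 x -> W 1 y ->
  W 0 (fun t => x t * y t) /\
  NW 0 (fun t => x t * y t) <= Csup * (NW 0 x * NW 1 y).
Proof.
move=> Wx Wy; have my := W_measurable Wy.
have := Lp_mul_bounded ab p1 my Wx (fun t It => W_sup Wy It).
rewrite (_ : (fun t => y t * x t) = (fun t => x t * y t)); last first.
  by apply/funext => t; rewrite mulrC.
by rewrite -mulrA [NW 1 y * _]mulrC.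
Qed.

(** By [pint_parts] the product is the primitive of x' y + x y', a sum of two products to which the
    hypothesis for order k applies. In the constant, 1 accounts for the value at [a] and each [C]
    for one product. *)
Lemma W_mulS k (C : R) : 0 <= C ->
  (forall x y, W k x -> W k.+1 y -> W k (fun t => x t * y t) /\
    NW k (fun t => x t * y t) <= C * (NW k x * NW k.+1 y)) ->
  forall x y, W k.+1 x -> W k.+1 y -> [/\ W k.+1 (fun t => x t * y t),
    eqW k (D (fun t => x t * y t)) (fun t => D x t * y t + x t * D y t) &
    NW k.+1 (fun t => x t * y t) <= (1 + C + C) * (NW k.+1 x * NW k.+1 y)].
Proof.
move=> C0 h x y Wx Wy; have [xE Wx'] := Wx; have [yE Wy'] := Wy.
have [W1 N1] := h _ _ Wx' Wy.
have [W2 N2] := h _ _ Wy' Wx.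
have [W3 N3] := W_add W1 W2.
have [ix iy] := (W_integ Wx', W_integ Wy').
have [|W4 e4 N4] := W_prim (x := fun t => x t * y t) W3.
  move=> t It.
  have ifF f g : integ f -> integ g -> integ (fun s => f s * pint g s).
    move=> fi gi; apply: (integ_mul_bounded fi (pint_measurable ab gi)) => s Is.
    exact: (pint_bounded ab gi Is).
  rewrite (pint_eq (g := fun s => y a * D x s + (x a * D y s +
      (D x s * pint (D y) s + pint (D x) s * D y s))) _ It); last first.
    by move=> s Is; rewrite (yE _ Is) (xE _ Is); ring.
  have i1 : integ (fun s => pint (D x) s * D y s).
    by apply: integ_eq (ifF _ _ iy ix) => s _; rewrite mulrC.
  have i2 : integ (fun s => D x s * pint (D y) s + pint (D x) s * D y s).
    by apply: integD => //; exact: ifF.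
  rewrite (pint_lin _ ix (integ_lin _ iy i2) It) (pint_lin _ iy i2 It).
  rewrite -(pint_parts ab ix iy It) (xE _ It) (yE _ It).
  by rewrite /=; ring.
split => //.
- apply: eqW_trans e4 _; apply: eqW_pt => t _; by rewrite [D y t * _]mulrC.
- rewrite N4 normrM.
  have := NW_ge0 k (D x); have := NW_ge0 k (D y).
  have := normr_ge0 (x a); have := normr_ge0 (y a).
  move: N1 N2 N3 => /=.
  set X := `|x a|; set Y := `|y a|; set X' := NW k (D x); set Y' := NW k (D y).
  move=> N1 N2 N3 Y0 X0 Y0' X0'.
  have h1 : X * Y <= (X + X') * (Y + Y') by rewrite ler_pM// ?lerDl.
  have h2 : C * (X' * (Y + Y')) <= C * ((X + X') * (Y + Y')).
    by rewrite ler_wpM2l// ler_wpM2r ?addr_ge0// lerDr.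
  have h3 : C * (Y' * (X + X')) <= C * ((X + X') * (Y + Y')).
    by rewrite ler_wpM2l// mulrC ler_wpM2l ?addr_ge0// lerDr.
  rewrite !mulrDl mul1r; lra.
Qed.

(** The second factor has one more order because L_p is not closed under products, whereas W^1
    consists of bounded functions. This fits a coefficient of order n times a state of order n +
    1. *)
Lemma W_mul k : exists2 C : R, 0 <= C &
  forall x y, W k x -> W k.+1 y -> W k (fun t => x t * y t) /\
    NW k (fun t => x t * y t) <= C * (NW k x * NW k.+1 y).
Proof.
elim: k => [|k [C C0 IH]].
  exists Csup; first exact: le_trans ler01 Csup_ge1.
  exact: W_mul0.
have [E E0 hE] := W_embed k.+1.
exists ((1 + C + C) * E); first by rewrite mulr_ge0// !addr_ge0.
move=> x y Wx /hE[Wy Ny]; have [W1 _ N1] := W_mulS C0 IH Wx Wy; split => //.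
rewrite (le_trans N1)// -mulrA ler_wpM2l ?addr_ge0//.
by rewrite mulrCA ler_wpM2l// NW_ge0.
Qed.

Lemma W_mul_deriv k x y : W k.+1 x -> W k.+1 y ->
  W k.+1 (fun t => x t * y t) /\
  eqW k (D (fun t => x t * y t)) (fun t => D x t * y t + x t * D y t).
Proof. by have [C C0 h] := W_mul k => Wx /(W_mulS C0 h Wx)[]. Qed.

(** The intervals [u i - e i, u i + e i] are nested; the supremum of their left ends is a common
    point. *)
Lemma real_geo_complete (u : nat -> R) (C : R) : 0 <= C ->
  (forall i, `|u i.+1 - u i| <= C * 2^-1 ^+ i) ->
  exists c, forall i, `|c - u i| <= 2 * C * 2^-1 ^+ i.
Proof.
move=> C0 du; pose e i : R := 2 * C * 2^-1 ^+ i.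
have e0 i : 0 <= e i by rewrite !mulr_ge0// exprn_ge0// invr_ge0.
have eS i : e i.+1 = e i - C * 2^-1 ^+ i.
  by rewrite /e exprS; set z := _ ^+ i; field.
have nd : nondecreasing_seq (fun i => u i - e i).
  apply/nondecreasing_seqP => i; rewrite eS.
  by have := du i; rewrite ler_norml => /andP[]; lra.
have ni : nonincreasing_seq (fun i => u i + e i).
  apply/nonincreasing_seqP => i; rewrite eS.
  by have := du i; rewrite ler_norml => /andP[]; lra.
have ub j : ubound (range (fun i => u i - e i)) (u j + e j).
  move=> _ [i _ <-]; apply: (le_trans (nd _ _ (leq_maxl i j))).
  apply: le_trans (ni _ _ (leq_maxr i j)) => /=; have := e0 (maxn i j); lra.
exists (sup (range (fun i => u i - e i))) => i.
rewrite ler_norml; apply/andP; split.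
  rewrite lerBrDl; apply: ub_le_sup; first by exists (u 0%N + e 0%N).
  by exists i.
by rewrite lerBlDl; apply: ge_sup => //; exists (u 0%N - e 0%N); exists 0%N.
Qed.

(** The limit is the primitive of the limit of the derivatives, started at the limit of the values
    at [a]. *)
Lemma W_complete k (x_ : nat -> R -> R) (C : R) : 0 <= C ->
  (forall i, W k (x_ i)) ->
  (forall i, NW k (fun t => x_ i.+1 t - x_ i t) <= C * 2^-1 ^+ i) ->
  exists x C', W k x /\
    forall i, NW k (fun t => x t - x_ i t) <= C' * 2^-1 ^+ i.
Proof.
elim: k x_ => [|k IH] x_ C0 Wx dx.
  by have [x Lx h] := Lp_complete ab p1 C0 Wx dx; exists x, (2 * C).
have WD i : W k (D (x_ i)) by have [] := Wx i.
have dD i : NW k (fun t => D (x_ i.+1) t - D (x_ i) t) <= C * 2^-1 ^+ i.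
  have [_ WB] := (W_sub (Wx i.+1) (Wx i)).1.
  have [WB1 _] := W_sub (WD i.+1) (WD i).
  have [_ ->] := W_eqW WB (D_sub (Wx i.+1) (Wx i)) (W_measurable WB1).
  by rewrite (le_trans _ (dx i))//= lerDr.
have [g [C1 [Wg hg]]] := IH _ C0 WD dD.
have [|c hc] := @real_geo_complete (fun i => x_ i a) _ C0.
  by move=> i; rewrite (le_trans _ (dx i))//= lerDl NW_ge0.
pose x t := c + pint g t.
have xa : x a = c by rewrite /x pint_a addr0.
have [|W1 e1 N1] := W_prim (x := x) Wg; first by move=> t It; rewrite xa.
exists x, (2 * C + C1); split => // i /=.
rewrite mulrDl lerD//; first by rewrite xa; exact: hc.
have [_ WB] := (W_sub W1 (Wx i)).1.
have [WB1 _] := W_sub Wg (WD i).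
have e2 : eqW k (D (fun t => x t - x_ i t)) (fun t => g t - D (x_ i) t).
  apply: (eqW_trans (D_sub W1 (Wx i))).
  by apply: (eqW_comp2 (fun u v => u - v) e1); exact: eqW_pt.
have [_ <-] := W_eqW WB e2 (W_measurable WB1).
exact: hg.
Qed.

End Sobolev.

(** * Matrix-valued functions *)

Section matrix_Sobolev.
Variables (R : realType) (a b p : R).
Hypotheses (ab : a < b) (p1 : 1 <= p).
Local Notation mu := (@lebesgue_measure R).
Local Notation I := `[a, b]%classic.
Local Notation D := (deriv_on a b).
Local Notation W := (W a b p).
Local Notation NW := (NW a b p).
Local Notation eqW := (eqW a b).

Definition absM m l (X : 'M[R]_(m, l)) : R := \sum_i \sum_j `|X i j|.

Definition mW k m l (X : R -> 'M[R]_(m, l)) :=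
  forall i j, W k (fun t => X t i j).

Definition mN k m l (X : R -> 'M[R]_(m, l)) : R :=
  \sum_i \sum_j NW k (fun t => X t i j).

Definition mD m l (X : R -> 'M[R]_(m, l)) (t : R) : 'M[R]_(m, l) :=
  \matrix_(i, j) D (fun s => X s i j) t.

Lemma mN_ge0 k m l (X : R -> 'M[R]_(m, l)) : 0 <= mN k X.
Proof. by apply: sumr_ge0 => i _; apply: sumr_ge0 => j _; exact: NW_ge0. Qed.

Lemma absM_ge0 m l (X : 'M[R]_(m, l)) : 0 <= absM X.
Proof. by apply: sumr_ge0 => i _; apply: sumr_ge0. Qed.

Lemma mN_entry k m l (X : R -> 'M[R]_(m, l)) i j :
  NW k (fun t => X t i j) <= mN k X.
Proof.
rewrite /mN (bigD1 i)//= (bigD1 j)//= -addrA lerDl addr_ge0//.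
  by apply: sumr_ge0 => ? _; exact: NW_ge0.
by apply: sumr_ge0 => ? _; apply: sumr_ge0 => ? _; exact: NW_ge0.
Qed.

Lemma absM_entry m l (X : 'M[R]_(m, l)) i j : `|X i j| <= absM X.
Proof.
rewrite /absM (bigD1 i)//= (bigD1 j)//= -addrA lerDl addr_ge0//.
  by apply: sumr_ge0.
by apply: sumr_ge0 => ? _; apply: sumr_ge0.
Qed.

(** For k = 0 the finiteness of [J] provides one common null set. *)
Lemma eqW_forall k (J : finType) (T : Type) (F G : J -> R -> T) :
  (forall j, eqW k (F j) (G j)) -> eqW k (fun t j => F j t) (fun t j => G j t).
Proof.
case: k => [|k] /= h; last by move=> t It; apply/funext => j; exact: h.
have Fil := ae_filter_ringOfSetsType mu.
have := filter_forall Fil h.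
by apply: leb_aeS => t ht It; apply/funext => j; exact: ht.
Qed.

Lemma meqW k m l (X Y : R -> 'M[R]_(m, l)) :
  (forall i j, eqW k (fun t => X t i j) (fun t => Y t i j)) -> eqW k X Y.
Proof.
move=> h.
have := @eqW_forall k ('I_m * 'I_l)%type R (fun ij t => X t ij.1 ij.2)
  (fun ij t => Y t ij.1 ij.2) (fun ij => h ij.1 ij.2).
move=> /(eqW_comp (fun f : 'I_m * 'I_l -> R => \matrix_(i, j) f (i, j))) e.
apply: eqW_trans (eqW_trans _ e) _; apply: eqW_pt => t _;
  by apply/matrixP => i j; rewrite mxE.
Qed.

Lemma meqW_entry k m l (X Y : R -> 'M[R]_(m, l)) : eqW k X Y ->
  forall i j, eqW k (fun t => X t i j) (fun t => Y t i j).
Proof. by move=> h i j; exact: (eqW_comp (fun A : 'M[R]_(m, l) => A i j) h). Qed.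

Lemma mW_D k m l (X : R -> 'M[R]_(m, l)) : mW k.+1 X -> mW k (mD X).
Proof.
move=> WX i j; have [_ +] := WX i j.
by congr W; apply/funext => t; rewrite mxE.
Qed.

Lemma mN_S k m l (X : R -> 'M[R]_(m, l)) :
  mN k.+1 X = absM (X a) + mN k (mD X).
Proof.
rewrite /mN /absM -big_split/=; apply: eq_bigr => i _.
rewrite -big_split/=; apply: eq_bigr => j _; congr (_ + _); congr NW.
by apply/funext => t; rewrite mxE.
Qed.

Lemma mW_eqW k m l (X Y : R -> 'M[R]_(m, l)) : mW k X -> mW k Y ->
  eqW k X Y -> mN k X = mN k Y.
Proof.
move=> WX WY XY; apply: eq_bigr => i _; apply: eq_bigr => j _.
apply/esym; apply: (W_eqW ab p1 (WX i j) (meqW_entry XY i j) _).2.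
exact: W_measurable (WY i j).
Qed.

Lemma mW_cst k m l (A : 'M[R]_(m, l)) : mW k (fun=> A).
Proof. by move=> i j; exact: W_cst. Qed.

Lemma mN0 k m l : mN k (fun=> 0 : 'M[R]_(m, l)) = 0.
Proof.
apply: big1 => i _; apply: big1 => j _; rewrite -[RHS](NW0 ab p1 k).
by congr NW; apply/funext => t; rewrite mxE.
Qed.

Lemma mW_lin k m l (c : R) (X Y : R -> 'M[R]_(m, l)) : mW k X -> mW k Y ->
  mW k (fun t => c *: X t + Y t) /\
  mN k (fun t => c *: X t + Y t) <= `|c| * mN k X + mN k Y.
Proof.
move=> WX WY.
have E i j : (fun t => (c *: X t + Y t) i j) = (fun t => c * X t i j + Y t i j).
  by apply/funext => t; rewrite !mxE.
split=> [i j|]; first by rewrite E; exact: W_lin.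
rewrite /mN mulr_sumr -big_split; apply: ler_sum => i _ /=.
rewrite mulr_sumr -big_split; apply: ler_sum => j _ /=.
by rewrite E; exact: NW_lin.
Qed.

Lemma mW_add k m l (X Y : R -> 'M[R]_(m, l)) : mW k X -> mW k Y ->
  mW k (fun t => X t + Y t) /\ mN k (fun t => X t + Y t) <= mN k X + mN k Y.
Proof.
move=> WX WY; have := mW_lin 1 WX WY; rewrite normr1 mul1r.
by rewrite (_ : (fun t => 1 *: X t + Y t) = (fun t => X t + Y t))//; apply/funext => t;
  rewrite scale1r.
Qed.

Lemma mW_sub k m l (X Y : R -> 'M[R]_(m, l)) : mW k X -> mW k Y ->
  mW k (fun t => X t - Y t) /\ mN k (fun t => X t - Y t) <= mN k X + mN k Y.
Proof.
move=> WX WY; have := mW_lin (-1) WY WX; rewrite normrN normr1 mul1r addrC.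
by rewrite (_ : (fun t => -1 *: Y t + X t) = (fun t => X t - Y t))//; apply/funext => t;
  rewrite scaleN1r addrC.
Qed.

Lemma mW_scale k m l (c : R) (X : R -> 'M[R]_(m, l)) : mW k X ->
  mW k (fun t => c *: X t) /\ mN k (fun t => c *: X t) <= `|c| * mN k X.
Proof.
move=> WX; have := mW_lin c WX (mW_cst k 0); rewrite mN0 addr0.
by rewrite (_ : (fun t => c *: X t + 0) = (fun t => c *: X t))//; apply/funext => t; rewrite addr0.
Qed.

Lemma mD_lin k m l (c : R) (X Y : R -> 'M[R]_(m, l)) :
  mW k.+1 X -> mW k.+1 Y ->
  eqW k (mD (fun t => c *: X t + Y t)) (fun t => c *: mD X t + mD Y t).
Proof.
move=> WX WY; apply: meqW => i j.
apply: (eqW_trans _ (eqW_trans (D_lin ab p1 c (WX i j) (WY i j)) _));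
  apply: eqW_pt => t _; rewrite !mxE//.
by congr D; apply/funext => s; rewrite !mxE.
Qed.

Lemma mD_cst k m l (A : 'M[R]_(m, l)) : eqW k (mD (fun=> A)) (fun=> 0).
Proof.
apply: meqW => i j; have [_ _ e] := W_cst_le ab p1 k (A i j).
apply: (eqW_trans _ (eqW_trans e _)); apply: eqW_pt => t _; by rewrite mxE.
Qed.

Lemma mW_prim k m l (G X : R -> 'M[R]_(m, l)) : mW k G ->
  (forall t, I t -> forall i j, X t i j = X a i j + pint a (fun s => G s i j) t) ->
  [/\ mW k.+1 X, eqW k (mD X) G & mN k.+1 X = absM (X a) + mN k G].
Proof.
move=> WG XE.
have h i j := W_prim ab p1 (x := fun t => X t i j) (WG i j)
  (fun t It => XE t It i j).
have W1 : mW k.+1 X by move=> i j; have [] := h i j.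
have e1 : eqW k (mD X) G.
  apply: meqW => i j; have [_ e _] := h i j; apply: eqW_trans e.
  by apply: eqW_pt => t _; rewrite mxE.
split => //; rewrite mN_S; congr (_ + _); apply: mW_eqW => //.
exact: mW_D.
Qed.

Lemma mW_formula k m l (X : R -> 'M[R]_(m, l)) : mW k.+1 X ->
  forall t, I t -> forall i j,
  X t i j = X a i j + pint a (fun s => mD X s i j) t.
Proof.
move=> WX t It i j; have [h _] := WX i j; rewrite (h _ It); congr (_ + _).
by apply: pint_eq It => s _; rewrite mxE.
Qed.

Lemma mW_le j k m l (X : R -> 'M[R]_(m, l)) : (j <= k)%N -> mW k X -> mW j X.
Proof. by move=> jk WX i i'; exact: W_le jk (WX i i'). Qed.

Lemma mW_embed k : exists2 C : R, 0 <= C &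
  forall m l (X : R -> 'M[R]_(m, l)), mW k.+1 X -> mN k X <= C * mN k.+1 X.
Proof.
have [C C0 h] := W_embed ab p1 k; exists C => // m l X WX.
rewrite /mN mulr_sumr; apply: ler_sum => i _.
by rewrite mulr_sumr; apply: ler_sum => j _; have [] := h _ (WX i j).
Qed.

Lemma mW_embed_le j k : (j <= k)%N -> exists2 C : R, 0 <= C &
  forall m l (X : R -> 'M[R]_(m, l)), mW k X -> mN j X <= C * mN k X.
Proof.
move=> /subnKC <-; elim: (k - j)%N => [|i [C C0 IH]].
  by exists 1 => // m l X; rewrite addn0 mul1r.
have [C' C'0 h] := mW_embed (j + i).
exists (C * C'); first exact: mulr_ge0.
rewrite addnS => m l X WX; rewrite -mulrA.
apply: le_trans (ler_wpM2l C0 (h _ _ _ WX)); apply: IH.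
exact: mW_le (leqnSn _) WX.
Qed.

Lemma mW_mul k : exists2 C : R, 0 <= C &
  forall m l q (X : R -> 'M[R]_(m, l)) (Y : R -> 'M[R]_(l, q)),
  mW k X -> mW k.+1 Y -> mW k (fun t => X t *m Y t) /\
  mN k (fun t => X t *m Y t) <= C * (mN k X * mN k.+1 Y).
Proof.
have [C C0 h] := W_mul ab p1 k; exists C => // m l q X Y WX WY.
have E i j : (fun t => (X t *m Y t) i j) = (fun t => \sum_s X t i s * Y t s j).
  by apply/funext => t; rewrite mxE.
have S i j : W k (fun t => \sum_s X t i s * Y t s j) /\
    NW k (fun t => \sum_s X t i s * Y t s j) <=
    \sum_s C * (NW k (fun t => X t i s) * NW k.+1 (fun t => Y t s j)).
  have Ws s : W k (fun t => X t i s * Y t s j) by have [] := h _ _ (WX i s) (WY s j).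
  have [W1 N1] := W_sum ab p1 (index_enum 'I_l) Ws; split => //.
  rewrite (le_trans N1)//; apply: ler_sum => s _.
  by have [] := h _ _ (WX i s) (WY s j).
split=> [i j|]; first by rewrite E; have [] := S i j.
apply: (@le_trans _ _ (\sum_i \sum_j \sum_s C *
    (NW k (fun t => X t i s) * NW k.+1 (fun t => Y t s j)))).
  by apply: ler_sum => i _; apply: ler_sum => j _; rewrite E; have [] := S i j.
rewrite [X in _ <= C * (X * _)]/mN mulr_suml mulr_sumr; apply: ler_sum => i _.
rewrite exchange_big mulr_suml mulr_sumr; apply: ler_sum => s _ /=.
rewrite -mulr_sumr ler_wpM2l// -mulr_sumr ler_wpM2l ?NW_ge0//.
rewrite /mN (bigD1 s)//= lerDl; apply: sumr_ge0 => i' _; apply: sumr_ge0 => j _.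
exact: (@NW_ge0 R a b p k.+1 (fun t => Y t i' j)).
Qed.

Lemma mW_mulD k m l q (X : R -> 'M[R]_(m, l)) (Y : R -> 'M[R]_(l, q)) :
  mW k.+1 X -> mW k.+1 Y -> mW k.+1 (fun t => X t *m Y t) /\
  eqW k (mD (fun t => X t *m Y t)) (fun t => mD X t *m Y t + X t *m mD Y t).
Proof.
move=> WX WY.
have E i j : (fun t => (X t *m Y t) i j) = (fun t => \sum_s X t i s * Y t s j).
  by apply/funext => t; rewrite mxE.
have h i s j := W_mul_deriv ab p1 (WX i s) (WY s j).
split=> [i j|].
  by rewrite E; apply: (W_sum ab p1 _ _).1 => s; have [] := h i s j.
apply: meqW => i j.
apply: (@eqW_trans _ _ _ _ _ _ (fun t => \sum_s (D (fun t => X t i s) t * Y t s j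
    + X t i s * D (fun t => Y t s j) t))); last first.
  apply: eqW_pt => t _; rewrite !mxE -big_split/=; apply: eq_bigr => s _.
  by rewrite !mxE.
apply: (@eqW_trans _ _ _ _ _ _ (D (fun t => \sum_s X t i s * Y t s j))).
  by apply: eqW_pt => t _; rewrite mxE E.
have Ws s : W k.+1 (fun t => X t i s * Y t s j) by have [] := h i s j.
apply: (eqW_trans (D_sum ab p1 _ Ws)).
apply: (@eqW_trans _ _ _ _ _ _ (fun t => \sum_s (fun s t =>
    (D (fun t => X t i s) t * Y t s j + X t i s * D (fun t => Y t s j) t)) s t)).
  have e := eqW_forall (fun s => (h i s j).2).
  exact: (eqW_comp (fun f : 'I_l -> R => \sum_s f s) e).
exact: eqW_pt.
Qed.

Lemma mW_tr k m l (X : R -> 'M[R]_(m, l)) : mW k X ->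
  mW k (fun t => (X t)^T) /\ mN k (fun t => (X t)^T) = mN k X.
Proof.
have E (Y : R -> 'M[R]_(m, l)) i j : (fun t => (Y t)^T i j) = (fun t => Y t j i).
  by apply/funext => t; rewrite mxE.
move=> WX; split=> [i j|]; first by rewrite E; exact: WX.
rewrite /mN exchange_big; apply: eq_bigr => i _; apply: eq_bigr => j _.
by rewrite E.
Qed.

(** Transposition exchanges the roles of the factors in [mW_mul], which commutativity does for
    scalars. *)
Lemma mW_mulr k : exists2 C : R, 0 <= C &
  forall m l q (X : R -> 'M[R]_(m, l)) (Y : R -> 'M[R]_(l, q)),
  mW k.+1 X -> mW k Y -> mW k (fun t => X t *m Y t) /\
  mN k (fun t => X t *m Y t) <= C * (mN k.+1 X * mN k Y).
Proof.
have [C C0 h] := mW_mul k; exists C => // m l q X Y WX WY.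
have [WXT NXT] := mW_tr WX; have [WYT NYT] := mW_tr WY.
have [W1 N1] := h _ _ _ _ _ WYT WXT; have [W2 N2] := mW_tr W1.
rewrite -NXT -NYT [mN k.+1 _ * _]mulrC; move: W2 N2.
rewrite (_ : (fun t => ((Y t)^T *m (X t)^T)^T) = (fun t => X t *m Y t)); last first.
  by apply/funext => t; rewrite trmx_mul !trmxK.
by move=> ? N2; split => //; rewrite N2.
Qed.

Lemma mW_complete k m l (X_ : nat -> R -> 'M[R]_(m, l)) (C : R) : 0 <= C ->
  (forall i, mW k (X_ i)) ->
  (forall i, mN k (fun t => X_ i.+1 t - X_ i t) <= C * 2^-1 ^+ i) ->
  exists X C', mW k X /\
    forall i, mN k (fun t => X t - X_ i t) <= C' * 2^-1 ^+ i.
Proof.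
move=> C0 WX dX.
have E (X Y : R -> 'M[R]_(m, l)) i j :
    (fun t => (X t - Y t) i j) = (fun t => X t i j - Y t i j).
  by apply/funext => t; rewrite !mxE.
have h (ij : 'I_m * 'I_l) : exists xC : (R -> R) * R, W k xC.1 /\
    forall i, NW k (fun t => xC.1 t - X_ i t ij.1 ij.2) <= xC.2 * 2^-1 ^+ i.
  have [i|x [C' [Wx hx]]] := W_complete ab p1 C0 (fun i => WX i ij.1 ij.2).
    by rewrite -E (le_trans _ (dX i))//; exact: (mN_entry k (fun t => X_ i.+1 t - X_ i t)).
  by exists (x, C').
have [xC hxC] := choice h.
exists (fun t => \matrix_(i, j) (xC (i, j)).1 t), (\sum_i \sum_j (xC (i, j)).2).
have EX i j : (fun t => (\matrix_(i < m, j < l) (xC (i, j)).1 t) i j) =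
    (xC (i, j)).1.
  by apply/funext => t; rewrite mxE.
split=> [i j|i]; first by rewrite EX; have [] := hxC (i, j).
rewrite mulr_suml; apply: ler_sum => i1 _; rewrite mulr_suml; apply: ler_sum => j1 _.
rewrite E (_ : (fun t => _ - _) = (fun t => (xC (i1, j1)).1 t - X_ i t i1 j1)).
  by have [_] := hxC (i1, j1); exact.
by apply/funext => t; rewrite mxE.
Qed.

(** Regularity bootstrap: X is a primitive of its derivative, hence of any function a.e. equal to
    it, and gains one order over that function. *)
Lemma mW_lift k j m l (X G : R -> 'M[R]_(m, l)) : mW k.+1 X -> mW j G ->
  eqW 0 (mD X) G -> mW j.+1 X /\ eqW j (mD X) G.
Proof.
move=> WX WG e; have [|//] := mW_prim (X := X) WG.
move=> t It i i'; rewrite (mW_formula WX It); congr (_ + _).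
apply: pint_ae It => //; last exact: meqW_entry e i i'.
  exact: W_measurable (mW_D WX i i').
exact: W_measurable (WG i i').
Qed.

End matrix_Sobolev.

(** * Linear systems *)

Section linear_system.
Variables (R : realType) (a b p : R).
Hypotheses (ab : a < b) (p1 : 1 <= p).
Local Notation mu := (@lebesgue_measure R).
Local Notation I := `[a, b]%classic.
Local Notation Lnm := (Lnm a b p).
Local Notation mW := (mW a b p).
Local Notation mN := (mN a b p).
Local Notation mD := (mD a b).
Local Notation eqW := (eqW a b).
Local Notation integ := (integ a b).
Local Notation pint := (pint a).

Lemma absM_add m l (X Y : 'M[R]_(m, l)) : absM (X + Y) <= absM X + absM Y.
Proof.
rewrite /absM -big_split/=; apply: ler_sum => i _.
rewrite -big_split/=; apply: ler_sum => j _.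
by rewrite mxE ler_normD.
Qed.

Lemma absM0 m l : absM (0 : 'M[R]_(m, l)) = 0.
Proof. by apply: big1 => i _; apply: big1 => j _; rewrite mxE normr0. Qed.

Lemma absM_opp m l (X : 'M[R]_(m, l)) : absM (- X) = absM X.
Proof.
by apply: eq_bigr => i _; apply: eq_bigr => j _; rewrite mxE normrN.
Qed.

Lemma absM_mul m l q (X : 'M[R]_(m, l)) (Y : 'M[R]_(l, q)) :
  absM (X *m Y) <= absM X * absM Y.
Proof.
apply: (@le_trans _ _ (\sum_i \sum_j \sum_s `|X i s| * `|Y s j|)).
  apply: ler_sum => i _; apply: ler_sum => j _; rewrite mxE.
  by rewrite (le_trans (ler_norm_sum _ _ _))//; apply: ler_sum => s _; rewrite normrM.
rewrite [X in _ <= X * _]/absM mulr_suml; apply: ler_sum => i _.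
rewrite exchange_big mulr_suml; apply: ler_sum => s _ /=.
rewrite -mulr_sumr ler_wpM2l// /absM (bigD1 s)//= lerDl.
by apply: sumr_ge0 => ? _; apply: sumr_ge0.
Qed.

Lemma absM_eq0 m l (X : 'M[R]_(m, l)) : absM X = 0 -> X = 0.
Proof.
move=> X0; apply/matrixP => i j; rewrite mxE; apply/eqP.
by rewrite -normr_le0 -X0; exact: absM_entry.
Qed.

(** The a.e. derivative of (pint g)^(k+1) is (k+1) g (pint g)^k. Induction with integration by parts
    stands in for the chain rule; this is the source of the factorials in the Picard iteration. *)
Lemma pint_pow g k t : integ g -> (forall s, I s -> 0 <= g s) -> I t ->
  integ (fun s => g s * pint g s ^+ k) /\
  pint (fun s => g s * pint g s ^+ k) t *+ k.+1 = pint g t ^+ k.+1.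
Proof.
move=> gi g0.
have ig k' : integ (fun s => g s * pint g s ^+ k').
  apply: (integ_mul_bounded (M := pint g b ^+ k') gi).
    exact: measurable_funX (pint_measurable ab gi).
  move=> s Is; rewrite normrX lerXn2r ?nnegrE// ?(pint_ge0 ab)//.
    exact: I_b.
  rewrite ger0_norm ?(pint_ge0 ab)//; apply: (pint_mono gi) => //.
    exact: I_b.
  by move/ItvP: Is => /andP[].
move=> It; split; first exact: ig.
elim: k t It => [|k IH] t It.
  by rewrite mulr1n expr1; apply: pint_eq It => s _; rewrite expr0 mulr1.
rewrite exprS -IH// mulrnAr (pint_parts ab gi (ig k) It).
have -> : pint (fun s => g s * pint (fun s => g s * pint g s ^+ k) s +
    pint g s * (g s * pint g s ^+ k)) t *+ k.+1 =
    pint (fun s => (g s * pint g s ^+ k.+1) * k.+2%:R) t.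
  have i3 : integ (fun s => g s * pint (fun s => g s * pint g s ^+ k) s +
      pint g s * (g s * pint g s ^+ k)).
    apply: integD; last by apply: (integ_eq _ (ig k.+1)) => s _; rewrite exprS; ring.
    have := integZ (k.+1%:R^-1) (ig k.+1); apply: integ_eq => s Is.
    by rewrite mulrCA -IH// -(mulr_natl (pint _ _)) mulKf// pnatr_eq0.
  rewrite -(mulr_natl (pint _ _)) -(pintZ _ i3 It).
  apply: pint_eq It => s Is.
  have E : k.+1%:R * pint (fun s => g s * pint g s ^+ k) s =
      pint g s * pint g s ^+ k by rewrite mulr_natl IH// exprS.
  rewrite mulrDr mulrCA E exprS -[k.+2]add1n natrD.
  by move: (pint g s ^+ k) (k.+1%:R) => z y; ring.
rewrite -(mulr_natl (pint _ _)) -(pintZ _ (ig k.+1) It); apply: pint_eq It => s _.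
by rewrite mulrC.
Qed.

Lemma pint_sum (J : Type) (r : seq J) (F : J -> R -> R) t :
  (forall j, integ (F j)) -> I t ->
  integ (fun s => \sum_(j <- r) F j s) /\
  pint (fun s => \sum_(j <- r) F j s) t = \sum_(j <- r) pint (F j) t.
Proof.
move=> iF It; elim: r => [|j r [IH1 IH2]].
  rewrite big_nil (_ : (fun _ => _) = (fun=> 0)); last first.
    by apply/funext => s; rewrite big_nil.
  by rewrite pint0; split => //; exact: integ0.
rewrite big_cons -IH2 -(pintD (iF j) IH1 It).
rewrite (_ : (fun s => \sum_(j0 <- j :: r) F j0 s) =
  (fun s => F j s + \sum_(j <- r) F j s)).
  by split => //; exact: integD.
by apply/funext => s; rewrite big_cons.
Qed.

Lemma absM_pint m l (G : R -> 'M[R]_(m, l)) g t :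
  (forall i j, integ (fun s => G s i j)) -> integ g ->
  (forall s, I s -> absM (G s) <= g s) -> I t ->
  absM (\matrix_(i, j) pint (fun s => G s i j) t) <= pint g t.
Proof.
move=> iG ig Gg It.
have iGa i j := integ_abs (iG i j).
have i1 i : integ (fun s => \sum_j `|G s i j|) by exact: (pint_sum _ (iGa i) It).1.
have i2 : integ (fun s => absM (G s)) by exact: (pint_sum _ i1 It).1.
apply: le_trans (pint_le i2 ig Gg It).
rewrite (pint_sum _ i1 It).2; apply: ler_sum => i _.
rewrite (pint_sum _ (iGa i) It).2; apply: ler_sum => j _.
by rewrite mxE; exact: pint_abs.
Qed.

Lemma geo_le0 (x C : R) : 0 <= x -> (forall i, x <= C * 2^-1 ^+ i) -> x = 0.
Proof.
move=> x0 h; apply/eqP; rewrite eq_le x0 andbT.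
have cv : C * 2^-1 ^+ i @[i --> \oo] --> C * 0.
  by apply: cvgMr; apply: cvg_expr; rewrite ger0_norm ?invr_ge0// invf_lt1// ltr1n.
rewrite mulr0 in cv; rewrite -(cvg_lim _ cv)//; apply: limr_ge.
  by apply/cvg_ex; exists 0.
exact: nearW.
Qed.

(** The terms of the exponential series at 2 H are bounded. This trades factorial decay for the
    geometric decay that the completeness lemmas ask for. *)
Lemma pow_fact_bounded (H : R) : exists2 B : R, 0 <= B &
  forall n, H ^+ n / n`!%:R <= B * 2^-1 ^+ n.
Proof.
have cv : cvgn (exp_coeff (2 * H)).
  by apply/cvg_ex; exists 0; exact: cvg_series_cvg_0 (is_cvg_series_exp_coeff _).
have [M [_ hM]] := cvg_seq_bounded cv.
exists (`|M| + 1); first by rewrite addr_ge0.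
move=> n; have /= := hM (`|M| + 1) _ n Logic.I.
rewrite /exp_coeff /= => /(_ _)/(le_trans (ler_norm _)) h.
have -> : H ^+ n / n`!%:R = (2 * H) ^+ n / n`!%:R * 2^-1 ^+ n.
  by rewrite exprMn exprVn -mulrA [X in _ = _ * X]mulrC mulrACA mulfV ?mul1r.
rewrite ler_wpM2r ?exprn_ge0 ?invr_ge0// h//.
by rewrite (le_lt_trans (ler_norm M))// ltrDl.
Qed.

Lemma mN0_mul_bounded m l q (X : R -> 'M[R]_(m, l)) (Y : R -> 'M[R]_(l, q)) (M : R) :
  mW 1 X -> mW 0 Y -> (forall t, I t -> absM (X t) <= M) ->
  mN 0 (fun t => X t *m Y t) <= m%:R * M * mN 0 Y.
Proof.
move=> WX WY XM.
have E i j : (fun t => (X t *m Y t) i j) = (fun t => \sum_s X t i s * Y t s j).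
  by apply/funext => t; rewrite mxE.
rewrite /mN -mulrA mulr_natl -[X in _ *+ X]card_ord -sumr_const.
apply: ler_sum => i _; rewrite exchange_big/= mulr_sumr; apply: ler_sum => j _.
rewrite mulr_sumr E.
have h s : Lp a b p (fun t => X t i s * Y t s j) /\
    Lnm (fun t => X t i s * Y t s j) <= M * Lnm (fun t => Y t s j).
  apply: (Lp_mul_bounded ab p1 (W_measurable ab p1 (WX i s)) (WY s j)) => t It.
  exact: le_trans (absM_entry _ _ _) (XM _ It).
have [_ N1] := W_sum ab p1 (k := 0) (index_enum 'I_l) (fun s => (h s).1).
by rewrite (le_trans N1)//; apply: ler_sum => s _; exact: (h s).2.
Qed.

(** * Picard iteration with an L_p coefficient matrix *)

Section Picard.
Variables (q : nat) (K : R -> 'M[R]_q).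
Hypothesis WK : mW 0 K.

Let kap t := absM (K t).
Let h := pint kap.

Let integ_kap : integ kap.
Proof.
have iK i j := integ_abs (W_integ ab p1 (WK i j)).
apply: (pint_sum _ (fun i => (pint_sum _ (iK i) (I_a ab)).1) (I_a ab)).1.
Qed.

(** Iterates for X' = X K, X(a) = 1. [K] stands on the right so that X is an integrating factor for
    u' + K u. *)
Fixpoint picard i : R -> 'M[R]_q := if i is i'.+1 then
  (fun t => 1%:M + \matrix_(j, l) pint (fun s => (picard i' s *m K s) j l) t)
  else fun=> 1%:M.

Let picard_a i : picard i a = 1%:M.
Proof.
case: i => //= i; apply/matrixP => j l.
by rewrite [LHS]mxE [X in _ + X]mxE pint_a addr0.
Qed.

Let mW_picard i : mW 1 (picard i) /\ mW 0 (fun t => picard i t *m K t).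
Proof.
have [C _ hC] := mW_mulr ab p1 0.
suff W1 : mW 1 (picard i) by split => //; exact: (hC _ _ _ _ _ W1 WK).1.
elim: i => [|i IH]; first exact: mW_cst.
have [W0 _] := hC _ _ _ _ _ IH WK.
have [|//] := mW_prim ab p1 (X := picard i.+1) W0.
by move=> t It j l; rewrite picard_a /= [LHS]mxE [X in _ + X]mxE.
Qed.

Let mD_picard i : eqW 0 (mD (picard i.+1)) (fun t => picard i t *m K t).
Proof.
have [|//] := mW_prim ab p1 (X := picard i.+1) (mW_picard i).2.
by move=> t It j l; rewrite picard_a /= [LHS]mxE [X in _ + X]mxE.
Qed.

Let d i t := picard i.+1 t - picard i t.

Let mWd i : mW 1 (d i).
Proof. exact: (mW_sub ab p1 (mW_picard _).1 (mW_picard _).1).1. Qed.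

Let mWdK i : mW 0 (fun t => d i t *m K t).
Proof. by have [C _ hC] := mW_mulr ab p1 0; exact: (hC _ _ _ _ _ (mWd i) WK).1. Qed.

Let dS i t : I t ->
  d i.+1 t = \matrix_(j, l) pint (fun s => (d i s *m K s) j l) t.
Proof.
move=> It; apply/matrixP => j l; rewrite /d /= !mxE.
have i1 := W_integ ab p1 ((mW_picard i.+1).2 j l).
have i2 := W_integ ab p1 ((mW_picard i).2 j l).
transitivity (pint (fun s => -1 * (picard i s *m K s) j l + (picard i.+1 s *m K s) j l) t).
  by rewrite (pint_lin _ i2 i1 It) /=; ring.
by apply: pint_eq It => s _; rewrite /d mulmxBl [RHS]mxE [X in _ = _ + X]mxE mulN1r addrC.
Qed.

Let kap_ge0 s : I s -> 0 <= kap s. Proof. by move=> _; exact: absM_ge0. Qed.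

(** [h] is the primitive of [kap], so integrating [kap] times a power of [h] yields the next power
    over the next factorial; the increments are thus summable on the whole of [a, b]. *)
Let d_le i t : I t -> absM (d i t) <= h t ^+ i.+1 / i.+1`!%:R.
Proof.
elim: i t => [|i IH] t It.
  rewrite expr1 divr1 /d /= addrC addKr.
  apply: absM_pint => // [j l|s Is]; last by rewrite mul1mx.
  exact: (W_integ ab p1 ((mW_picard 0).2 j l)).
have [i1 E1] := pint_pow i.+1 integ_kap kap_ge0 It.
rewrite dS//; apply: (@le_trans _ _ (pint (fun s => i.+1`!%:R^-1 *
   (kap s * h s ^+ i.+1)) t)).
  apply: absM_pint => // [j l||s Is].
  - exact: (W_integ ab p1 (mWdK i j l)).
  - exact: integZ.
  - rewrite (le_trans (absM_mul _ _))// mulrCA mulrC ler_wpM2l ?absM_ge0//.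
    by rewrite mulrC IH.
rewrite (pintZ _ i1 It) -E1 -(mulr_natl (pint _ _)) [(i.+2)`!]factS natrM invfM.
by rewrite mulrACA mulfV ?mul1r ?pnatr_eq0// mulrC.
Qed.

(** [d i] times K is the derivative of [d i.+1], and it is small in L_p because [d i] is small in
    the sup norm. This lifts uniform convergence to convergence in W^1, at the price of starting the
    sequence at index 1. *)
Lemma picard_limit : exists X : R -> 'M[R]_q,
  [/\ mW 1 X, X a = 1%:M & eqW 0 (mD X) (fun t => X t *m K t)].
Proof.
have [C2 C20 hC2] := mW_mulr ab p1 0.
have [B B0 hB] := pow_fact_bounded (h b).
have h0 t : I t -> 0 <= h t by exact: (pint_ge0 ab integ_kap kap_ge0).
have d_sup i t : I t -> absM (d i t) <= B * 2^-1 ^+ i.+1.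
  move=> It; apply: le_trans (hB _); apply: (le_trans (d_le _ It)).
  rewrite ler_wpM2r ?invr_ge0// lerXn2r ?nnegrE ?h0//; first exact: I_b.
  apply: (pint_mono integ_kap kap_ge0 It (I_b ab)).
  by move/ItvP: It => /andP[].
have NdS i : mN 1 (d i.+1) <= q%:R * B * mN 0 K * 2^-1 ^+ i.
  have [|_ _ ->] := mW_prim ab p1 (X := d i.+1) (mWdK i).
    move=> t It j l; rewrite !dS//; last exact: I_a.
    by rewrite !mxE pint_a add0r.
  rewrite dS; last exact: I_a.
  rewrite (_ : absM _ = 0) ?add0r; last first.
    by apply: big1 => j _; apply: big1 => l _; rewrite mxE pint_a normr0.
  rewrite (le_trans (mN0_mul_bounded (mWd i) WK (d_sup i)))//.
  rewrite -!mulrA ler_wpM2l// ler_wpM2l// mulrC ler_wpM2l ?mN_ge0//.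
  by rewrite exprS ler_piMl ?exprn_ge0 ?invr_ge0// invf_le1// ler1n.
have C0 : 0 <= q%:R * B * mN 0 K by rewrite !mulr_ge0// mN_ge0.
have [X [C' [WX hX]]] := mW_complete ab p1 C0 (fun i => (mW_picard i.+1).1) NdS.
exists X; split => //.
  apply/eqP; rewrite -subr_eq0; apply/eqP/absM_eq0.
  apply: (@geo_le0 _ C'); first exact: absM_ge0.
  move=> i; apply: le_trans (hX i); rewrite mN_S picard_a lerDl; exact: mN_ge0.
have WXK : mW 0 (fun t => X t *m K t) by exact: (hC2 _ _ _ _ _ WX WK).1.
have [WE _] := mW_sub ab p1 (mW_D WX) WXK.
(* With P the iterates, P(i+2)' = P(i+1) K, so X' - X K is the derivative of X - P(i+2) minus (X -
   P(i+1)) K, and both parts tend to 0. *)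
have E0 : mN 0 (fun t => mD X t - X t *m K t) = 0.
  apply: (@geo_le0 _ (C' + C2 * (C' * mN 0 K))); first exact: mN_ge0.
  move=> i; have [WP WPK] := mW_picard i.+1.
  have [W1 N1] := mW_sub ab p1 (mW_D WX) WPK.
  have [W2 N2] := mW_sub ab p1 WX WP.
  have [W3 N3] := hC2 _ _ _ _ _ W2 WK.
  have [W4 N4] := mW_sub ab p1 W1 W3.
  rewrite (_ : (fun t => mD X t - X t *m K t) = (fun t => mD X t - picard i.+1 t *m K t -
     (X t - picard i.+1 t) *m K t)); last first.
    by apply/funext => t; rewrite mulmxBl opprB addrA subrK.
  apply: (le_trans N4); rewrite mulrDl lerD//; last first.
    by rewrite (le_trans N3)// -mulrA ler_wpM2l// mulrAC ler_wpM2r// mN_ge0.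
  have [W5 N5] := mW_sub ab p1 WX (mW_picard i.+2).1.
  have e5 : eqW 0 (mD (fun t => X t - picard i.+2 t)) (fun t => mD X t - picard i.+1 t *m K t).
    have := mD_lin ab p1 (k := 0) (-1) (mW_picard i.+2).1 WX.
    rewrite (_ : (fun t => -1 *: picard i.+2 t + X t) = (fun t => X t - picard i.+2 t)); last first.
      by apply/funext => t; rewrite scaleN1r addrC.
    move=> /eqW_trans; apply.
    have := eqW_comp2 (fun U V : 'M[R]_q => V - U) (mD_picard i.+1) (eqW_pt 0 (fun t _ => erefl (mD X t))).
    apply: eqW_trans; apply: eqW_pt => t _; by rewrite scaleN1r addrC.
  rewrite -(mW_eqW ab p1 (mW_D W5) W1 e5).
  apply: (@le_trans _ _ (mN 1 (fun t => X t - picard i.+2 t))).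
    by rewrite mN_S lerDr absM_ge0.
  rewrite (le_trans (hX i.+1))// ler_wpM2l//.
    by have := hX 0%N; rewrite expr0 mulr1; apply: le_trans; exact: mN_ge0.
  by rewrite exprS ler_piMl ?exprn_ge0 ?invr_ge0// invf_le1// ler1n.
apply: meqW => i j.
have N0 : Lnm (fun t => (mD X t - X t *m K t) i j) = 0.
  apply/eqP; rewrite eq_le Lnm_ge0 andbT -E0.
  exact: (mN_entry a b p 0 (fun t => mD X t - X t *m K t)).
apply: leb_aeS (Lnm_eq0 p1 (WE i j) N0) => t h' It.
by have /eqP := h' It; rewrite [X in X == _]mxE [X in _ + X]mxE subr_eq0 => /eqP.
Qed.

End Picard.

End linear_system.

(** * Fundamental matrix, Cauchy problem and a priori estimate *)

Section fundamental_matrix.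
Variables (R : realType) (a b p : R).
Hypotheses (ab : a < b) (p1 : 1 <= p).
Local Notation I := `[a, b]%classic.
Local Notation mW := (mW a b p).
Local Notation mN := (mN a b p).
Local Notation mD := (mD a b).
Local Notation eqW := (eqW a b).
Local Notation pint := (pint a).

Lemma mW_mul_same k : exists2 C : R, 0 <= C &
  forall m l q (X : R -> 'M[R]_(m, l)) (Y : R -> 'M[R]_(l, q)),
  mW k.+1 X -> mW k.+1 Y ->
  mN k.+1 (fun t => X t *m Y t) <= C * (mN k.+1 X * mN k.+1 Y).
Proof.
have [C C0 hC] := mW_mul ab p1 k; have [C' C'0 hC'] := mW_mulr ab p1 k.
exists (1 + C + C') => [|m l q X Y WX WY]; first by rewrite !addr_ge0.
have [W1 e1] := mW_mulD ab p1 WX WY.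
have [W2 N2] := hC _ _ _ _ _ (mW_D WX) WY.
have [W3 N3] := hC' _ _ _ _ _ WX (mW_D WY).
have [W4 N4] := mW_add ab p1 W2 W3.
rewrite mN_S (mW_eqW ab p1 (mW_D W1) W4 e1).
have h1 : absM (X a *m Y a) <= mN k.+1 X * mN k.+1 Y.
  rewrite (le_trans (absM_mul _ _))// ler_pM ?absM_ge0// mN_S lerDl mN_ge0//.
have h2 : C * (mN k (mD X) * mN k.+1 Y) <= C * (mN k.+1 X * mN k.+1 Y).
  by rewrite ler_wpM2l// ler_wpM2r ?mN_ge0// [leRHS]mN_S lerDr absM_ge0.
have h3 : C' * (mN k.+1 X * mN k (mD Y)) <= C' * (mN k.+1 X * mN k.+1 Y).
  by rewrite ler_wpM2l// ler_wpM2l ?mN_ge0// [leRHS]mN_S lerDr absM_ge0.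
rewrite !mulrDl mul1r -addrA lerD//; apply: (le_trans N4).
by rewrite lerD//; [exact: le_trans N2 h2|exact: le_trans N3 h3].
Qed.

Lemma absM_a_le k m l (X : R -> 'M[R]_(m, l)) : absM (X a) <= mN k.+1 X.
Proof. by rewrite mN_S lerDl mN_ge0. Qed.

Lemma mN_D_le k m l (X : R -> 'M[R]_(m, l)) : mN k (mD X) <= mN k.+1 X.
Proof. by rewrite mN_S lerDr absM_ge0. Qed.

Lemma mW_const_of_D k m l (X : R -> 'M[R]_(m, l)) : mW k.+1 X ->
  eqW 0 (mD X) (fun=> 0) -> forall t, I t -> X t = X a.
Proof.
move=> WX e t It; apply/matrixP => i j; rewrite (mW_formula WX It).
rewrite (pint_ae (g := fun=> 0) _ _ _ It) ?pint0 ?addr0//.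
  exact: W_measurable ab p1 _ _ (mW_D WX i j).
by apply: eqW_trans (meqW_entry e i j) _; apply: eqW_pt => s _; rewrite mxE.
Qed.

(** The iteration gives order 1 only. As long as j < n, X and K of order j + 1 make X K of order j +
    1, so X has order j + 2. *)
Lemma linear_existence n q (K : R -> 'M[R]_q) : mW n K ->
  exists X, [/\ mW n.+1 X, X a = 1%:M & eqW n (mD X) (fun t => X t *m K t)].
Proof.
move=> WK; have [X [WX Xa eX]] := picard_limit ab p1 (mW_le ab p1 (leq0n n) WK).
exists X; suff h j : (j <= n)%N ->
    mW j.+1 X /\ eqW j (mD X) (fun t => X t *m K t).
  by have [] := h n (leqnn n).
elim: j => [//|j IH] jn; have [WXj _] := IH (ltnW jn).
have [WXK _] := mW_mulD ab p1 WXj (mW_le ab p1 jn WK).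
exact: (mW_lift ab p1 WX WXK eX).
Qed.

Lemma mD_tr k m l (X : R -> 'M[R]_(m, l)) :
  eqW k (mD (fun t => (X t)^T)) (fun t => (mD X t)^T).
Proof.
apply: eqW_pt => t _; apply/matrixP => i j; rewrite !mxE; congr deriv_on.
by apply/funext => s; rewrite mxE.
Qed.

(** The inverse comes with its regularity because it is obtained as a solution: [Phi] is the
    transpose of the solution for -K^T, and (Psi Phi)' = Psi K Phi - Psi K Phi = 0. *)
Lemma fundamental n q (K : R -> 'M[R]_q) : mW n K ->
  exists Psi Phi : R -> 'M[R]_q,
  [/\ mW n.+1 Psi /\ mW n.+1 Phi, Psi a = 1%:M /\ Phi a = 1%:M,
      eqW n (mD Psi) (fun t => Psi t *m K t),
      eqW n (mD Phi) (fun t => - K t *m Phi t) &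
      forall t, I t -> Psi t *m Phi t = 1%:M /\ Phi t *m Psi t = 1%:M].
Proof.
move=> WK; have [Psi [WPsi Psia ePsi]] := linear_existence WK.
have WKT : mW n (fun t => - (K t)^T).
  have [+ _] := mW_scale ab p1 (-1) (mW_tr WK).1.
  by rewrite (_ : (fun t => -1 *: (K t)^T) = (fun t => - (K t)^T))//; apply/funext => t;
    rewrite scaleN1r.
have [X [WX Xa eX]] := linear_existence WKT.
pose Phi t := (X t)^T.
have WPhi : mW n.+1 Phi := (mW_tr WX).1.
have ePhi : eqW n (mD Phi) (fun t => - K t *m Phi t).
  apply: eqW_trans (mD_tr _ _) _.
  apply: eqW_trans (eqW_comp (fun A : 'M[R]_q => A^T) eX) _.
  by apply: eqW_pt => t _; rewrite /Phi trmx_mul linearN/= trmxK.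
exists Psi, Phi; split => //; first by rewrite /Phi Xa trmx1.
have [WPP ePP] := mW_mulD ab p1 WPsi WPhi.
have e0 : eqW n (mD (fun t => Psi t *m Phi t)) (fun=> 0).
  apply: eqW_trans ePP _.
  have e1 := eqW_comp2 (fun A B : 'M[R]_q => A *m B) ePsi (eqW_pt n (fun t _ => erefl (Phi t))).
  have e2 := eqW_comp2 (fun A B : 'M[R]_q => A *m B) (eqW_pt n (fun t _ => erefl (Psi t))) ePhi.
  apply: eqW_trans (eqW_comp2 (fun A B : 'M[R]_q => A + B) e1 e2) _.
  by apply: eqW_pt => t _ /=; rewrite mulNmx mulmxN mulmxA subrr.
move=> t It; have E := mW_const_of_D WPP (eqW_le (leq0n n) e0) It.
have {}E : Psi t *m Phi t = 1%:M by rewrite E Psia /Phi Xa trmx1 mulmx1.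
by split => //; exact: mulmx1C.
Qed.

(** Variation of constants: u = Phi z with z' = Psi F and z(a) = c. *)
Lemma cauchy_exists n q l (K : R -> 'M[R]_q) (F : R -> 'M[R]_(q, l)) c :
  mW n K -> mW n F -> exists u, [/\ mW n.+1 u, u a = c &
    eqW n (fun t => mD u t + K t *m u t) F].
Proof.
move=> WK WF; have [Psi [Phi [[WPsi WPhi] [Psia Phia] ePsi ePhi inv]]] := fundamental WK.
have [C _ hC] := mW_mulr ab p1 n; have [WPF _] := hC _ _ _ _ _ WPsi WF.
pose z t := c + \matrix_(i, j) pint (fun s => (Psi s *m F s) i j) t.
have za : z a = c.
  by apply/matrixP => i j; rewrite /z [LHS]mxE [X in _ + X]mxE pint_a addr0.
have [|Wz ez _] := mW_prim ab p1 (X := z) WPF.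
  by move=> t It i j; rewrite za /z [LHS]mxE [X in _ + X]mxE.
have [Wu eu] := mW_mulD ab p1 WPhi Wz.
exists (fun t => Phi t *m z t); split => //; first by rewrite Phia za mul1mx.
have e1 := eqW_comp2 (fun A (B : 'M[R]_(q, l)) => A *m B) ePhi (eqW_pt n (fun t _ => erefl (z t))).
have e2 := eqW_comp2 (fun (A : 'M[R]_q) B => A *m B) (eqW_pt n (fun t _ => erefl (Phi t))) ez.
have e3 := eqW_trans eu (eqW_comp2 (fun A B : 'M[R]_(q, l) => A + B) e1 e2).
apply: eqW_trans (eqW_comp2 (fun A B : 'M[R]_(q, l) => A + B) e3
  (eqW_pt n (fun t _ => erefl (K t *m (Phi t *m z t))))) _.
apply: eqW_pt => t It /=.
rewrite !mulNmx -!mulmxA addrC addrA subrr add0r mulmxA.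
by rewrite (inv t It).2 mul1mx.
Qed.

(** (Psi u)' = Psi (u' + K u) = 0. For a state matrix that is invertible at [a] this provides an
    inverse of order n + 1 on all of [a, b]. *)
Lemma cauchy_conserved n q l (K Psi : R -> 'M[R]_q) (u : R -> 'M[R]_(q, l)) :
  mW n.+1 Psi -> Psi a = 1%:M -> eqW n (mD Psi) (fun t => Psi t *m K t) ->
  mW n.+1 u -> eqW n (fun t => mD u t + K t *m u t) (fun=> 0) ->
  forall t, I t -> Psi t *m u t = u a.
Proof.
move=> WPsi Psia ePsi Wu eu t It.
have [Wz ez] := mW_mulD ab p1 WPsi Wu.
have e0 : eqW n (mD (fun t => Psi t *m u t)) (fun=> 0).
  apply: eqW_trans ez _.
  have e1 := eqW_comp2 (fun A (B : 'M[R]_(q, l)) => A *m B) ePsi (eqW_pt n (fun t _ => erefl (u t))).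
  have e2 := eqW_comp2 (fun A B : 'M[R]_(q, l) => A + B) e1
    (eqW_pt n (fun t _ => erefl (Psi t *m mD u t))).
  apply: eqW_trans e2 _.
  have e3 := eqW_comp2 (fun (A : 'M[R]_q) B => A *m B) (eqW_pt n (fun t _ => erefl (Psi t))) eu.
  apply: eqW_trans _ (eqW_trans e3 _); apply: eqW_pt => s _ /=.
    by rewrite mulmxDr addrC mulmxA.
  by rewrite mulmx0.
by rewrite (mW_const_of_D Wz (eqW_le (leq0n n) e0) It) Psia mul1mx.
Qed.

(** The integrating factor of the unperturbed equation is applied to the perturbed one: (Psi u)' =
    Psi (u' + K u) + Psi (K0 - K) u. The last term is absorbed when K is close to K0, so one
    constant serves all such K. *)
Lemma apriori n q (K0 : R -> 'M[R]_q) : mW n K0 ->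
  exists delta C : R, [/\ 0 < delta, 0 <= C &
  forall l K (u : R -> 'M[R]_(q, l)), mW n K ->
    mN n (fun t => K t - K0 t) <= delta -> mW n.+1 u ->
    mN n.+1 u <= C * (absM (u a) + mN n (fun t => mD u t + K t *m u t))].
Proof.
move=> WK0; have [Psi [Phi [[WPsi WPhi] [Psia Phia] ePsi _ inv]]] := fundamental WK0.
have [C1 C10 h1] := mW_mulr ab p1 n; have [C2 C20 h2] := mW_mul ab p1 n.
have [C3 C30 h3] := mW_mul_same n.
pose P := mN n.+1 Psi; pose Q := mN n.+1 Phi.
have P0 : 0 <= P by exact: mN_ge0.
have Q0 : 0 <= Q by exact: mN_ge0.
(* [T] is the factor with which |K0 - K| |u| returns; the radius 1 / (2 (T + 1)) makes this at most
   |u| / 2, and the added 1 covers T = 0. Absorbing it doubles the final constant. *)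
pose T := C3 * Q * (C1 * P) * C2.
have T0 : 0 <= T by rewrite /T !mulr_ge0.
exists (2 * (T + 1))^-1, (2 * (C3 * Q * (1 + C1 * P))).
split; first by rewrite invr_gt0 mulr_gt0// ltr_wpDl.
  by rewrite !mulr_ge0// addr_ge0// mulr_ge0.
move=> l K u WK Kd Wu.
pose F t := mD u t + K t *m u t.
pose G t := (K0 t - K t) *m u t.
have [WKK NKK] := mW_sub ab p1 WK0 WK.
have {}Kd : mN n (fun t => K0 t - K t) <= (2 * (T + 1))^-1.
  apply: le_trans Kd; have [W1 N1] := mW_sub ab p1 WK WK0.
  have [W2 N2] := mW_scale ab p1 (-1) W1; rewrite normrN normr1 mul1r in N2.
  move: N2; rewrite (_ : (fun t => -1 *: (K t - K0 t)) = (fun t => K0 t - K t))//.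
  by apply/funext => t; rewrite scaleN1r opprB.
have [WG NG] := h2 _ _ _ _ _ WKK Wu.
have [WKu _] := h2 _ _ _ _ _ WK Wu.
have [WF _] := mW_add ab p1 (mW_D Wu) WKu.
have [WPF NPF] := h1 _ _ _ _ _ WPsi WF.
have [WPG NPG] := h1 _ _ _ _ _ WPsi WG.
have [WS NS] := mW_add ab p1 WPF WPG.
have [Wz ez] := mW_mulD ab p1 WPsi Wu.
have e1 : eqW n (mD (fun t => Psi t *m u t)) (fun t => Psi t *m F t + Psi t *m G t).
  apply: eqW_trans ez _.
  have e2 := eqW_comp2 (fun A (B : 'M[R]_(q, l)) => A *m B) ePsi (eqW_pt n (fun t _ => erefl (u t))).
  apply: eqW_trans (eqW_comp2 (fun A B : 'M[R]_(q, l) => A + B) e2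
    (eqW_pt n (fun t _ => erefl (Psi t *m mD u t)))) _.
  apply: eqW_pt => t _ /=.
  rewrite -mulmxDr /F /G mulmxBl -addrA [K t *m u t + _]addrC subrK.
  by rewrite mulmxDr mulmxA addrC.
have Nz : mN n.+1 (fun t => Psi t *m u t) =
    absM (u a) + mN n (fun t => Psi t *m F t + Psi t *m G t).
  by rewrite mN_S Psia mul1mx (mW_eqW ab p1 (mW_D Wz) WS e1).
have Nu : mN n.+1 u = mN n.+1 (fun t => Phi t *m (Psi t *m u t)).
  apply: (mW_eqW ab p1) => //; first exact: (mW_mulD ab p1 WPhi Wz).1.
  by move=> t It; rewrite mulmxA (inv t It).2 mul1mx.
have := h3 _ _ _ _ _ WPhi Wz; rewrite -Nu -/Q Nz => hu.
set U := mN n.+1 u in hu NG *; set f := mN n F in NPF *.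
set g := mN n G in NPG NG.
have U0 : 0 <= U by exact: mN_ge0.
have f0 : 0 <= f by exact: mN_ge0.
have ua0 : 0 <= absM (u a) by exact: absM_ge0.
have hg : g <= C2 * ((2 * (T + 1))^-1 * U).
  by rewrite (le_trans NG)// ler_wpM2l// ler_wpM2r.
have hS : mN n (fun t => Psi t *m F t + Psi t *m G t) <=
    C1 * P * f + C1 * P * (C2 * ((2 * (T + 1))^-1 * U)).
  rewrite (le_trans NS)// lerD//; first by rewrite -mulrA.
  by rewrite (le_trans NPG)// -mulrA ler_wpM2l// ler_wpM2l.
have CQ0 : 0 <= C3 * Q by rewrite mulr_ge0.
have hT : C3 * Q * (C1 * P * (C2 * ((2 * (T + 1))^-1 * U))) <= U / 2.
  have -> : C3 * Q * (C1 * P * (C2 * ((2 * (T + 1))^-1 * U))) =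
      T / (T + 1) * (U / 2) by rewrite /T invfM; ring.
  rewrite ler_piMl ?divr_ge0// ler_pdivrMr ?mul1r ?lerDl// ltr_wpDl//.
have hu2 : U <= C3 * Q * (absM (u a) + C1 * P * f) + U / 2.
  apply: (le_trans hu); rewrite [leLHS]mulrA.
  apply: (le_trans (ler_wpM2l CQ0 (lerD (lexx (absM (u a))) hS))).
  by rewrite addrA mulrDr lerD2l.
have hfin : absM (u a) + C1 * P * f <= (1 + C1 * P) * (absM (u a) + f).
  have h4 : 0 <= C1 * P * absM (u a) by rewrite !mulr_ge0.
  rewrite mulrDl mul1r mulrDr; lra.
have := ler_wpM2l CQ0 hfin; rewrite mulrA => h5.
by move: h5 hu2; rewrite -(mulrA 2); lra.
Qed.

End fundamental_matrix.

(** * Equations of order r *)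

Section higher_order.
Variables (R : realType) (a b p : R).
Hypotheses (ab : a < b) (p1 : 1 <= p).
Local Notation I := `[a, b]%classic.
Local Notation NW := (NW a b p).
Local Notation mW := (mW a b p).
Local Notation mN := (mN a b p).
Local Notation mD := (mD a b).
Local Notation eqW := (eqW a b).

Definition mDn i m l (y : R -> 'M[R]_(m, l)) : R -> 'M[R]_(m, l) :=
  iter i (fun X => mD X) y.

Lemma eqW_congr (T : Type) k (x x' y y' : R -> T) :
  (forall t, I t -> x' t = x t) -> (forall t, I t -> y t = y' t) ->
  eqW k x y -> eqW k x' y'.
Proof. by move=> hx hy e; exact: (eqW_trans (eqW_pt k hx) (eqW_trans e (eqW_pt k hy))). Qed.

Lemma mD_eq m l (X Y : R -> 'M[R]_(m, l)) : (forall t, I t -> X t = Y t) ->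
  forall t, I t -> mD X t = mD Y t.
Proof.
move=> XY t It; apply/matrixP => i j; rewrite !mxE; apply: deriv_on_eq It => s Is.
by rewrite XY.
Qed.

Lemma mDn_eq i m l (X Y : R -> 'M[R]_(m, l)) : (forall t, I t -> X t = Y t) ->
  forall t, I t -> mDn i X t = mDn i Y t.
Proof. by move=> XY; elim: i => [//|i IH] t It; exact: mD_eq. Qed.

Lemma mW_mDn k i m l (y : R -> 'M[R]_(m, l)) : mW (k + i) y -> mW k (mDn i y).
Proof.
elim: i k => [|i IH] k; first by rewrite addn0.
by rewrite addnS -addSn => /IH /mW_D.
Qed.

Lemma mN_mDn k i m l (y : R -> 'M[R]_(m, l)) :
  mN (k + i) y = \sum_(j < i) absM (mDn j y a) + mN k (mDn i y).
Proof.
elim: i k => [|i IH] k; first by rewrite addn0 big_ord0 add0r.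
by rewrite addnS -addSn IH mN_S big_ord_recr/= addrA.
Qed.

Lemma mN_mDn_le k i m l (y : R -> 'M[R]_(m, l)) : mN k (mDn i y) <= mN (k + i) y.
Proof. by rewrite mN_mDn lerDr; apply: sumr_ge0 => j _; exact: absM_ge0. Qed.

Lemma mW_sum k m l (J : Type) (s : seq J) (F : J -> R -> 'M[R]_(m, l)) :
  (forall j, mW k (F j)) -> mW k (fun t => \sum_(j <- s) F j t) /\
  mN k (fun t => \sum_(j <- s) F j t) <= \sum_(j <- s) mN k (F j).
Proof.
move=> WF; elim: s => [|j s [IH1 IH2]].
  rewrite big_nil (_ : (fun _ => _) = (fun=> 0)); last first.
    by apply/funext => t; rewrite big_nil.
  by rewrite mN0//; split => //; exact: mW_cst.
rewrite big_cons (_ : (fun _ => _) = (fun t => F j t + \sum_(j <- s) F j t)).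
  have [W1 N1] := mW_add ab p1 (WF j) IH1; split => //.
  by rewrite (le_trans N1)// lerD2l.
by apply/funext => t; rewrite big_cons.
Qed.

(** * The state of a function and the companion system *)

Section state.
Variables (r' M n : nat).
Local Notation r := r'.+1.

(** Decodes a position in the state into the order of the derivative and the component; it is the
    inverse of [mxvec_index]. *)
Definition state_idx (s : 'I_(r * M)) : 'I_r * 'I_M :=
  enum_val (cast_ord (esym (mxvec_cast r M)) s).

Lemma state_idxK (i : 'I_r) (j : 'I_M) : state_idx (mxvec_index i j) = (i, j).
Proof. by rewrite /state_idx /mxvec_index cast_ordK enum_rankK. Qed.

Lemma sum_state (V : nmodType) (F : 'I_(r * M) -> V) :
  \sum_s F s = \sum_i \sum_j F (mxvec_index i j).
Proof.
rewrite pair_bigA (reindex (uncurry (@mxvec_index r M)))/=.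
  by apply: eq_bigr => -[].
exact: (subon_bij (fun _ _ => isT) (curry_mxvec_bij r M)).
Qed.

Definition st l (y : R -> 'M[R]_(M, l)) (t : R) : 'M[R]_(r * M, l) :=
  \matrix_(s, k) mDn (state_idx s).1 y t (state_idx s).2 k.

Definition Lop l (A : nat -> R -> 'M[R]_M) (y : R -> 'M[R]_(M, l)) (t : R) :
  'M[R]_(M, l) := mDn r y t + \sum_(i < r) A i t *m mDn i y t.

(** The signs follow the convention u' + K u = F: the identity blocks above the diagonal are
    negative and the coefficients keep their sign. *)
Definition companion (A : nat -> R -> 'M[R]_M) (t : R) : 'M[R]_(r * M) :=
  \matrix_(s, s') if ((state_idx s).1.+1 < r)%N
    then - (((state_idx s').1 == (state_idx s).1.+1 :> nat) &&
            ((state_idx s').2 == (state_idx s).2))%:R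
    else A (state_idx s').1 t (state_idx s).2 (state_idx s').2.

Definition last_block l (f : R -> 'M[R]_(M, l)) (t : R) : 'M[R]_(r * M, l) :=
  \matrix_(s, k) if ((state_idx s).1.+1 < r)%N then 0 else f t (state_idx s).2 k.

Lemma mD_st l (y : R -> 'M[R]_(M, l)) t s k :
  mD (st y) t s k = mDn (state_idx s).1.+1 y t (state_idx s).2 k.
Proof.
by rewrite /= !mxE; congr deriv_on; apply/funext => x; rewrite mxE.
Qed.

(** Purely formal: the derivative of the state is the shifted state by definition of the iterates,
    default values included, so the identity holds at every t. *)
Lemma companionE l A (y : R -> 'M[R]_(M, l)) t :
  mD (st y) t + companion A t *m st y t = last_block (Lop A y) t.
Proof.
apply/matrixP => s k; rewrite mxE mD_st [X in _ + X]mxE [RHS]mxE sum_state.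
case Es : (state_idx s) => [i j] /=.
case: ifPn => [ir|ir]; last first.
  have {ir}ir : i.+1 = r by apply/eqP; rewrite eqn_leq ltn_ord leqNgt ir.
  have -> : mDn i.+1 y t j k = mDn r y t j k by rewrite [in LHS]ir.
  rewrite /Lop [RHS]mxE; congr (_ + _); rewrite summxE; apply: eq_bigr => i' _.
  rewrite [RHS]mxE; apply: eq_bigr => j' _.
  by rewrite !mxE !state_idxK Es /= ir ltnn.
rewrite (bigD1 (Ordinal ir))//= (bigD1 j)//= big1 ?addr0 => [|j' j'j]; last first.
  by rewrite !mxE !state_idxK Es /= ir eqxx (negbTE j'j) oppr0 mul0r.
rewrite big1 ?addr0 => [|i' i'i]; last first.
  apply: big1 => j' _; rewrite !mxE !state_idxK Es /= ir.
  rewrite (_ : (_ == _ :> nat) = false) ?oppr0 ?mul0r//.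
  by apply/negbTE; apply: contra i'i => /eqP h; apply/eqP/val_inj.
rewrite [companion _ _ _ _]mxE [st _ _ _ _]mxE !state_idxK Es /= ir !eqxx mulN1r.
exact: subrr.
Qed.

Lemma mW_st l (y : R -> 'M[R]_(M, l)) : mW (n + r) y -> mW n.+1 (st y).
Proof.
move=> Wy s k; rewrite (_ : (fun t => _) =
    (fun t => mDn (state_idx s).1 y t (state_idx s).2 k)); last first.
  by apply/funext => t; rewrite mxE.
apply: (W_le ab p1 (k := n + r - (state_idx s).1)).
  by have := ltn_ord (state_idx s).1; lia.
by apply: mW_mDn; rewrite subnK//; have := ltn_ord (state_idx s).1; lia.
Qed.

Lemma mN_st k l (y : R -> 'M[R]_(M, l)) :
  mN k (st y) = \sum_(i < r) mN k (mDn i y).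
Proof.
rewrite /mN sum_state; apply: eq_bigr => i _; apply: eq_bigr => j _.
apply: eq_bigr => k' _; congr NW; apply/funext => t.
by rewrite mxE state_idxK.
Qed.

Lemma absM_st l (y : R -> 'M[R]_(M, l)) t :
  absM (st y t) = \sum_(i < r) absM (mDn i y t).
Proof.
rewrite /absM sum_state; apply: eq_bigr => i _; apply: eq_bigr => j _.
by apply: eq_bigr => k' _; rewrite mxE state_idxK.
Qed.

Lemma mN_st_le : exists2 C : R, 0 <= C & forall l (y : R -> 'M[R]_(M, l)),
  mW (n + r) y -> mN n.+1 (st y) <= C * mN (n + r) y.
Proof.
have h (i : 'I_r) : exists C : R, 0 <= C /\
    forall l (X : R -> 'M[R]_(M, l)), mW (n + r - i) X -> mN n.+1 X <= C * mN (n + r - i) X.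
  have [|C C0 hC] := @mW_embed_le R a b p ab p1 n.+1 (n + r - i).
    by have := ltn_ord i; lia.
  by exists C; split => // l X; exact: hC.
have [C hC] := choice h.
exists (\sum_i C i); first by apply: sumr_ge0 => i _; have [] := hC i.
move=> l y Wy; rewrite mN_st mulr_suml; apply: ler_sum => i _.
have [C0 Ci] := hC i.
have E : (n + r = n + r - i + i)%N.
  by rewrite subnK//; have := ltn_ord i; lia.
apply: (le_trans (Ci _ _ _)); first by apply: mW_mDn; rewrite -E.
by rewrite ler_wpM2l// [in leRHS]E; exact: mN_mDn_le.
Qed.

(** The norm of y splits into the values at [a] of the derivatives of order below r, which form the
    state at [a], and the norm of y^(r), the derivative of the last block. Each part is at most the
    norm of the state. *)
Lemma mN_le_st l (y : R -> 'M[R]_(M, l)) : mW (n + r) y ->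
  mN (n + r) y <= 2 * mN n.+1 (st y).
Proof.
move=> Wy; rewrite mN_mDn mulr_natl mulr2n lerD//.
  by rewrite -absM_st; exact: absM_a_le.
rewrite mN_st big_ord_recr/= ler_wpDl//.
  by apply: sumr_ge0 => i _; exact: mN_ge0.
exact: mN_D_le.
Qed.

Lemma NW_zero k (f : R -> R) : (forall t, f t = 0) -> NW k f = 0.
Proof.
by move=> f0; rewrite -[RHS](NW0 ab p1 k); congr NW; apply/funext.
Qed.

Lemma W_zero k (f : R -> R) : (forall t, f t = 0) -> W a b p k f.
Proof.
move=> f0; rewrite (_ : f = (fun=> 0)); first exact: W_cst.
exact/funext.
Qed.

Lemma mW_companion A : (forall i, (i < r)%N -> mW n (A i)) -> mW n (companion A).
Proof.
move=> WA s s'; have [ir|ir] := boolP ((state_idx s).1.+1 < r)%N.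
  rewrite (_ : (fun t => _) = (fun=> companion A a s s')); first exact: W_cst.
  by apply/funext => t; rewrite !mxE ir.
rewrite (_ : (fun t => _) =
    fun t => A (state_idx s').1 t (state_idx s).2 (state_idx s').2).
  exact: WA.
by apply/funext => t; rewrite mxE (negbTE ir).
Qed.

Lemma ord_max_last (i : 'I_r) : (i.+1 < r)%N = (i != ord_max).
Proof. by rewrite -val_eqE /= ltnS ltn_neqAle -ltnS ltn_ord andbT. Qed.

Lemma mN_companion_sub A A' :
  mN n (fun t => companion A t - companion A' t) <=
  \sum_(i < r) mN n (fun t => A i t - A' i t).
Proof.
rewrite {1}/mN sum_state (bigD1 ord_max)//= [X in _ + X]big1 ?addr0; last first.
  move=> i il; apply: big1 => j _; apply: big1 => s' _; apply: NW_zero => t.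
  by rewrite !mxE !state_idxK /= ord_max_last il subrr.
rewrite (eq_bigr (fun j => \sum_(i' < r) \sum_(j' < M)
    NW n (fun t => (A i' t - A' i' t) j j'))); first by rewrite exchange_big lexx.
move=> j _; rewrite sum_state; apply: eq_bigr => i' _; apply: eq_bigr => j' _.
congr NW; apply/funext => t.
by rewrite !mxE !state_idxK /= ltnn.
Qed.

Lemma companion_row l A t (v : 'M[R]_(r * M, l)) (i : 'I_r) j k
    (ir : (i.+1 < r)%N) :
  (companion A t *m v) (mxvec_index i j) k = - v (mxvec_index (Ordinal ir) j) k.
Proof.
rewrite mxE sum_state (bigD1 (Ordinal ir))//= (bigD1 j)//= big1 ?addr0 => [|j' j'j].
  rewrite big1 ?addr0 => [|i' i'i].
    by rewrite !mxE !state_idxK /= ir !eqxx mulN1r.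
  apply: big1 => j' _; rewrite !mxE !state_idxK /= ir.
  rewrite (_ : (_ == _ :> nat) = false) ?oppr0 ?mul0r//.
  by apply/negbTE; apply: contra i'i => /eqP h; apply/eqP/val_inj.
by rewrite !mxE !state_idxK /= ir eqxx (negbTE j'j) oppr0 mul0r.
Qed.

Lemma mW_last_block l (f : R -> 'M[R]_(M, l)) : mW n f -> mW n (last_block f).
Proof.
move=> Wf s k; have [ir|ir] := boolP ((state_idx s).1.+1 < r)%N.
  by apply: W_zero => t; rewrite mxE ir.
rewrite (_ : (fun t => _) = fun t => f t (state_idx s).2 k); first exact: Wf.
by apply/funext => t; rewrite mxE (negbTE ir).
Qed.

Lemma mN_last_block l (f : R -> 'M[R]_(M, l)) :
  mN n (last_block f) = mN n f.
Proof.
rewrite {1}/mN sum_state (bigD1 ord_max)//= [X in _ + X]big1 ?addr0; last first.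
  move=> i il; apply: big1 => j _; apply: big1 => s' _; apply: NW_zero => t.
  by rewrite !mxE !state_idxK /= ord_max_last il.
apply: eq_bigr => j _; apply: eq_bigr => k _; congr NW; apply/funext => t.
by rewrite mxE state_idxK /= ltnn.
Qed.

Lemma last_block_row l (f : R -> 'M[R]_(M, l)) t j k :
  last_block f t (mxvec_index ord_max j) k = f t j k.
Proof. by rewrite mxE state_idxK /= ltnn. Qed.

Lemma eqW_last_block k l (f g : R -> 'M[R]_(M, l)) :
  eqW k (last_block f) (last_block g) -> eqW k f g.
Proof.
move=> /meqW_entry h; apply: meqW => i j.
by apply: eqW_congr (h (mxvec_index ord_max i) j) => t _; rewrite last_block_row.
Qed.

Lemma eqW_last_blockI k l (f g : R -> 'M[R]_(M, l)) :
  eqW k f g -> eqW k (last_block f) (last_block g).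
Proof.
exact: (eqW_comp (fun F : 'M[R]_(M, l) => \matrix_(s, k)
  if ((state_idx s).1.+1 < r)%N then 0 else F (state_idx s).2 k)).
Qed.

(** The leading terms cancel in the difference; in the rest each coefficient of order n multiplies
    some y^(i) with i < r, which still has order n + 1. *)
Lemma Lop_W : exists2 C : R, 0 <= C &
  forall l (A A' : nat -> R -> 'M[R]_M) (y : R -> 'M[R]_(M, l)),
  (forall i, (i < r)%N -> mW n (A i)) -> (forall i, (i < r)%N -> mW n (A' i)) ->
  mW (n + r) y -> mW n (Lop A y) /\
  mN n (fun t => Lop A y t - Lop A' y t) <=
    C * (\sum_(i < r) mN n (fun t => A i t - A' i t)) * mN (n + r) y.
Proof.
have [C C0 hC] := mW_mul ab p1 n; have [C' C'0 hC'] := mN_st_le.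
exists (C * C'); first exact: mulr_ge0.
move=> l A A' y WA WA' Wy.
have Wi (i : 'I_r) : mW n.+1 (mDn i y).
  move=> j k; have := mW_st Wy (mxvec_index i j) k.
  by congr W; apply/funext => t; rewrite mxE state_idxK.
have WL A1 : (forall i, (i < r)%N -> mW n (A1 i)) -> mW n (Lop A1 y).
  move=> WA1; apply: (mW_add ab p1 (mW_mDn Wy) _).1.
  apply: (mW_sum _ _).1 => i.
  exact: (hC _ _ _ _ _ (WA1 i (ltn_ord i)) (Wi i)).1.
split; first exact: WL.
rewrite (_ : (fun t => _) = (fun t => \sum_(i < r) (A i t - A' i t) *m mDn i y t)).
  have WAA (i : 'I_r) : mW n (fun t => A i t - A' i t).
    exact: (mW_sub ab p1 (WA i (ltn_ord i)) (WA' i (ltn_ord i))).1.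
  have [_ N1] := mW_sum (index_enum 'I_r) (fun i => (hC _ _ _ _ _ (WAA i) (Wi i)).1).
  rewrite (le_trans N1)// -(mulrA (C * C')) mulr_suml [leRHS]mulr_sumr.
  apply: ler_sum => i _.
  rewrite (le_trans (hC _ _ _ _ _ (WAA i) (Wi i)).2)// -!mulrA ler_wpM2l//.
  rewrite [leRHS]mulrCA ler_wpM2l ?mN_ge0//.
  apply: le_trans (hC' _ _ Wy); rewrite mN_st (bigD1 i)//= lerDl.
  by apply: sumr_ge0 => i' _; exact: mN_ge0.
apply/funext => t; rewrite /Lop opprD addrACA subrr add0r -sumrB.
by apply: eq_bigr => i _; rewrite mulmxBl.
Qed.

Lemma Lop_apriori (A0 : nat -> R -> 'M[R]_M) :
  (forall i, (i < r)%N -> mW n (A0 i)) ->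
  exists delta C : R, [/\ 0 < delta, 0 <= C &
  forall l A (y : R -> 'M[R]_(M, l)), (forall i, (i < r)%N -> mW n (A i)) ->
    \sum_(i < r) mN n (fun t => A i t - A0 i t) <= delta -> mW (n + r) y ->
    mN (n + r) y <= C * (absM (st y a) + mN n (Lop A y))].
Proof.
move=> WA0; have [delta [C [d0 C0 h]]] := apriori ab p1 (mW_companion WA0).
exists delta, (2 * C); split => //; first by rewrite mulr_ge0.
move=> l A y WA dA Wy; rewrite (le_trans (mN_le_st Wy))// -mulrA ler_wpM2l//.
have := h l _ _ (mW_companion WA) (le_trans (mN_companion_sub _ _) dA) (mW_st Wy).
rewrite (_ : (fun t => _) = last_block (Lop A y)) ?mN_last_block//.
by apply/funext => t; rewrite companionE.
Qed.

(** A solution u of the companion system must be recognized as a state. All rows but the last block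
    say that the derivative of block i is block i + 1, so y is block 0. *)
Lemma Lop_exists l A (f : R -> 'M[R]_(M, l)) c :
  (forall i, (i < r)%N -> mW n (A i)) -> mW n f ->
  exists y, [/\ mW (n + r) y, st y a = c & eqW n (Lop A y) f].
Proof.
move=> WA Wf.
have [u [Wu ua eu]] := cauchy_exists ab p1 c (mW_companion WA) (mW_last_block Wf).
pose blk (i : nat) t : 'M[R]_(M, l) := \matrix_(j, k) u t (mxvec_index (inord i) j) k.
have Wblk0 i : mW n.+1 (blk i).
  move=> j k; have := Wu (mxvec_index (inord i) j) k.
  by congr W; apply/funext => t; rewrite mxE.
have eblk i : (i.+1 < r)%N -> eqW n (mD (blk i)) (blk i.+1).
  move=> ir; apply: meqW => j k.
  have := meqW_entry eu (mxvec_index (inord i) j) k.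
  have ir' : ((inord i : 'I_r).+1 < r)%N by rewrite inordK// ltnW.
  move=> /eqW_comp2 /(_ (eqW_pt n (fun t _ => erefl (blk i.+1 t j k)))).
  move=> /(_ _ (fun v w => v + w)) e; apply: (eqW_trans _ (eqW_trans e _)).
    apply: eqW_pt => t _.
    rewrite [X in _ = X + _]mxE (companion_row A t (u t) j k ir').
    have -> : blk i.+1 t j k = u t (mxvec_index (Ordinal ir') j) k.
      rewrite mxE; congr (u t (mxvec_index _ j) k).
      by apply: val_inj; rewrite /= !inordK// ltnW.
    rewrite subrK !mxE; congr deriv_on.
    by apply/funext => x; rewrite mxE.
  by apply: eqW_pt => t _; rewrite mxE state_idxK /= ir' add0r.
(* Here [d] counts blocks from the last one upwards: the last has order n + 1, and each block gains
   one order as a primitive of its successor, up to n + r for block 0. *)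
have lift d : (d.+1 < r)%N -> mW (n.+1 + d) (blk (r' - d)%N) ->
    mW (n.+1 + d.+1) (blk (r' - d.+1)%N) /\
    eqW (n.+1 + d) (mD (blk (r' - d.+1)%N)) (blk (r' - d)%N).
  move=> dr Wd; have E : (r' - d = (r' - d.+1).+1)%N by lia.
  rewrite addnS; apply: (mW_lift ab p1 (Wblk0 _) Wd).
  by rewrite E; apply: eqW_le (leq0n n) (eblk _ _); lia.
have h d : (d < r)%N -> mW (n.+1 + d) (blk (r' - d)%N).
  elim: d => [_|d IH dr]; first by rewrite addn0; exact: Wblk0.
  exact: (lift _ dr (IH (ltnW dr))).1.
have eblkI i : (i.+1 < r)%N -> forall t, I t -> mD (blk i) t = blk i.+1 t.
  move=> ir; have dr : ((r' - i.+1).+1 < r)%N by lia.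
  have [_] := lift _ dr (h _ (ltnW dr)).
  have -> : (r' - (r' - i.+1).+1 = i)%N by clear -dr ir; lia.
  have -> : (r' - (r' - i.+1) = i.+1)%N by clear -dr ir; lia.
  by [].
have E i : (i < r)%N -> forall t, I t -> mDn i (blk 0) t = blk i t.
  elim: i => [//|i IH] ir t It.
  rewrite /= -eblkI//; apply: mD_eq It => s Is; exact: IH (ltnW ir) _ Is.
have Wy : mW (n + r) (blk 0) by have := h r' (ltnSn _); rewrite subnn addSnnS.
have stu t : I t -> st (blk 0) t = u t.
  move=> It; apply/matrixP => s k; rewrite mxE E// mxE.
  congr (u t _ k); rewrite inord_val /state_idx /mxvec_index -surjective_pairing.
  by rewrite enum_valK cast_ordKV.
exists (blk 0); split => //; first by rewrite stu//; exact: I_a.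
apply: eqW_last_block; apply: eqW_trans eu; apply: eqW_pt => t It.
by rewrite -companionE stu// (mD_eq stu).
Qed.

End state.
End higher_order.

(** * Uniform boundedness *)

Section vanishing.
Variable R : realType.
Implicit Types g h : R -> R.

Definition vanish g := g eps @[eps --> 0^'+] --> (0 : R).

Lemma near_right0 (d : R) : 0 < d -> \forall e \near (0 : R)^'+, 0 < e < d.
Proof. by move=> d0; near=> e; apply/andP; split. Unshelve. all: by end_near. Qed.

Lemma near_right_le (d : R) : 0 < d -> \forall e \near (0 : R)^'+, 0 <= e < d.
Proof. by move/near_right0; apply: filterS => e /andP[/ltW -> ->]. Qed.

Lemma near_right0P (P : R -> Prop) :
  (\forall e \near (0 : R)^'+, P e) <-> exists2 d, 0 < d & forall e, 0 < e < d -> P e.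
Proof.
split=> [[d /= d0 h]|[d d0 h]].
  exists d => // e /andP[e0 ed]; apply: h => //=.
  by rewrite sub0r normrN gtr0_norm.
by apply: filterS (near_right0 d0) => e; exact: h.
Qed.

Lemma vanish_lt g e : vanish g -> 0 < e -> \forall x \near 0^'+, `|g x| < e.
Proof. by move=> /cvgr0_norm_lt; exact. Qed.

Lemma vanish_le g h : (\forall e \near 0^'+, `|g e| <= h e) -> vanish h -> vanish g.
Proof.
move=> gh vh; apply/cvgr0Pnorm_lt => e e0; near=> x.
apply: (le_lt_trans (y := h x)); first by near: x.
apply: le_lt_trans (ler_norm _) _; near: x; exact: vanish_lt.
Unshelve. all: by end_near. Qed.

Lemma vanishD g h : vanish g -> vanish h -> vanish (fun e => g e + h e).
Proof. by move=> vg vh; rewrite /vanish -[X in _ --> X](addr0 0); exact: cvgD. Qed.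

Lemma vanishZ c g : vanish g -> vanish (fun e => c * g e).
Proof. by move=> vg; rewrite /vanish -[X in _ --> X](mulr0 c); exact: cvgMr. Qed.

Lemma vanish0 : vanish (fun=> 0). Proof. exact: cvg_cst. Qed.

Lemma vanish_sum (J : Type) (s : seq J) (F : J -> R -> R) :
  (forall j, vanish (F j)) -> vanish (fun e => \sum_(j <- s) F j e).
Proof.
move=> h; elim: s => [|j s IH].
  rewrite (_ : (fun _ => _) = (fun=> 0)); first exact: vanish0.
  by apply/funext => e; rewrite big_nil.
rewrite (_ : (fun _ => _) = (fun e => F j e + \sum_(j <- s) F j e)).
  exact: vanishD.
by apply/funext => e; rewrite big_cons.
Qed.

End vanishing.

(** * Bounded real-linear operators and the Banach-Steinhaus argument *)

Section uniform_boundedness.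
Variables (R : realType) (a b p : R).
Hypotheses (ab : a < b) (p1 : 1 <= p).
Local Notation I := `[a, b]%classic.
Local Notation mW := (mW a b p).
Local Notation mN := (mN a b p).

Lemma mN_tri k m l (X Y Z : R -> 'M[R]_(m, l)) : mW k X -> mW k Y -> mW k Z ->
  mN k (fun t => X t - Z t) <= mN k (fun t => X t - Y t) + mN k (fun t => Y t - Z t).
Proof.
move=> WX WY WZ.
have := (mW_add ab p1 (mW_sub ab p1 WX WY).1 (mW_sub ab p1 WY WZ).1).2.
by rewrite (_ : (fun t => _ - _ + _) = (fun t => X t - Z t))//; apply/funext => t;
  rewrite addrA subrK.
Qed.

Definition blin k m q (B : (R -> 'cV[R]_m) -> 'cV[R]_q) :=
  (forall (c : R) y z, mW k y -> mW k z ->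
     B (fun t => c *: y t + z t) = c *: B y + B z) /\
  exists2 C : R, 0 <= C & forall y, mW k y -> absM (B y) <= C * mN k y.

Section blin.
Variables (k m q : nat) (B : (R -> 'cV[R]_m) -> 'cV[R]_q).
Hypothesis HB : blin k B.

Lemma blin_add y z : mW k y -> mW k z -> B (fun t => y t + z t) = B y + B z.
Proof.
move=> Wy Wz; have := HB.1 1 _ _ Wy Wz; rewrite scale1r => <-.
by congr B; apply/funext => t; rewrite scale1r.
Qed.

Lemma blin_sub y z : mW k y -> mW k z -> B (fun t => y t - z t) = B y - B z.
Proof.
move=> Wy Wz; have := HB.1 (-1) _ _ Wz Wy; rewrite scaleN1r addrC => <-.
by congr B; apply/funext => t; rewrite scaleN1r addrC.
Qed.

Lemma blin_null y : mW k y -> mN k y = 0 -> B y = 0.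
Proof.
move=> Wy y0; have [C _ h] := HB.2; apply: absM_eq0; apply/eqP.
by rewrite eq_le absM_ge0 andbT (le_trans (h _ Wy))// y0 mulr0.
Qed.

Lemma blin0 : B (fun=> 0) = 0.
Proof. by apply: blin_null; [exact: mW_cst|exact: mN0]. Qed.

Lemma blin_scale c y : mW k y -> B (fun t => c *: y t) = c *: B y.
Proof.
move=> Wy; have := HB.1 c _ _ Wy (mW_cst ab p1 k 0); rewrite blin0 addr0 => <-.
by congr B; apply/funext => t; rewrite addr0.
Qed.

(** For a fundamental matrix Y this turns the boundary condition on Y v into a linear system for
    v. *)
Lemma blin_mul l (Y : R -> 'M[R]_(m, l)) (v : 'cV[R]_l) : mW k Y ->
  B (fun t => Y t *m v) =
  (\matrix_(i, j) B (fun t => col j (Y t)) i 0) *m v.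
Proof.
move=> WY; have Wc j : mW k (fun t => col j (Y t)).
  move=> i i'; rewrite (_ : (fun t => _) = (fun t => Y t i j))//.
  by apply/funext => t; rewrite mxE.
have h (s : seq 'I_l) : mW k (fun t => \sum_(j <- s) v j 0 *: col j (Y t)) /\
    B (fun t => \sum_(j <- s) v j 0 *: col j (Y t)) =
    \sum_(j <- s) v j 0 *: B (fun t => col j (Y t)).
  elim: s => [|j s [W1 IH]].
    rewrite (_ : (fun t => _) = (fun=> 0)); last by apply/funext => t; rewrite big_nil.
    by rewrite big_nil blin0; split => //; exact: mW_cst.
  rewrite (_ : (fun t => _) =
    (fun t => v j 0 *: col j (Y t) + \sum_(j <- s) v j 0 *: col j (Y t))).
    by rewrite HB.1// big_cons IH; split => //; exact: (mW_lin ab p1 _ (Wc j) W1).1.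
  by apply/funext => t; rewrite big_cons.
rewrite (_ : (fun t => _) = (fun t => \sum_j v j 0 *: col j (Y t))).
  rewrite (h _).2; apply/matrixP => i i'; rewrite !ord1 summxE mxE.
  by apply: eq_bigr => j _; rewrite !mxE mulrC.
apply/funext => t; apply/matrixP => i i'; rewrite !ord1 summxE mxE.
by apply: eq_bigr => j _; rewrite !mxE mulrC.
Qed.

End blin.

(* A gliding hump with adaptively chosen steps: whichever of x + y and x - y
   has the larger image is kept, so no operator norm has to be attained. *)
Lemma blin_bounded_seq k m q (B : nat -> (R -> 'cV[R]_m) -> 'cV[R]_q) :
  (forall i, blin k (B i)) ->
  (forall y, mW k y -> exists K, forall i, absM (B i y) <= K) ->
  exists2 C : R, 0 <= C & forall i y, mW k y -> absM (B i y) <= C * mN k y.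
Proof.
move=> HB Bpt; apply: contrapT => unb.
have hump (d K : R) : 0 < d -> 0 <= K -> exists i y,
    [/\ mW k y, mN k y <= d & K <= absM (B i y)].
  move=> d0 K0; apply: contrapT => h; apply: unb; exists (K / d).
    by rewrite divr_ge0// ltW.
  move=> i y Wy; have [C C0 hC] := (HB i).2; rewrite leNgt; apply/negP => lt1.
  have [N0|N0] := eqVneq (mN k y) 0.
    by move: lt1; rewrite ltNge; move: (hC _ Wy); rewrite N0 !mulr0 => ->.
  have Np : 0 < mN k y by rewrite lt_neqAle eq_sym N0 mN_ge0.
  have dN0 : 0 <= d / mN k y by rewrite divr_ge0 ?ltW.
  apply: h; exists i, (fun t => (d / mN k y) *: y t); split.
  - exact: (mW_scale ab p1 _ Wy).1.
  - rewrite (le_trans (mW_scale ab p1 _ Wy).2)// ger0_norm//.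
    by rewrite divfK.
  - rewrite (blin_scale (HB i))//.
    have -> : absM ((d / mN k y) *: B i y) = d / mN k y * absM (B i y).
      rewrite /absM mulr_sumr; apply: eq_bigr => i1 _; rewrite mulr_sumr.
      apply: eq_bigr => i2 _; by rewrite mxE normrM ger0_norm.
    apply: le_trans (ler_wpM2l dN0 (ltW lt1)).
    by rewrite mulrACA [_ / d]mulrC !mulrA divfK// mulfV ?gt_eqF// mul1r.
(* A stage consists of the current point, a radius within which all later points stay, and the index
   of the operator made large at that point. *)
pose S := ((R -> 'cV[R]_m) * R * nat)%type.
pose good (s : S) := mW k s.1.1 /\ 0 < s.1.2.
pose P (js : nat * S) (s' : S) := good js.2 -> [/\ good s',
  mN k (fun t => s'.1.1 t - js.2.1.1 t) <= js.2.1.2 / 2,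
  s'.1.2 <= js.2.1.2 / 2,
  js.1%:R <= absM (B s'.2 s'.1.1) &
  forall y, mW k y -> mN k y <= s'.1.2 -> absM (B s'.2 y) <= 1].
have [F hF] : {F & forall js, P js (F js)}.
  apply: choice => -[j [[x d] i0]]; rewrite /P/good/=.
  case: (pselect (mW k x /\ 0 < d)) => [[Wx d0]|ng]; last by exists (x, d, i0).
  have [i [y [Wy Ny By]]] := hump (d / 2) j%:R (divr_gt0 d0 (ltr0Sn _ 1)) (ler0n _ _).
  have [C C0 hC] := (HB i).2.
  have Cp : 0 < C + 1 by rewrite ltr_wpDl.
  (* Halving keeps all later points within [d']; the other bound makes [B i] at most 1 on the ball
     of radius [d'], so later steps cannot undo its large value. *)
  pose d' := Num.min (d / 2) (C + 1)^-1.
  have d'0 : 0 < d' by rewrite lt_min divr_gt0//= invr_gt0.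
  have fin x' : mW k x' -> mN k (fun t => x' t - x t) <= d / 2 ->
      j%:R <= absM (B i x') -> exists s' : S, mW k x /\ 0 < d -> [/\ mW k s'.1.1 /\ 0 < s'.1.2,
      mN k (fun t => s'.1.1 t - x t) <= d / 2, s'.1.2 <= d / 2,
      j%:R <= absM (B s'.2 s'.1.1) &
      forall y, mW k y -> mN k y <= s'.1.2 -> absM (B s'.2 y) <= 1].
    move=> Wx' Nx' Bx'; exists (x', d', i) => _; split => //=.
      by rewrite ge_min lexx.
    move=> z Wz Nz; rewrite (le_trans (hC _ Wz))//.
    have : mN k z <= (C + 1)^-1 by rewrite (le_trans Nz)// ge_min lexx orbT.
    move=> /(ler_wpM2l C0) /le_trans; apply.
    by rewrite ler_pdivrMr// mul1r lerDl.
  have Wp := mW_add ab p1 Wx Wy; have Wm := mW_sub ab p1 Wx Wy.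
  (* B(x + y) - B(x - y) = 2 B y, so one of the two images has size at least |B y| >= j. *)
  have := absM_add (B i (fun t => x t + y t)) (- B i (fun t => x t - y t)).
  rewrite absM_opp (blin_add (HB i))// (blin_sub (HB i))//.
  rewrite opprB addrC addrA subrK.
  have -> : absM (B i y + B i y) = 2 * absM (B i y).
    rewrite /absM mulr_sumr; apply: eq_bigr => i1 _; rewrite mulr_sumr.
    by apply: eq_bigr => i2 _; rewrite mxE -mulr2n normrMn mulr_natl.
  have [jp _|jp] := leP j%:R (absM (B i (fun t => x t + y t))).
    apply: (fin _ Wp.1) jp; rewrite (_ : (fun t => _ - _) = y)//.
    by apply/funext => t; rewrite addrAC subrr add0r.
  move=> h; apply: (fin _ Wm.1).
    rewrite (le_trans _ Ny)//.
    have := (mW_scale ab p1 (-1) Wy).2; rewrite normrN normr1 mul1r.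
    rewrite (_ : (fun t => -1 *: _) = (fun t => x t - y t - x t))//.
    by apply/funext => t; rewrite scaleN1r addrAC subrr add0r.
  rewrite (blin_sub (HB i))//; move: jp; rewrite (blin_add (HB i))//.
  by move: h By; lra.
pose s := fix s j : S := if j is j'.+1 then F (j', s j') else ((fun=> 0), 1, 0%N).
have gs j : good (s j).
  elim: j => [|j IH]; last by have [] := hF (j, s j) IH.
  by split => //=; exact: mW_cst.
have hs j : [/\ good (s j.+1),
  mN k (fun t => (s j.+1).1.1 t - (s j).1.1 t) <= (s j).1.2 / 2,
  (s j.+1).1.2 <= (s j).1.2 / 2, j%:R <= absM (B (s j.+1).2 (s j.+1).1.1) &
  forall y, mW k y -> mN k y <= (s j.+1).1.2 -> absM (B (s j.+1).2 y) <= 1].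
  exact: (hF (j, s j) (gs j)).
have dle j : (s j).1.2 <= 2^-1 ^+ j.
  elim: j => [|j IH]; first by rewrite expr0.
  have [_ _ h _ _] := hs j; rewrite (le_trans h)// exprSr.
  by rewrite ler_wpM2r// invr_ge0.
have [] := mW_complete ab p1 (k := k) (X_ := fun j => (s j).1.1) (C := 1).
- by [].
- by move=> j; have [] := gs j.
- move=> j; have [_ h _ _ _] := hs j; rewrite mul1r (le_trans h)//.
  have [_ d0] := gs j; rewrite (le_trans _ (dle j))// ler_pdivrMr//.
  by rewrite ler_peMr ?ltW// ltr1n.
move=> x [C [Wx xC]].
have tail j l : mN k (fun t => (s (j + l)%N).1.1 t - (s j).1.1 t) <=
    (s j).1.2 - (s (j + l)%N).1.2.
  elim: l => [|l IH].
    rewrite addn0 subrr (_ : (fun _ => _) = (fun=> 0)) ?mN0//.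
    by apply/funext => t; rewrite subrr.
  have [Wj _] := gs j; have [Wl dl] := gs (j + l)%N.
  have [[Wl1 _] h1 h2 _ _] := hs (j + l)%N.
  rewrite addnS (le_trans (mN_tri Wl1 Wl Wj))//.
  by move: IH h1 h2; lra.
have xs j : mN k (fun t => x t - (s j).1.1 t) <= (s j).1.2.
  have [Wj dj] := gs j.
  rewrite -subr_le0; set z := _ - _.
  (* The positive part of the excess [z] is at most C / 2^l for every l, through the stage j + l,
     hence zero. *)
  have : Num.max z 0 = 0.
    apply: (geo_le0 (C := C)); first by rewrite le_max lexx orbT.
    move=> l; rewrite ge_max; apply/andP; split; last first.
      by rewrite (le_trans _ (xC l))// mN_ge0.
    have [Wl dl] := gs (j + l)%N.
    have h1 := mN_tri Wx Wl Wj; have h2 := tail j l; have h3 := xC (j + l)%N.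
    have C0 : 0 <= C.
      by have := xC 0%N; rewrite expr0 mulr1; apply: le_trans; exact: mN_ge0.
    have h4 : C * 2^-1 ^+ (j + l) <= C * 2^-1 ^+ l.
      rewrite ler_wpM2l// exprD ler_piMl ?exprn_ge0 ?invr_ge0//.
      by rewrite exprn_ile1 ?invr_ge0// invf_le1// ler1n.
    by rewrite /z; move: h1 h2 h3 h4 dl; lra.
  by move=> <-; rewrite le_max lexx.
have [K hK] := Bpt x Wx.
(* At stage j + 1 the image of the stage point is at least j, and passing to the limit x changes it
   by at most 1; j > K + 1 contradicts the pointwise bound [K]. *)
pose j := (Num.truncn (K + 1)).+1.
have [[Wj _] _ _ h1 h2] := hs j.
have := h2 _ (mW_sub ab p1 Wx Wj).1 (xs j.+1).
rewrite (blin_sub (HB _))// => h3.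
have := absM_add (B (s j.+1).2 x) (- (B (s j.+1).2 x - B (s j.+1).2 (s j.+1).1.1)).
rewrite absM_opp opprB addrC subrK => h4.
have : K + 1 < j%:R by rewrite truncnS_gt.
by have := hK (s j.+1).2; move: h1 h3 h4; lra.
Qed.

(** Otherwise there are parameters f i -> 0 at which the constant i fails. The operators [B (f i)]
    are pointwise bounded: by convergence when f i < d, and by a finite sum for the remaining
    indices i < N. *)
Lemma blin_bounded_near k m q (B : R -> (R -> 'cV[R]_m) -> 'cV[R]_q) eps0 :
  0 < eps0 -> (forall e, 0 <= e < eps0 -> blin k (B e)) ->
  (forall y, mW k y -> vanish (fun e => absM (B e y - B 0 y))) ->
  exists2 C : R, 0 <= C &
  \forall e \near (0 : R)^'+, forall y, mW k y -> absM (B e y) <= C * mN k y.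
Proof.
move=> eps0_gt0 HB Bv; apply: contrapT => h.
have pick i : exists e : R, 0 < e < Num.min eps0 i.+1%:R^-1 /\
    exists y, mW k y /\ i%:R * mN k y < absM (B e y).
  apply: contrapT => h'; apply: h; exists i%:R => //; apply/near_right0P.
  exists (Num.min eps0 i.+1%:R^-1); first by rewrite lt_min eps0_gt0 invr_gt0/=.
  move=> e he y Wy; rewrite leNgt; apply/negP => lt1.
  by apply: h'; exists e; split => //; exists y.
have [f hf] := choice pick.
have Bf i : blin k (B (f i)).
  have [/andP[f0]] := hf i; rewrite lt_min => /andP[fe _] _.
  by apply: HB; rewrite ltW.
have [|C C0 hC] := blin_bounded_seq Bf.
  move=> y Wy; have /near_right0P[d d0 hd] := vanish_lt (Bv y Wy) ltr01.
  pose N := (Num.truncn d^-1).+1.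
  exists (absM (B 0 y) + 1 + \sum_(i < N) absM (B (f i) y)) => i.
  have S0 : 0 <= \sum_(i < N) absM (B (f i) y).
    by apply: sumr_ge0 => ? _; exact: absM_ge0.
  have [iN|Ni] := ltnP i N.
    rewrite (bigD1 (Ordinal iN))//= addrCA lerDl !addr_ge0 ?absM_ge0//.
    by apply: sumr_ge0 => ? _; exact: absM_ge0.
  have [/andP[f0]] := hf i; rewrite lt_min => /andP[_ fi] _.
  have fd : f i < d.
    rewrite (lt_le_trans fi)// invf_ple ?posrE// (le_trans (ltW (truncnS_gt _)))//.
    by rewrite ler_nat ltnW.
  have := hd (f i); rewrite f0 fd => /(_ isT).
  rewrite ger0_norm ?absM_ge0// => h1.
  have := absM_add (B (f i) y - B 0 y) (B 0 y); rewrite subrK => h2.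
  by move: h1 h2 S0; lra.
pose i := (Num.truncn C).+1.
have [_ [y [Wy]]] := hf i; apply/negP; rewrite -leNgt.
by rewrite (le_trans (hC i y Wy))// ler_wpM2r ?mN_ge0// ltW// truncnS_gt.
Qed.

End uniform_boundedness.

(** * The real boundary-value problem *)

Section real_problem.
Variables (R : realType) (a b p : R).
Hypotheses (ab : a < b) (p1 : 1 <= p).
Local Notation I := `[a, b]%classic.
Local Notation mW := (mW a b p).
Local Notation mN := (mN a b p).
Local Notation mD := (mD a b).
Local Notation mDn := (mDn a b).
Local Notation eqW := (eqW a b).
Local Notation blin := (blin a b p).

Lemma eqW_map (T U : Type) k (op : R -> T -> U) (x x' : R -> T) :
  eqW k x x' -> eqW k (fun t => op t (x t)) (fun t => op t (x' t)).
Proof. by move=> e; exact: (eqW_comp2 (fun w t => op t w) e (eqW_pt k (fun t _ => erefl t))). Qed.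

Lemma mN_eq0 k m l (y : R -> 'M[R]_(m, l)) : mW k.+1 y -> mN k.+1 y = 0 ->
  forall t, I t -> y t = 0.
Proof.
move=> Wy y0 t It; apply/matrixP => i j; rewrite mxE; apply/eqP.
have W1 : mW 1 y by exact: mW_le Wy.
have [C C0 h] := @mW_embed_le _ a b p ab p1 1 k.+1 isT.
have N1 : mN 1 y <= 0 by rewrite (le_trans (h _ _ _ Wy))// y0 mulr0.
rewrite -normr_le0 (le_trans (W_sup ab p1 (W1 i j) It))// mulr_ge0_le0//.
  by rewrite (le_trans ler01 (Csup_ge1 ab)).
exact: le_trans (mN_entry _ _ _ _ _ _ _) N1.
Qed.

Lemma mN_cst k m l (v : 'M[R]_(m, l)) : mN k.+1 (fun=> v) = absM v.
Proof.
rewrite mN_S -[RHS]addr0; congr (_ + _); rewrite -(mN0 ab p1 k m l).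
apply: (mW_eqW ab p1 _ _ (mD_cst ab p1 k v)); last exact: mW_cst.
by apply: mW_D; exact: mW_cst.
Qed.

Lemma mW_mul_cst k : exists2 C : R, 0 <= C &
  forall m l q (Y : R -> 'M[R]_(m, l)) (v : 'M[R]_(l, q)), mW k Y ->
  mW k (fun t => Y t *m v) /\ mN k (fun t => Y t *m v) <= C * (mN k Y * absM v).
Proof.
have [C C0 h] := mW_mul ab p1 k; exists C => // m l q Y v WY.
by have := h _ _ _ _ _ WY (mW_cst ab p1 k.+1 v); rewrite mN_cst.
Qed.

Lemma mD_mul_cst k m l q (Y : R -> 'M[R]_(m, l)) (v : 'M[R]_(l, q)) :
  mW k.+1 Y -> eqW k (mD (fun t => Y t *m v)) (fun t => mD Y t *m v).
Proof.
move=> WY; apply: eqW_trans (mW_mulD ab p1 WY (mW_cst ab p1 k.+1 v)).2 _.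
have := eqW_map (fun t w => mD Y t *m v + Y t *m w) (mD_cst ab p1 k v).
by move/eqW_trans; apply; apply: eqW_pt => t _; rewrite mulmx0 addr0.
Qed.

Lemma mDn_lin i k m l (c : R) (x y : R -> 'M[R]_(m, l)) :
  mW (k + i) x -> mW (k + i) y ->
  eqW k (mDn i (fun t => c *: x t + y t)) (fun t => c *: mDn i x t + mDn i y t).
Proof.
elim: i k => [|i IH] k Wx Wy; first by exact: eqW_pt.
rewrite addnS -addSn in Wx Wy.
have h := IH _ Wx Wy.
apply: eqW_trans (eqW_pt k (mD_eq h)) _.
by apply: (mD_lin ab p1); exact: mW_mDn.
Qed.

Lemma mDn_mul_cst i k m l q (Y : R -> 'M[R]_(m, l)) (v : 'M[R]_(l, q)) :
  mW (k + i) Y -> eqW k (mDn i (fun t => Y t *m v)) (fun t => mDn i Y t *m v).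
Proof.
elim: i k => [|i IH] k WY; first by exact: eqW_pt.
rewrite addnS -addSn in WY.
apply: eqW_trans (eqW_pt k (mD_eq (IH _ WY))) _.
by apply: mD_mul_cst => //; exact: mW_mDn.
Qed.

Lemma inj_unitmx q (X : 'M[R]_q) : (forall v : 'cV_q, X *m v = 0 -> v = 0) ->
  X \in unitmx.
Proof.
move=> h; rewrite -unitmx_tr -row_free_unit -kermx_eq0; apply/eqP/row_matrixP => i.
rewrite row0 -[LHS]trmxK (h (row i (kermx X^T))^T) ?trmx0//.
by rewrite -[LHS]trmxK trmx_mul trmxK -row_mul mulmx_ker row0 trmx0.
Qed.

Section fixed_operator.
Variables (r' M n : nat).
Local Notation r := r'.+1.
Local Notation Lop := (@Lop _ a b r' M _).
Local Notation st := (@st _ a b r' M _).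

Lemma mW_low i l (y : R -> 'M[R]_(M, l)) : (i < r)%N -> mW (n + r) y ->
  mW (n.+1 + i) y.
Proof. by move=> ir; apply: mW_le; lia. Qed.

Lemma Lop_lin l A c (x y : R -> 'M[R]_(M, l)) : mW (n + r) x -> mW (n + r) y ->
  eqW n (Lop A (fun t => c *: x t + y t)) (fun t => c *: Lop A x t + Lop A y t).
Proof.
move=> Wx Wy; have h := mDn_lin (i := r) c Wx Wy.
have e := eqW_map (fun t w =>
  w + \sum_(i < r) A i t *m mDn i (fun t => c *: x t + y t) t) h.
apply: eqW_trans e _; apply: eqW_pt => t It.
rewrite /Lop scalerDr addrACA scaler_sumr -big_split/=; congr (_ + _).
apply: eq_bigr => i _.
have := mDn_lin c (mW_low (ltn_ord i) Wx) (mW_low (ltn_ord i) Wy).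
by move=> /(_ t It) ->; rewrite mulmxDr scalemxAr.
Qed.

Lemma Lop_sub l A (x y : R -> 'M[R]_(M, l)) : mW (n + r) x -> mW (n + r) y ->
  eqW n (Lop A (fun t => x t - y t)) (fun t => Lop A x t - Lop A y t).
Proof.
move=> Wx Wy; have := Lop_lin A (-1) Wy Wx.
rewrite (_ : (fun t => -1 *: y t + x t) = (fun t => x t - y t)).
  by move/eqW_trans; apply; apply: eqW_pt => t _; rewrite scaleN1r addrC.
by apply/funext => t; rewrite scaleN1r addrC.
Qed.

Lemma Lop_mul l l' A (Y : R -> 'M[R]_(M, l)) (v : 'M[R]_(l, l')) :
  mW (n + r) Y -> eqW n (Lop A (fun t => Y t *m v)) (fun t => Lop A Y t *m v).
Proof.
move=> WY; have h := mDn_mul_cst (i := r) v WY.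
have e := eqW_map (fun t w =>
  w + \sum_(i < r) A i t *m mDn i (fun t => Y t *m v) t) h.
apply: eqW_trans e _; apply: eqW_pt => t It.
rewrite /Lop mulmxDl mulmx_suml; congr (_ + _).
apply: eq_bigr => i _.
have := mDn_mul_cst v (mW_low (ltn_ord i) WY).
by move=> /(_ t It) ->; rewrite mulmxA.
Qed.

Lemma Lop0 l A : eqW n (Lop A (fun=> 0 : 'M[R]_(M, l))) (fun=> 0).
Proof.
have := Lop_mul A (0 : 'M[R]_l) (mW_cst ab p1 (n + r) (0 : 'M[R]_(M, l))).
rewrite (_ : (fun t => _ *m 0) = (fun=> 0)); last by apply/funext => t; rewrite mulmx0.
by move/eqW_trans; apply; apply: eqW_pt => t _; rewrite mulmx0.
Qed.

Lemma st_lin l c (x y : R -> 'M[R]_(M, l)) : mW (n + r) x -> mW (n + r) y ->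
  forall t, I t -> st (fun t => c *: x t + y t) t = c *: st x t + st y t.
Proof.
move=> Wx Wy t It; apply/matrixP => s k; rewrite !mxE.
set i := (state_idx s).1.
have := mDn_lin c (mW_low (ltn_ord i) Wx) (mW_low (ltn_ord i) Wy).
by move=> /(_ t It) ->; rewrite !mxE.
Qed.

Lemma st_sub l (x y : R -> 'M[R]_(M, l)) : mW (n + r) x -> mW (n + r) y ->
  forall t, I t -> st (fun t => x t - y t) t = st x t - st y t.
Proof.
move=> Wx Wy t It; have := st_lin (-1) Wy Wx It.
rewrite (_ : (fun t => -1 *: y t + x t) = (fun t => x t - y t)).
  by rewrite scaleN1r addrC.
by apply/funext => s; rewrite scaleN1r addrC.
Qed.

Lemma st_mul l l' (Y : R -> 'M[R]_(M, l)) (v : 'M[R]_(l, l')) : mW (n + r) Y ->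
  forall t, I t -> st (fun t => Y t *m v) t = st Y t *m v.
Proof.
move=> WY t It; apply/matrixP => s k; rewrite !mxE.
set i := (state_idx s).1.
have := mDn_mul_cst v (mW_low (ltn_ord i) WY).
by move=> /(_ t It) ->; rewrite !mxE; apply: eq_bigr => j _; rewrite mxE.
Qed.

Lemma st_eq l (x y : R -> 'M[R]_(M, l)) : (forall t, I t -> x t = y t) ->
  forall t, I t -> st x t = st y t.
Proof. by move=> xy t It; apply/matrixP => s k; rewrite !mxE (mDn_eq _ xy It). Qed.

Lemma st0 l t : I t -> st (fun=> 0 : 'M[R]_(M, l)) t = 0.
Proof.
move=> It; have := st_mul (0 : 'M[R]_l) (mW_cst ab p1 (n + r) (0 : 'M[R]_(M, l))) It.
by rewrite !mulmx0.
Qed.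

Lemma mN_Lop_eq l A (x : R -> 'M[R]_(M, l)) f :
  (forall i, (i < r)%N -> mW n (A i)) -> mW (n + r) x -> mW n f ->
  eqW n (Lop A x) f -> mN n (Lop A x) = mN n f.
Proof.
move=> WA Wx Wf e; apply: mW_eqW => //.
by have [C _ h] := Lop_W ab p1 r' M n; exact: (h _ _ _ _ WA WA Wx).1.
Qed.

Definition rsolves A (B : (R -> 'cV[R]_M) -> 'cV[R]_(r * M)) f c y :=
  [/\ mW (n + r) y, eqW n (Lop A y) f & B y = c].

Section solvability.
Variables (A : nat -> R -> 'M[R]_M) (B : (R -> 'cV[R]_M) -> 'cV[R]_(r * M)).
Hypotheses (WA : forall i, (i < r)%N -> mW n (A i)) (HB : blin (n + r) B).

Lemma rsolves_sub f c f' c' x y : rsolves A B f c x -> rsolves A B f' c' y ->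
  rsolves A B (fun t => f t - f' t) (c - c') (fun t => x t - y t).
Proof.
move=> [Wx Lx <-] [Wy Ly <-]; split; first exact: (mW_sub ab p1 Wx Wy).1.
  apply: eqW_trans (Lop_sub A Wx Wy) _.
  exact: (eqW_comp2 (fun v w => v - w) Lx Ly).
exact: blin_sub HB _ _ Wx Wy.
Qed.

Hypothesis inj : forall y, rsolves A B (fun=> 0) 0 y -> forall t, I t -> y t = 0.

Lemma rsolves_unique f c x y : rsolves A B f c x -> rsolves A B f c y ->
  forall t, I t -> x t = y t.
Proof.
move=> sx sy t It; apply/eqP; rewrite -subr_eq0; apply/eqP.
apply: (inj (y := fun t => x t - y t)) It.
have [W1 e1 e2] := rsolves_sub sx sy; split => //; last by rewrite e2 subrr.
by apply: eqW_trans e1 _; apply: eqW_pt => s _; rewrite subrr.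
Qed.

(** The characteristic matrix of the problem. It is square because the number of boundary conditions
    equals the dimension r M of the space of states. *)
Definition boundary_mx (Y : R -> 'M[R]_(M, r * M)) : 'M[R]_(r * M) :=
  \matrix_(i, j) B (fun t => col j (Y t)) i 0.

(** A vector v in the kernel makes Y v a solution of the homogeneous problem, hence zero, while its
    state at [a] is v. *)
Lemma boundary_mx_unit Y : mW (n + r) Y -> st Y a = 1%:M ->
  eqW n (Lop A Y) (fun=> 0) -> boundary_mx Y \in unitmx.
Proof.
move=> WY Ya LY; apply: inj_unitmx => v Yv0.
have [C _ h] := mW_mul_cst (n + r); have [WYv _] := h _ _ _ Y v WY.
have sYv : rsolves A B (fun=> 0) 0 (fun t => Y t *m v).
  split => //; last by rewrite (blin_mul ab p1 HB).
  apply: eqW_trans (Lop_mul A v WY) _.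
  apply: (eqW_trans (eqW_comp (fun w => w *m v) LY)).
  by apply: eqW_pt => t _; rewrite mul0mx.
have Ia := I_a ab.
have := st_mul v WY Ia; rewrite Ya mul1mx => <-.
by rewrite (st_eq (inj sYv) Ia) st0.
Qed.

(** A particular solution x with zero state at [a] is corrected by Y v, with v chosen to meet the
    boundary condition. *)
Lemma rsolvable f c : mW n f -> exists2 y, rsolves A B f c y &
  forall z, rsolves A B f c z -> forall t, I t -> z t = y t.
Proof.
move=> Wf; suff [y sy] : exists y, rsolves A B f c y.
  by exists y => // z sz t It; exact: rsolves_unique sz sy t It.
have [Y [WY Ya LY]] := Lop_exists ab p1 (1%:M : 'M[R]_(r * M)) WA
  (mW_cst ab p1 n (0 : 'M[R]_(M, r * M))).
have [x [Wx _ Lx]] := Lop_exists ab p1 (0 : 'cV[R]_(r * M)) WA Wf.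
have U := boundary_mx_unit WY Ya LY.
pose v := invmx (boundary_mx Y) *m (c - B x).
have [C _ h] := mW_mul_cst (n + r); have [WYv _] := h _ _ _ Y v WY.
exists (fun t => Y t *m v + x t); split; first exact: (mW_add ab p1 WYv Wx).1.
  rewrite (_ : (fun t => _) = (fun t => 1 *: (Y t *m v) + x t)); last first.
    by apply/funext => t; rewrite scale1r.
  apply: eqW_trans (Lop_lin A 1 WYv Wx) _.
  apply: (eqW_trans (eqW_comp2 (fun w z => 1 *: w + z) (Lop_mul A v WY) Lx)).
  apply: (eqW_trans (eqW_map (fun t w => 1 *: (w *m v) + f t) LY)).
  by apply: eqW_pt => t _; rewrite mul0mx scaler0 add0r.
by rewrite (blin_add HB)// (blin_mul ab p1 HB)// mulKVmx// subrK.
Qed.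

End solvability.
End fixed_operator.
End real_problem.

(** * Sufficiency of the three conditions for the real problem *)

Section real_main.
Variables (R : realType) (a b p : R).
Hypotheses (ab : a < b) (p1 : 1 <= p).
Local Notation I := `[a, b]%classic.
Local Notation mW := (mW a b p).
Local Notation mN := (mN a b p).
Local Notation mD := (mD a b).
Local Notation mDn := (mDn a b).
Local Notation eqW := (eqW a b).
Local Notation blin := (blin a b p).
Variables (r' M n : nat).
Local Notation r := r'.+1.
Local Notation Lop := (@Lop _ a b r' M _).
Local Notation st := (@st _ a b r' M _).
Local Notation rsolves := (@rsolves _ a b p r' M n).
Variables (eps0 : R) (A : nat -> R -> R -> 'M[R]_M)
  (B : R -> (R -> 'cV[R]_M) -> 'cV[R]_(r * M)).
Hypothesis eps0_gt0 : 0 < eps0.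
Hypothesis WA : forall e, 0 <= e < eps0 -> forall i, (i < r)%N -> mW n (A i e).
Hypothesis HB : forall e, 0 <= e < eps0 -> blin (n + r) (B e).
Local Notation At e := (fun i => A i e).
Local Notation sol e := (rsolves (At e) (B e)).

Definition rdepends := exists eps1 : R, [/\ 0 < eps1 < eps0,
  forall e, 0 <= e < eps1 -> forall f c, mW n f ->
    exists2 y, sol e f c y & forall z, sol e f c z -> forall t, I t -> z t = y t &
  forall f c y, (forall e, 0 <= e < eps0 -> mW n (f e)) ->
    (forall e, 0 <= e < eps1 -> sol e (f e) (c e) (y e)) ->
    vanish (fun e => mN n (fun t => f e t - f 0 t)) ->
    vanish (fun e => absM (c e - c 0)) ->
    vanish (fun e => mN (n + r) (fun t => y e t - y 0 t))].

Let e00 : 0 <= (0 : R) < eps0. Proof. by rewrite lexx. Qed.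

Section sufficiency.
Hypothesis inj : forall y, sol 0 (fun=> 0) 0 y -> forall t, I t -> y t = 0.
Hypothesis A_cvg : forall i, (i < r)%N ->
  vanish (fun e => mN n (fun t => A i e t - A i 0 t)).
Hypothesis B_cvg : forall y, mW (n + r) y -> vanish (fun e => absM (B e y - B 0 y)).

Let SA e := \sum_(i < r) mN n (fun t => A i e t - A i 0 t).

Lemma vanish_SA : vanish SA.
Proof. by apply: vanish_sum => i; exact: A_cvg. Qed.

Lemma SA_ge0 e : 0 <= SA e.
Proof. by apply: sumr_ge0 => i _; exact: mN_ge0. Qed.

(* y is compared with Y q, where Y is the fundamental matrix of the limiting
   equation and q the state of y at a; the boundary condition controls q. *)
Lemma uniform_estimate : exists2 C : R, 0 <= C & \forall e \near (0 : R)^'+,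
  forall y, mW (n + r) y ->
  mN (n + r) y <= C * (absM (B e y) + mN n (Lop (At e) y)).
Proof.
have [dl [C1 [dl0 C10 hC1]]] := Lop_apriori ab p1 (WA e00).
have [C2 C20 hC2] := blin_bounded_near ab p1 eps0_gt0 HB B_cvg.
have [C3 C30 hC3] := Lop_W ab p1 r' M n.
have [C4 C40 hC4] := mW_mul_cst ab p1 (n + r).
have [Y [WY Ya LY]] := Lop_exists ab p1 (1%:M : 'M[R]_(r * M)) (WA e00)
  (mW_cst ab p1 n (0 : 'M[R]_(M, r * M))).
have U := boundary_mx_unit ab p1 (HB e00) inj WY Ya LY.
pose X e := boundary_mx (B e) Y.
pose K := absM (invmx (X 0)).
have Wc j : mW (n + r) (fun t => col j (Y t)).
  move=> i i'; rewrite (_ : (fun t => _) = (fun t => Y t i j))//.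
  by apply/funext => t; rewrite mxE.
have vX : vanish (fun e => absM (X e - X 0)).
  rewrite (_ : (fun e => _) = (fun e => \sum_j absM (B e (fun t => col j (Y t)) -
      B 0 (fun t => col j (Y t))))).
    by apply: vanish_sum => j; exact: B_cvg.
  apply/funext => e; rewrite /absM exchange_big/=; apply: eq_bigr => j _.
  by apply: eq_bigr => i _; rewrite big_ord1 !mxE.
pose N := mN (n + r) Y.
pose C5 := C2 * (C1 * (C3 * (C4 * N))).
have N0 : 0 <= N by exact: mN_ge0.
have K0 : 0 <= K by exact: absM_ge0.
have C50 : 0 <= C5 by rewrite !mulr_ge0.
(* This is the factor with which |q| returns on the right of [h5]; [C5] collects the constants met
   on the way from q through L(e) y0 and back through B(e). Once it is at most 1/2, |q| is
   absorbed. *)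
have veta : vanish (fun e => K * (C5 * SA e + absM (X e - X 0))).
  by apply/vanishZ/vanishD => //; apply: vanishZ; exact: vanish_SA.
exists (C1 * (2 * K * (1 + C2 * C1) + 1)).
  by rewrite mulr_ge0// addr_ge0// !mulr_ge0// addr_ge0// mulr_ge0.
near=> e => y Wy.
have he : 0 <= e < eps0 by near: e; exact: near_right_le.
have hSA : SA e <= dl.
  by rewrite (le_trans (ler_norm _))// ltW//; near: e; exact: vanish_lt vanish_SA _.
have hB : forall y, mW (n + r) y -> absM (B e y) <= C2 * mN (n + r) y by near: e.
have heta : K * (C5 * SA e + absM (X e - X 0)) <= 2^-1.
  rewrite (le_trans (ler_norm _))// ltW//; near: e; apply: (vanish_lt veta).
  by rewrite invr_gt0.
have WAe := WA he.
have ap l (z : R -> 'M[R]_(M, l)) := @hC1 l _ z WAe hSA.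
set q := st y a; set g := mN n (Lop (At e) y).
have [Wy0 Ny0] := hC4 _ _ _ Y q WY.
pose y0 t := Y t *m q.
have Ly0 : eqW n (Lop (At 0) y0) (fun=> 0).
  apply: eqW_trans (Lop_mul ab p1 _ _ WY) _.
  apply: (eqW_trans (eqW_comp (fun w => w *m q) LY)).
  by apply: eqW_pt => t _; rewrite mul0mx.
have Ww := (mW_sub ab p1 Wy Wy0).1.
have [WLy0 NLy0] := hC3 _ _ _ y0 WAe (WA e00) Wy0.
have WLy := (hC3 _ _ _ y WAe (WA e00) Wy).1.
have WLw := (hC3 _ _ _ _ WAe (WA e00) Ww).1.
have g0 : 0 <= g by exact: mN_ge0.
(* As L(0) y0 = 0, L(e) y0 equals (L(e) - L(0)) y0, which is controlled by the coefficient
   differences. *)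
have NLy0' : mN n (Lop (At e) y0) <= C3 * SA e * mN (n + r) y0.
  rewrite (le_trans _ NLy0)// le_eqVlt; apply/orP; left; apply/eqP.
  apply: mW_eqW => //.
    apply: (mW_sub ab p1 WLy0 _).1; exact: (hC3 _ _ _ y0 (WA e00) (WA e00) Wy0).1.
  apply: eqW_sym; apply: (eqW_trans (eqW_map (fun t w => Lop (At e) y0 t - w) Ly0)).
  by apply: eqW_pt => t _; rewrite subr0.
have NLw : mN n (Lop (At e) (fun t => y t - y0 t)) <= g + mN n (Lop (At e) y0).
  rewrite (le_trans _ (mW_sub ab p1 WLy WLy0).2)// le_eqVlt; apply/orP; left.
  apply/eqP; apply: mW_eqW => //; first exact: (mW_sub ab p1 WLy WLy0).1.
  exact: (Lop_sub ab p1 _ Wy Wy0).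
(* y - y0 starts from the zero state, so the a priori estimate involves only L(e) (y - y0). *)
have wa : st (fun t => y t - y0 t) a = 0.
  rewrite (st_sub ab p1 Wy Wy0)// ?(st_mul ab p1 _ WY) ?Ya ?mul1mx ?subrr//; exact: I_a.
have Nw := ap _ _ Ww; rewrite wa absM0 add0r in Nw.
have By0 : B e y0 = X e *m q by rewrite (blin_mul ab p1 (HB he)).
have Bw : B e (fun t => y t - y0 t) = B e y - X e *m q.
  by rewrite (blin_sub (HB he))// By0.
set Q := absM q; set D := absM (B e y).
have Q0 : 0 <= Q by exact: absM_ge0.
have D0 : 0 <= D by exact: absM_ge0.
have h1 : absM (X e *m q) <= D + C2 * mN (n + r) (fun t => y t - y0 t).
  have := absM_add (B e y) (- (B e y - X e *m q)); rewrite absM_opp opprB addrC subrK.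
  by move/le_trans; apply; rewrite lerD2l -Bw; exact: hB.
have h2 : absM (X 0 *m q) <= absM (X e *m q) + absM (X e - X 0) * Q.
  have := absM_add (X e *m q) (- ((X e - X 0) *m q)).
  rewrite absM_opp mulmxBl opprB addrC subrK => /le_trans; apply.
  by rewrite lerD2l -mulmxBl; exact: absM_mul.
have h3 : Q <= K * absM (X 0 *m q).
  by rewrite /Q -{1}(mulKmx U q); exact: absM_mul.
have h4 : mN (n + r) (fun t => y t - y0 t) <= C1 * (g + C3 * SA e * (C4 * (N * Q))).
  rewrite (le_trans Nw)// ler_wpM2l// (le_trans NLw)// lerD2l (le_trans NLy0')//.
  by rewrite ler_wpM2l// mulr_ge0// SA_ge0.
have h5 : Q <= K * (D + C2 * (C1 * g)) + K * (C5 * SA e + absM (X e - X 0)) * Q.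
  rewrite (le_trans h3)// -mulrA -mulrDr ler_wpM2l// (le_trans h2)//.
  rewrite mulrDl addrA lerD2r (le_trans h1)// -addrA lerD2l.
  rewrite (le_trans (ler_wpM2l C20 h4))// mulrDr mulrDr lerD2l /C5.
  by rewrite le_eqVlt; apply/orP; left; apply/eqP; ring.
have h6 : Q <= 2 * (K * (D + C2 * (C1 * g))).
  have : K * (C5 * SA e + absM (X e - X 0)) * Q <= 2^-1 * Q by rewrite ler_wpM2r.
  by move: h5; lra.
rewrite (le_trans (ap _ _ Wy))// -[leRHS]mulrA ler_wpM2l//.
rewrite -/q -/Q -/g (_ : _ * (D + g) = 2 * (K * (D + C2 * (C1 * g))) + g +
  (D + 2 * (K * (g + C2 * (C1 * D))))); last by ring.
rewrite (@le_trans _ _ (2 * (K * (D + C2 * (C1 * g))) + g)) ?lerD2r//.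
by rewrite lerDl !(addr_ge0, mulr_ge0).
Unshelve. all: by end_near. Qed.

Lemma rdepends_sufficient : rdepends.
Proof.
have [C C0 hC] := uniform_estimate.
have [d d0 hd] := (near_right0P _).1 hC.
have mpos : 0 < Num.min d (eps0 / 2) by rewrite lt_min d0 divr_gt0.
(* The half keeps the new bound strictly below [eps0]. *)
exists (Num.min d (eps0 / 2)); split.
- rewrite mpos/= (@le_lt_trans _ _ (eps0 / 2)) ?ge_min ?lexx ?orbT//.
  by rewrite ltr_pdivrMr// ltr_pMr// ltr1n.
- move=> e /andP[e0 em] f c Wf.
  have he : 0 <= e < eps0.
    rewrite e0 (lt_trans em)// (@le_lt_trans _ _ (eps0 / 2)) ?ge_min ?lexx ?orbT//.
    by rewrite ltr_pdivrMr// ltr_pMr// ltr1n.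
  apply: (rsolvable ab p1 (WA he) (HB he)) => //.
  (* The uniform estimate covers e > 0 only; at e = 0 uniqueness is the assumption on the limiting
     problem. *)
  have [->|en0] := eqVneq e 0; first exact: inj.
  move=> y [Wy Ly By] t It; move: Wy Ly; rewrite addnS => Wy Ly.
  apply: (mN_eq0 ab p1 Wy) It; apply/eqP; rewrite eq_le mN_ge0 andbT.
  have ed : 0 < e < d.
    by rewrite lt_neqAle eq_sym en0 e0/= (lt_le_trans em)// ge_min lexx.
  move: Wy; rewrite -addnS => Wy; rewrite (le_trans (hd _ ed _ Wy))//.
  rewrite By (mN_Lop_eq ab p1 (WA he) Wy (mW_cst ab p1 n 0) Ly) (mN0 ab p1).
  by rewrite absM0 addr0 mulr0.
move=> f c y Wf sy vf vc.
have hs0 : 0 <= (0 : R) < Num.min d (eps0 / 2) by rewrite lexx.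
have [Wy0 Ly0 By0] := sy 0 hs0.
have [C3 C30 hC3] := Lop_W ab p1 r' M n.
(* For w = y(e) - y(0), B(e) w is c(e) - c(0) minus (B(e) - B(0)) y(0), and L(e) w is f(e) - f(0)
   minus (L(e) - L(0)) y(0). The operator differences act on the fixed function y(0), so strong
   convergence of B(e) is enough. *)
apply: (@vanish_le _ _ (fun e => C * ((absM (c e - c 0) + absM (B e (y 0) - B 0 (y 0)))
   + (mN n (fun t => f e t - f 0 t) + C3 * (mN (n + r) (y 0) * SA e))))); last first.
  apply/vanishZ/vanishD; first exact: vanishD (B_cvg Wy0).
  by apply: vanishD => //; do 2 apply: vanishZ; exact: vanish_SA.
near=> e.
have em : 0 <= e < Num.min d (eps0 / 2) by near: e; exact: near_right_le.
have he : 0 <= e < eps0 by near: e; exact: near_right_le.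
rewrite ger0_norm ?mN_ge0//.
have [Wy Ly By] := sy e em.
have Ww := (mW_sub ab p1 Wy Wy0).1.
have hCe : forall y, mW (n + r) y ->
  mN (n + r) y <= C * (absM (B e y) + mN n (Lop (At e) y)) by near: e.
rewrite (le_trans (hCe _ Ww))// ler_wpM2l// lerD//.
  rewrite (blin_sub (HB he))// By.
  have -> : c e - B e (y 0) = (c e - c 0) - (B e (y 0) - B 0 (y 0)).
    by rewrite By0 opprB addrA subrK.
  by rewrite (le_trans (absM_add _ _))// absM_opp.
have [WL1 NL1] := hC3 _ _ _ _ (WA he) (WA e00) Wy0.
have WL2 := (hC3 _ _ _ _ (WA e00) (WA e00) Wy0).1.
have WL3 := (hC3 _ _ _ _ (WA he) (WA he) Ww).1.
have Wd := (mW_sub ab p1 (Wf _ he) (Wf _ e00)).1.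
have Wdd := (mW_sub ab p1 WL1 WL2).1.
have E : eqW n (Lop (At e) (fun t => y e t - y 0 t))
    (fun t => (f e t - f 0 t) - (Lop (At e) (y 0) t - Lop (At 0) (y 0) t)).
  apply: eqW_trans (Lop_sub ab p1 _ Wy Wy0) _.
  have e1 := eqW_map (fun t w => w - Lop (At e) (y 0) t) Ly.
  have e2 := eqW_map (fun t w => (f e t - w) - (Lop (At e) (y 0) t - Lop (At 0) (y 0) t)) Ly0.
  apply: eqW_trans e1 (eqW_trans _ e2); apply: eqW_pt => t _.
  by rewrite opprB addrA subrK.
rewrite (mN_Lop_eq ab p1 (WA he) Ww (mW_sub ab p1 Wd Wdd).1 E).
rewrite (le_trans (mW_sub ab p1 Wd Wdd).2)// lerD2l (le_trans NL1)//.
by rewrite -mulrA [SA e * _]mulrC.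
Unshelve. all: by end_near. Qed.

End sufficiency.
End real_main.

(** * Recovering the coefficients from the solutions *)

Section coefficients.
Variables (R : realType) (a b p : R).
Hypotheses (ab : a < b) (p1 : 1 <= p).
Local Notation I := `[a, b]%classic.
Local Notation mW := (mW a b p).
Local Notation mN := (mN a b p).
Local Notation mD := (mD a b).
Local Notation eqW := (eqW a b).

(* With E := (U e - U 0) V, the equations give
   (K e - K 0) (1 + E) = - ((U e - U 0)' + K 0 (U e - U 0)) V. *)
Lemma coefficient_cvg n q (eps1 : R) (K U : R -> R -> 'M[R]_q) (V : R -> 'M[R]_q) :
  0 < eps1 -> (forall e, 0 <= e < eps1 -> [/\ mW n (K e), mW n.+1 (U e) &
    eqW n (fun t => mD (U e) t + K e t *m U e t) (fun=> 0)]) ->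
  mW n.+1 V -> (forall t, I t -> U 0 t *m V t = 1%:M) ->
  vanish (fun e => mN n.+1 (fun t => U e t - U 0 t)) ->
  vanish (fun e => mN n (fun t => K e t - K 0 t)).
Proof.
move=> eps1_gt0 h WV UV vU.
have [C C0 hC] := mW_mul ab p1 n.
have [C' C'0 hC'] := mW_mul_same ab p1 n.
have h00 : 0 <= (0 : R) < eps1 by rewrite lexx.
have [WK0 WU0 E0] := h 0 h00.
pose N := mN n.+1 V; have N0 : 0 <= N by exact: mN_ge0.
(* Bounds ((U e - U 0)' + K 0 (U e - U 0)) V by a multiple of [dU e]. *)
pose c := C * ((1 + C * mN n (K 0)) * N).
pose dU e := mN n.+1 (fun t => U e t - U 0 t).
have c0 : 0 <= c by rewrite !(mulr_ge0, addr_ge0)// mN_ge0.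
apply: (@vanish_le _ _ (fun e => 2 * c * dU e)); last exact: vanishZ.
near=> e.
have he : 0 <= e < eps1 by near: e; exact: near_right_le.
(* Makes (K e - K 0) E at most half of K e - K 0 in norm, which is then absorbed instead of
   inverting 1 + E. *)
have small : C * (C' * N) * dU e <= 2^-1.
  rewrite (le_trans (ler_norm _))// ltW//; near: e.
  by apply: (vanish_lt (vanishZ _ vU)); rewrite invr_gt0.
have [WKe WUe Ee] := h e he.
have WdU := (mW_sub ab p1 WUe WU0).1.
have WdK := (mW_sub ab p1 WKe WK0).1.
have WE : mW n.+1 (fun t => (U e t - U 0 t) *m V t) := (mW_mulD ab p1 WdU WV).1.
have NE := hC' _ _ _ _ _ WdU WV.
have [WDE NDE] := hC _ _ _ _ _ WdK WE.
have WDU := (mW_sub ab p1 (mW_D WUe) (mW_D WU0)).1.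
have NDU : mN n (fun t => mD (U e) t - mD (U 0) t) <= dU e.
  rewrite (le_trans _ (mN_D_le _ _ _ _ (fun t => U e t - U 0 t)))// le_eqVlt; apply/orP;
    left; apply/eqP.
  apply: (mW_eqW ab p1 WDU (mW_D WdU)).
  have := mD_lin ab p1 (-1) WU0 WUe.
  rewrite (_ : (fun t => -1 *: U 0 t + U e t) = (fun t => U e t - U 0 t)).
    move=> H; apply: eqW_trans _ (eqW_sym H); apply: eqW_pt => t _.
    by rewrite scaleN1r addrC.
  by apply/funext => t; rewrite scaleN1r addrC.
have [WKU NKU] := hC _ _ _ _ _ WK0 WdU.
have [WG NG] := mW_add ab p1 WDU WKU.
have [WH NH] := hC _ _ _ _ _ WG WV.
have E : eqW n (fun t => K e t - K 0 t) (fun t => - ((mD (U e) t - mD (U 0) t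
    + K 0 t *m (U e t - U 0 t)) *m V t) - (K e t - K 0 t) *m ((U e t - U 0 t) *m V t)).
  (* For n = 0 the equations hold a.e., so they are substituted one at a time through the variable
     [w] of an expression; the remaining identity, by U 0 V = 1, is algebra. *)
  have e1 := eqW_map (fun t w => - ((w - K e t *m U e t - mD (U 0) t
    + K 0 t *m (U e t - U 0 t)) *m V t) - (K e t - K 0 t) *m ((U e t - U 0 t) *m V t)) Ee.
  have e2 := eqW_map (fun t w => - ((0 - K e t *m U e t - (w - K 0 t *m U 0 t)
    + K 0 t *m (U e t - U 0 t)) *m V t) - (K e t - K 0 t) *m ((U e t - U 0 t) *m V t)) E0.
  apply: eqW_sym; apply: (eqW_trans _ (eqW_trans e1 (eqW_trans _ (eqW_trans e2 _))));
    apply: eqW_pt => t It; rewrite ?addrK//.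
  rewrite !mulmxA -!mulNmx -mulmxDl -[RHS]mulmx1 -(UV t It) mulmxA; congr (_ *m _).
  rewrite !mulNmx !mulmxBr !mulmxBl.
  move: (K e t *m U e t) (K e t *m U 0 t) (K 0 t *m U e t) (K 0 t *m U 0 t).
  by move=> X1 X2 X3 X4; apply/matrixP => i j; rewrite !mxE; ring.
set dK := mN n (fun t => K e t - K 0 t) in NDE *.
have dK0 : 0 <= dK by exact: mN_ge0.
have NdK : dK <= mN n (fun t => (mD (U e) t - mD (U 0) t +
    K 0 t *m (U e t - U 0 t)) *m V t) + mN n (fun t => (K e t - K 0 t) *m ((U e t - U 0 t) *m V t)).
  have [WS NS] := mW_add ab p1 WH WDE; rewrite (le_trans _ NS)//.
  have := (mW_scale ab p1 (-1) WS).2; rewrite normrN normr1 mul1r; apply: le_trans.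
  rewrite le_eqVlt; apply/orP; left; apply/eqP.
  apply: (mW_eqW ab p1 WdK (mW_scale ab p1 (-1) WS).1).
  apply: eqW_trans E _; apply: eqW_pt => t _; by rewrite scaleN1r opprD.
have h1 : mN n (fun t => (K e t - K 0 t) *m ((U e t - U 0 t) *m V t)) <= dK * 2^-1.
  rewrite (le_trans NDE)// mulrCA ler_wpM2l// (le_trans _ small)//.
  by rewrite -mulrA ler_wpM2l// (le_trans NE)// -/(dU e) -mulrA ler_wpM2l// mulrC.
have dU0 : 0 <= dU e by exact: mN_ge0.
have h2 : mN n (fun t => (mD (U e) t - mD (U 0) t +
    K 0 t *m (U e t - U 0 t)) *m V t) <= c * dU e.
  rewrite (le_trans NH)// /c -!mulrA ler_wpM2l// [N * _]mulrC mulrA ler_wpM2r//.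
  rewrite (le_trans NG)// mulrDl mul1r lerD// (le_trans NKU)//.
  by rewrite mulrA.
rewrite ger0_norm// -mulrA; move: NdK h1 h2; lra.
Unshelve. all: by end_near. Qed.

End coefficients.

(** * Necessity of the three conditions for the real problem *)

Section necessity.
Variables (R : realType) (a b p : R).
Hypotheses (ab : a < b) (p1 : 1 <= p).
Local Notation I := `[a, b]%classic.
Local Notation mW := (mW a b p).
Local Notation mN := (mN a b p).
Local Notation NW := (NW a b p).
Local Notation mD := (mD a b).
Local Notation mDn := (mDn a b).
Local Notation eqW := (eqW a b).
Local Notation blin := (blin a b p).
Variables (r' M n : nat).
Local Notation r := r'.+1.
Local Notation Lop := (@Lop _ a b r' M _).
Local Notation st := (@st _ a b r' M _).
Local Notation rsolves := (@rsolves _ a b p r' M n).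

Lemma mN_companion_ge (A A' : nat -> R -> 'M[R]_M) (i : 'I_r) :
  mN n (fun t => A i t - A' i t) <=
  mN n (fun t => @companion _ r' M A t - @companion _ r' M A' t).
Proof.
rewrite {2}/mN (eq_bigr _ (fun s _ => sum_state _)) sum_state.
rewrite [leRHS](bigD1 ord_max)//= -[leLHS]addr0 lerD//; last first.
  do 4 (apply: sumr_ge0 => ? _); exact: NW_ge0.
apply: ler_sum => j _; rewrite [leRHS](bigD1 i)//= -[leLHS]addr0 lerD//; last first.
  do 2 (apply: sumr_ge0 => ? _); exact: NW_ge0.
apply: ler_sum => k _; rewrite le_eqVlt; apply/orP; left; apply/eqP; congr NW.
by apply/funext => t; rewrite !mxE !state_idxK /= ltnn.
Qed.

Variables (eps0 : R) (A : nat -> R -> R -> 'M[R]_M)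
  (B : R -> (R -> 'cV[R]_M) -> 'cV[R]_(r * M)).
Hypothesis eps0_gt0 : 0 < eps0.
Hypothesis WA : forall e, 0 <= e < eps0 -> forall i, (i < r)%N -> mW n (A i e).
Hypothesis HB : forall e, 0 <= e < eps0 -> blin (n + r) (B e).
Local Notation At e := (fun i => A i e).
Local Notation sol e := (rsolves (At e) (B e)).
Hypothesis dep : rdepends a b p n eps0 A B.

Let e00 : 0 <= (0 : R) < eps0. Proof. by rewrite lexx. Qed.

Lemma rdepends_inj y : sol 0 (fun=> 0) 0 y -> forall t, I t -> y t = 0.
Proof.
have [eps1 [/andP[e1 _] sol1 _]] := dep.
have [|z _ uz] := sol1 0 _ (fun=> 0) 0 (mW_cst ab p1 n 0); first by rewrite lexx.
move=> sy t It; rewrite (uz _ sy t It) -(uz (fun=> 0) _ t It)//.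
split; [exact: mW_cst|exact: Lop0|exact: blin0 (HB e00)].
Qed.

Lemma matrix_family : exists eps1 (Y : R -> R -> 'M[R]_(M, r * M)),
  [/\ 0 < eps1 < eps0,
   forall e, 0 <= e < eps1 -> [/\ mW (n + r) (Y e),
     eqW n (Lop (At e) (Y e)) (fun=> 0) & boundary_mx (B e) (Y e) = 1%:M] &
   vanish (fun e => mN (n + r) (fun t => Y e t - Y 0 t))].
Proof.
have [eps1 [/andP[e1 e10] sol1 cont]] := dep.
have pick (ej : R * 'I_(r * M)) : exists y, 0 <= ej.1 < eps1 ->
    sol ej.1 (fun=> 0) (delta_mx ej.2 0) y.
  case: (pselect (0 <= ej.1 < eps1)) => [he|]; last by exists (fun=> 0).
  have [y sy _] := sol1 _ he (fun=> 0) (delta_mx ej.2 0) (mW_cst ab p1 n 0).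
  by exists y.
have [y_ hy] := choice pick.
pose Y e t : 'M[R]_(M, r * M) := \matrix_(i, j) y_ (e, j) t i 0.
have colY e j : (fun t => col j (Y e t)) = y_ (e, j).
  by apply/funext => t; apply/matrixP => i k; rewrite !mxE ord1.
have DY i e j : (fun t => col j (mDn i (Y e) t)) = mDn i (y_ (e, j)).
  elim: i => [|i IH]; first exact: colY.
  rewrite /= -IH; apply/funext => t; apply/matrixP => k l; rewrite !mxE.
  by congr deriv_on; apply/funext => s; rewrite mxE.
have DYE i e j t k : mDn i (Y e) t k j = mDn i (y_ (e, j)) t k 0.
  by rewrite -DY mxE.
exists eps1, Y; split; first by rewrite e1.
  move=> e he; have sy j := hy (e, j) he; split.
  - move=> i j; have [/(_ i 0) + _ _] := sy j.
    by congr W; apply/funext => t; rewrite mxE.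
  - apply: meqW => i j; have [_ /meqW_entry /(_ i 0) Ly _] := sy j.
    apply: (eqW_trans _ (eqW_trans Ly _)); apply: eqW_pt => t _;
      last by rewrite !mxE.
    rewrite /Lop [LHS]mxE [RHS]mxE DYE !summxE; congr (_ + _).
    apply: eq_bigr => k _; rewrite [LHS]mxE [RHS]mxE.
    by apply: eq_bigr => l _; rewrite DYE.
  - apply/matrixP => i j; rewrite !mxE colY; have [_ _ ->] := sy j.
    by rewrite mxE eqxx andbT.
rewrite (_ : (fun e => _) =
  (fun e => \sum_j mN (n + r) (fun t => y_ (e, j) t - y_ (0, j) t))).
  apply: vanish_sum => j.
  (* The data of each column do not depend on e, so their convergence is trivial. *)
  apply: (cont (fun _ _ => 0) (fun=> delta_mx j 0)).
  - by move=> *; exact: mW_cst.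
  - by move=> e; exact: (hy (e, j)).
  - rewrite (_ : (fun e => _) = (fun=> 0)); first exact: vanish0.
    apply/funext => e; rewrite -[RHS](mN0 ab p1 n M 1); congr mN.
    by apply/funext => t; rewrite subrr.
  - rewrite (_ : (fun e => _) = (fun=> 0)); first exact: vanish0.
    by apply/funext => e; rewrite subrr absM0.
apply/funext => e; rewrite /mN exchange_big; apply: eq_bigr => j _.
apply: eq_bigr => i _; rewrite big_ord1; congr NW.
by apply/funext => t; rewrite !mxE.
Qed.

Lemma state_vanish l (Y : R -> R -> 'M[R]_(M, l)) eps1 : 0 < eps1 ->
  (forall e, 0 <= e < eps1 -> mW (n + r) (Y e)) ->
  vanish (fun e => mN (n + r) (fun t => Y e t - Y 0 t)) ->
  vanish (fun e => mN n.+1 (fun t => st (Y e) t - st (Y 0) t)).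
Proof.
move=> e1 WY vY; have [C C0 hC] := mN_st_le ab p1 r' M n.
apply: vanish_le (vanishZ C vY); near=> e.
have he : 0 <= e < eps1 by near: e; exact: near_right_le.
have h0 : 0 <= (0 : R) < eps1 by rewrite lexx.
have Wd := (mW_sub ab p1 (WY _ he) (WY _ h0)).1.
rewrite ger0_norm ?mN_ge0// (le_trans _ (hC _ _ Wd))// le_eqVlt; apply/orP; left.
apply/eqP; apply: mW_eqW => //.
- exact: (mW_sub ab p1 (mW_st ab p1 (WY _ he)) (mW_st ab p1 (WY _ h0))).1.
- exact: mW_st.
- by apply: eqW_pt => t It; rewrite (st_sub ab p1 (WY _ he) (WY _ h0)).
Unshelve. all: by end_near. Qed.

(** If the state of Y v vanishes at [a], the a priori estimate gives norm zero for Y v, and v =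
    B(0)(Y v) = 0. *)
Lemma state_unit Y : mW (n + r) Y -> eqW n (Lop (At 0) Y) (fun=> 0) ->
  boundary_mx (B 0) Y = 1%:M -> st Y a \in unitmx.
Proof.
move=> WY LY BY; apply: inj_unitmx => v Yv.
have [C _ h] := mW_mul_cst ab p1 (n + r); have [WYv _] := h _ _ _ Y v WY.
have <- : B 0 (fun t => Y t *m v) = v.
  by rewrite (blin_mul ab p1 (HB e00))//; move: BY; rewrite /boundary_mx => ->; rewrite mul1mx.
apply: (blin_null (HB e00) WYv); apply/eqP; rewrite eq_le mN_ge0 andbT.
have [dl [C1 [dl0 C10 hC1]]] := Lop_apriori ab p1 (WA e00).
have S0 : \sum_(i < r) mN n (fun t => A i 0 t - A i 0 t) <= dl.
  rewrite big1 ?ltW// => i _; rewrite -[RHS](mN0 ab p1 n M M); congr mN.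
  by apply/funext => t; rewrite subrr.
have LYv : eqW n (Lop (At 0) (fun t => Y t *m v)) (fun=> 0).
  apply: eqW_trans (Lop_mul ab p1 _ v WY) _.
  apply: (eqW_trans (eqW_comp (fun w => w *m v) LY)).
  by apply: eqW_pt => t _; rewrite mul0mx.
rewrite (le_trans (hC1 _ _ _ (WA e00) S0 WYv))//.
rewrite (mN_Lop_eq ab p1 (WA e00) WYv (mW_cst ab p1 n 0) LYv) (mN0 ab p1) addr0.
by rewrite (st_mul ab p1 v WY (I_a ab)) Yv absM0 mulr0.
Qed.

Lemma rdepends_A i : (i < r)%N -> vanish (fun e => mN n (fun t => A i e t - A i 0 t)).
Proof.
move=> ir; have [eps1 [Y [/andP[e1 e10] hY vY]]] := matrix_family.
have h0 : 0 <= (0 : R) < eps1 by rewrite lexx.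
have lt10 e : 0 <= e < eps1 -> 0 <= e < eps0.
  by move=> /andP[-> /lt_trans]; exact.
have WY e (he : 0 <= e < eps1) : mW (n + r) (Y e) by have [] := hY e he.
have [WY0 LY0 BY0] := hY 0 h0.
have U0 := state_unit WY0 LY0 BY0.
have WK e (he : 0 <= e < eps1) : mW n (@companion _ r' M (At e)).
  by apply: mW_companion => //; exact: WA (lt10 _ he).
have EU e (he : 0 <= e < eps1) :
    eqW n (fun t => mD (st (Y e)) t + companion r' (At e) t *m st (Y e) t) (fun=> 0).
  have [_ LY _] := hY e he.
  apply: (eqW_trans _ (eqW_trans (@eqW_last_blockI _ a b r' M n _ _ _ LY) _)).
    by apply: eqW_pt => t _; rewrite companionE.
  by apply: eqW_pt => t _; apply/matrixP => s k; rewrite !mxE; case: ifP.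
have [Psi [_ [[WPsi _] [Psia _] ePsi _ _]]] := fundamental ab p1 (WK 0 h0).
have cons := cauchy_conserved ab p1 WPsi Psia ePsi (mW_st ab p1 WY0) (EU 0 h0).
(* Psi times the state matrix of Y(0) is constant, equal to its value at [a]; this makes [V] its
   inverse, with order n + 1. *)
pose V t := invmx (st (Y 0) a) *m Psi t.
have WV : mW n.+1 V.
  exact: (mW_mulD ab p1 (mW_cst ab p1 n.+1 (invmx (st (Y 0) a))) WPsi).1.
have UV t : I t -> st (Y 0) t *m V t = 1%:M.
  by move=> It; apply: mulmx1C; rewrite /V -mulmxA cons// mulVmx.
have := @coefficient_cvg _ a b p ab p1 n _ eps1 (fun e => @companion _ r' M (At e))
  (fun e => st (Y e)) V e1.
move=> /(_ _ WV UV (state_vanish e1 WY vY)) h.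
apply: vanish_le (h _); last first.
  by move=> e he; split; [exact: WK|exact: mW_st (WY _ he)|exact: EU].
near=> e; rewrite ger0_norm ?mN_ge0//.
exact: (mN_companion_ge (At e) (At 0) (Ordinal ir)).
Unshelve. all: by end_near. Qed.

(** The right-hand sides L(e) y converge by [rdepends_A], so (I) has to be available before
    continuity can be applied to the x(e). *)
Lemma rdepends_B y : mW (n + r) y -> vanish (fun e => absM (B e y - B 0 y)).
Proof.
move=> Wy; have [eps1' [/andP[e1' e10'] sol1 cont]] := dep.
have [eps1 [Y [/andP[e1 e10] hY vY]]] := matrix_family.
have lt10 e : 0 <= e < eps1' -> 0 <= e < eps0.
  by move=> /andP[-> /lt_trans]; exact.
have h0 : 0 <= (0 : R) < eps1 by rewrite lexx.
have h0' : 0 <= (0 : R) < eps1' by rewrite lexx.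
have [WY0 LY0 BY0] := hY 0 h0.
have U0 := state_unit WY0 LY0 BY0.
have WY e (he : 0 <= e < eps1) : mW (n + r) (Y e) by have [] := hY e he.
have [C3 C30 hC3] := Lop_W ab p1 r' M n.
pose f e := Lop (At e) y.
have Wf e (he : 0 <= e < eps0) : mW n (f e).
  exact: (hC3 _ _ _ _ (WA he) (WA he) Wy).1.
have pick e : exists x, 0 <= e < eps1' -> sol e (f e) 0 x.
  case: (pselect (0 <= e < eps1')) => [he|]; last by exists (fun=> 0).
  by have [x sx _] := sol1 _ he (f e) 0 (Wf _ (lt10 _ he)); exists x.
have [x hx] := choice pick.
have vx : vanish (fun e => mN (n + r) (fun t => x e t - x 0 t)).
  apply: (cont f (fun=> 0) x Wf hx).
    apply: (@vanish_le _ _ (fun e => C3 * (mN (n + r) y *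
        \sum_(i < r) mN n (fun t => A i e t - A i 0 t)))); last first.
      by do 2 apply: vanishZ; apply: vanish_sum => i; exact: rdepends_A.
    near=> e; rewrite ger0_norm ?mN_ge0//.
    have he : 0 <= e < eps0 by near: e; exact: near_right_le.
    rewrite (le_trans (hC3 _ _ _ _ (WA he) (WA e00) Wy).2)//.
    by rewrite -mulrA [_ * mN _ _]mulrC.
  rewrite (_ : (fun e => _) = (fun=> 0)); first exact: vanish0.
  by apply/funext => e; rewrite subrr absM0.
have Wx e (he : 0 <= e < eps1') : mW (n + r) (x e) by have [] := hx e he.
have vsx := state_vanish e1' Wx vx.
have vsY := state_vanish e1 WY vY.
(* Both functions solve L(e) z = 0, B(e) z = B(e) y; uniqueness identifies them, and their states
   are read at [a]. *)
have rep e : 0 <= e < eps1 -> 0 <= e < eps1' ->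
    st (Y e) a *m B e y = st y a - st (x e) a.
  move=> he he'; have Ia := I_a ab; have [WYe LYe BYe] := hY e he.
  rewrite -(st_sub ab p1 Wy (Wx e he') Ia) -(st_mul ab p1 _ WYe Ia).
  have [y0 _ u] := sol1 _ he' (fun=> 0) (B e y) (mW_cst ab p1 n 0).
  have [C _ h] := mW_mul_cst ab p1 (n + r); have [WYv _] := h _ _ _ (Y e) (B e y) WYe.
  apply: st_eq Ia => t It.
  rewrite (u (fun t => Y e t *m B e y) _ t It); last first.
    split => //; last by rewrite (blin_mul ab p1 (HB (lt10 _ he')))//; move: BYe;
      rewrite /boundary_mx => ->; rewrite mul1mx.
    apply: eqW_trans (Lop_mul ab p1 _ _ WYe) _.
    apply: (eqW_trans (eqW_comp (fun w => w *m B e y) LYe)).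
    by apply: eqW_pt => s _; rewrite mul0mx.
  rewrite (u (fun t => y t - x e t) _ t It)//.
  have sy : sol e (f e) (B e y) y by split => //; exact: eqW_pt.
  have [W1 e1'' e2''] := rsolves_sub ab p1 (HB (lt10 _ he')) sy (hx e he').
  split => //; last by rewrite e2'' subr0.
  by apply: eqW_trans e1'' _; apply: eqW_pt => s _; rewrite subrr.
pose K := absM (invmx (st (Y 0) a)); have K0 : 0 <= K by exact: absM_ge0.
pose hx' e := mN n.+1 (fun t => st (x e) t - st (x 0) t).
pose hY' e := mN n.+1 (fun t => st (Y e) t - st (Y 0) t).
apply: (@vanish_le _ _ (fun e => 2 * K * (hx' e + absM (B 0 y) * hY' e))); last first.
  by apply: vanishZ; apply: vanishD => //; exact: vanishZ.
near=> e; rewrite ger0_norm ?absM_ge0//.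
have he : 0 <= e < eps1 by near: e; exact: near_right_le.
have he' : 0 <= e < eps1' by near: e; exact: near_right_le.
have small : K * hY' e <= 2^-1.
  rewrite (le_trans (ler_norm _))// ltW//; near: e.
  by apply: (vanish_lt (vanishZ _ vsY)); rewrite invr_gt0.
set dq := B e y - B 0 y; set Q := absM dq.
have Q0 : 0 <= Q by exact: absM_ge0.
pose dU := st (Y e) a - st (Y 0) a.
have NU : absM dU <= hY' e := absM_a_le _ _ _ _ (fun t => st (Y e) t - st (Y 0) t).
have Nx : absM (st (x e) a - st (x 0) a) <= hx' e :=
  absM_a_le _ _ _ _ (fun t => st (x e) t - st (x 0) t).
(* The difference of [rep] at e and at 0, solved for the term with [st (Y 0) a]; the unknown [dq]
   recurs only with the small factor [dU]. *)
have E : st (Y 0) a *m dq =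
    - (st (x e) a - st (x 0) a) - dU *m B 0 y - dU *m dq.
  have := rep e he he'; have := rep 0 h0 h0'.
  rewrite /dU /dq !mulmxBl !mulmxBr => -> ->.
  move: (st y a) (st (x e) a) (st (x 0) a) (st (Y e) a *m B 0 y) (st (Y 0) a *m B e y).
  by move=> X1 X2 X3 X4 X5; apply/matrixP => i j; rewrite !mxE; ring.
have h1 : Q <= K * absM (st (Y 0) a *m dq).
  by rewrite /Q -{1}(mulKmx U0 dq); exact: absM_mul.
have h2 : absM (st (Y 0) a *m dq) <= hx' e + absM (B 0 y) * hY' e + hY' e * Q.
  rewrite E (le_trans (absM_add _ _))// absM_opp lerD//.
    rewrite (le_trans (absM_add _ _))// !absM_opp lerD//.
    by rewrite (le_trans (absM_mul _ _))// mulrC ler_wpM2l// absM_ge0.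
  by rewrite (le_trans (absM_mul _ _))// ler_wpM2r.
have h3 : Q <= K * (hx' e + absM (B 0 y) * hY' e) + 2^-1 * Q.
  rewrite (le_trans h1)// (le_trans (ler_wpM2l K0 h2))// mulrDr lerD2l mulrA.
  by rewrite ler_wpM2r.
by rewrite -mulrA; move: h3; lra.
Unshelve. all: by end_near. Qed.

End necessity.

(** * From complex to real functions *)

Section complex_scalar.
Variables (R : realType) (a b p : R).
Hypotheses (ab : a < b) (p1 : 1 <= p).
Local Notation mu := (@lebesgue_measure R).
Local Notation I := `[a, b]%classic.
Local Notation D := (deriv_on a b).
Local Notation Lp := (Lp a b p).
Local Notation Lnm := (Lnm a b p).
Local Notation W := (W a b p).
Local Notation NW := (NW a b p).
Local Notation L1c := (L1c a b).
Local Notation Rez x := (fun t => complex.Re (x t)).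
Local Notation Imz x := (fun t => complex.Im (x t)).
Implicit Types (x : R -> R[i]) (u : R -> R).

Lemma W_iter k u : W k u <->
  (forall j, (j <= k)%N -> Lp (iter j D u)) /\
  (forall j, (j < k)%N -> forall t, I t ->
    iter j D u t = iter j D u a + pint a (iter j.+1 D u) t).
Proof.
elim: k u => [|k IH] u.
  by split=> [Wu|[/(_ 0%N isT)]//]; split=> // -[].
split=> [Wu|[h1 h2]].
  have [f /IH[h1 h2]] := Wu; split=> [] [|j] jk.
  - exact: (W_le ab p1 (leq0n k.+1) Wu).
  - by rewrite iterSr; exact: h1.
  - exact: f.
  - by move=> t It; have := h2 j jk t It; rewrite -!iterSr.
split; first exact: (h2 0%N).
apply/IH; split=> j jk; first by have := h1 j.+1 jk; rewrite iterSr.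
by move=> t It; have := h2 j.+1 jk t It; rewrite -!iterSr.
Qed.

Lemma Lnm_iter_le k : exists2 C : R, 0 <= C & forall j u, (j <= k)%N -> W k u ->
  Lnm (iter j D u) <= C * NW k u.
Proof.
elim: k => [|k [C C0 IH]].
  by exists 1 => // -[]// u _ _; rewrite mul1r.
have [C' C'0 h] := W_embed ab p1 k.
exists (C * C' + C); first by rewrite addr_ge0// mulr_ge0.
move=> j u jk Wu; have [_ WDu] := Wu; have [Wk Nk] := h _ Wu.
have N0 : 0 <= NW k.+1 u by exact: NW_ge0.
case: j jk => [_|j jk].
  rewrite (le_trans (IH 0%N u (leq0n _) Wk))// mulrDl -mulrA.
  by rewrite (le_trans (ler_wpM2l C0 Nk))// lerDl mulr_ge0.
rewrite iterSr (le_trans (IH j _ jk WDu))// mulrDl.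
apply: (@le_trans _ _ (C * NW k.+1 u)); first by rewrite ler_wpM2l// lerDr.
by rewrite lerDr !mulr_ge0.
Qed.

Lemma Lnm1_gt0 : 0 < Lnm (fun=> 1).
Proof.
have E : \int[mu]_(t in I) 1 = b - a.
  by rewrite Rintegral_cst ?mul1r; [rewrite /= mu_itv|exact: measurable_itv].
have := int_abs_le_Lnm ab p1 (Lp_cst p ab 1); rewrite normr1 E.
move=> h; have : 0 < L1c * Lnm (fun=> 1) by rewrite (lt_le_trans _ h)// subr_gt0.
by rewrite pmulr_rgt0// L1c_gt0.
Qed.

(** The constant u(a) is u minus the primitive of u'; its L_p norm is |u(a)| times that of 1, which
    is positive. *)
Lemma abs_a_le : exists2 C : R, 0 <= C & forall u, W 1 u ->
  `|u a| <= C * (Lnm u + Lnm (D u)).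
Proof.
have l1 := Lnm1_gt0; have L0 := L1c_gt0 ab.
exists ((Lnm (fun=> 1))^-1 * (1 + L1c * Lnm (fun=> 1))).
  by rewrite mulr_ge0 ?invr_ge0 ?addr_ge0 ?mulr_ge0// ltW.
move=> u Wu; have [f LDu] := Wu; have Lu : Lp u := W_le ab p1 (leq0n 1) Wu.
have iD := W_integ ab p1 (k := 0) LDu.
have ip := pint_measurable ab iD.
have bnd t : I t -> `|pint a (D u) t| <= `|L1c * Lnm (D u)|.
  move=> It; rewrite (le_trans (pint_bounded ab iD It))// pintE.
  by rewrite (le_trans (int_abs_le_Lnm ab p1 LDu))// ler_norm.
have [Lpp Npp] : Lp (pint a (D u)) /\ Lnm (pint a (D u)) <= Lnm (fun=> L1c * Lnm (D u)).
  by apply: (Lp_le p1 ip (Lp_cst p ab _)); apply: (eqW_pt 0).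
have [Ls Ns] := W_sub ab p1 (k := 0) Lu Lpp.
have Nc c : Lnm (fun=> c) = `|c| * Lnm (fun=> 1).
  rewrite -(Lp_scale p1 c (Lp_cst p ab 1)).2.
  by congr Lnm; apply/funext => t; rewrite mulr1.
have [_ Ne] := W_pt ab p1 (k := 0) (y := fun=> u a)
  (fun t It => etrans (congr1 (fun z => z - _) (f t It)) (addrK _ _)) Ls.
rewrite /= Nc in Ne; rewrite -mulrA ler_pdivlMl// mulrC Ne (le_trans Ns)//=.
set L1 := Lnm (fun=> 1) in l1 *; set Lu' := Lnm u; set LD := Lnm (D u) in Npp *.
have LL : 0 <= L1c * LD by rewrite mulr_ge0 ?Lnm_ge0// ltW.
rewrite (le_trans (lerD (lexx _) Npp))// Nc -/L1 ger0_norm//.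
have u0 : 0 <= Lu' by exact: Lnm_ge0.
have D0 : 0 <= LD by exact: Lnm_ge0.
have h : 0 <= L1c * L1 * Lu' by rewrite !mulr_ge0// ltW.
by move: h D0; lra.
Qed.

Lemma NW_le_sum k : exists2 C : R, 0 <= C & forall u, W k u ->
  NW k u <= C * \sum_(j < k.+1) Lnm (iter j D u).
Proof.
have [C C0 hC] := abs_a_le; elim: k => [|k [C' C'0 IH]].
  by exists 1 => // u _; rewrite big_ord1 mul1r.
exists (C + C + C') => [|u Wu]; first by rewrite !addr_ge0.
have [_ WDu] := Wu; have S0 i (v : R -> R) : 0 <= \sum_(j < i) Lnm (iter j D v).
  by apply: sumr_ge0 => j _; exact: Lnm_ge0.
have h1 : NW k (D u) <= C' * \sum_(j < k.+2) Lnm (iter j D u).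
  rewrite (le_trans (IH _ WDu))// ler_wpM2l// [leRHS]big_ord_recl.
  rewrite (eq_bigr (fun j : 'I_k.+1 => Lnm (iter (lift ord0 j) D u))).
    by rewrite lerDr Lnm_ge0.
  by move=> j _; rewrite -iterSr.
have h2 := hC u (W_le ab p1 (ltn0Sn k) Wu).
have h3 : Lnm u + Lnm (D u) <= \sum_(j < k.+2) Lnm (iter j D u).
  by rewrite !big_ord_recl/= addrA lerDl; apply: sumr_ge0 => j _; exact: Lnm_ge0.
rewrite /= mulrDl lerD// (le_trans h2)//.
by rewrite (le_trans (ler_wpM2l C0 h3))// ler_wpM2r// lerDl.
Qed.

Lemma Re_cderivn j x : (fun t => complex.Re (cderivn a b j x t)) = iter j D (Rez x).
Proof.
by elim: j => [//|j IH]; rewrite [RHS]/= -IH.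
Qed.

Lemma Im_cderivn j x : (fun t => complex.Im (cderivn a b j x t)) = iter j D (Imz x).
Proof.
by elim: j => [//|j IH]; rewrite [RHS]/= -IH.
Qed.

Local Notation nrm x := (fun t => Normc.normc (x t)).

Lemma normc_ge0 (z : R[i]) : 0 <= Normc.normc z.
Proof. by case: z => u v /=; exact: sqrtr_ge0. Qed.

Lemma Re_le_normc (z : R[i]) : `|complex.Re z| <= Normc.normc z.
Proof.
case: z => u v /=; rewrite -(sqrtr_sqr u) ler_sqrt ?lerDl ?sqr_ge0//.
by rewrite addr_ge0 ?sqr_ge0.
Qed.

Lemma Im_le_normc (z : R[i]) : `|complex.Im z| <= Normc.normc z.
Proof.
case: z => u v /=; rewrite -(sqrtr_sqr v) ler_sqrt ?lerDr ?sqr_ge0//.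
by rewrite addr_ge0 ?sqr_ge0.
Qed.

Lemma normc_le (z : R[i]) : Normc.normc z <= `|complex.Re z| + `|complex.Im z|.
Proof.
case: z => u v /=; rewrite -[leRHS]ger0_norm ?addr_ge0// -sqrtr_sqr.
rewrite ler_sqrt ?sqr_ge0// sqrrD !real_normK ?num_real// addrAC lerDl.
by rewrite mulrn_wge0// mulr_ge0.
Qed.

Lemma measurable_nrm x : measurable_fun I (Rez x) -> measurable_fun I (Imz x) ->
  measurable_fun I (nrm x).
Proof.
move=> mr mi.
rewrite (_ : (fun t => _) = (fun t => Num.sqrt (Rez x t ^+ 2 + Imz x t ^+ 2))).
  have ms : measurable_fun setT (@Num.sqrt R).
    by apply: continuous_measurable_fun; exact: sqrt_continuous.
  apply: (measurableT_comp ms).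
  by apply: measurable_funD; apply: measurable_funX.
by apply/funext => t; case: (x t).
Qed.

Lemma Lnm_Re x : measurable_fun I (Rez x) -> Lp (nrm x) ->
  Lp (Rez x) /\ Lnm (Rez x) <= Lnm (nrm x).
Proof.
move=> mr Ln; apply: (Lp_le p1 mr Ln); apply: (eqW_pt 0) => t _.
by rewrite [leRHS]ger0_norm ?normc_ge0// Re_le_normc.
Qed.

Lemma Lnm_Im x : measurable_fun I (Imz x) -> Lp (nrm x) ->
  Lp (Imz x) /\ Lnm (Imz x) <= Lnm (nrm x).
Proof.
move=> mr Ln; apply: (Lp_le p1 mr Ln); apply: (eqW_pt 0) => t _.
by rewrite [leRHS]ger0_norm ?normc_ge0// Im_le_normc.
Qed.

Lemma Lnm_nrm x : Lp (Rez x) -> Lp (Imz x) ->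
  Lp (nrm x) /\ Lnm (nrm x) <= Lnm (Rez x) + Lnm (Imz x).
Proof.
have habs u : Lp u -> Lp (fun t => `|u t|) /\ Lnm (fun t => `|u t|) <= Lnm u.
  move=> Lu; apply: (Lp_le p1 _ Lu).
    apply: measurableT_comp (Lp_measurable Lu); exact: normr_measurable.
  by apply: (eqW_pt 0) => t _; rewrite normr_id lexx.
move=> Lr Li; have [Lr' Nr] := habs _ Lr; have [Li' Ni] := habs _ Li.
have [Ls Ns] := Lp_add p1 Lr' Li'.
have [||Ln Nn] := Lp_le p1 (v := nrm x) _ Ls.
- exact: measurable_nrm (Lp_measurable Lr) (Lp_measurable Li).
- apply: (eqW_pt 0) => t _; rewrite ger0_norm ?normc_ge0//.
  by rewrite ger0_norm ?addr_ge0// normc_le.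
by split=> //; rewrite (le_trans Nn)// (le_trans Ns)// lerD.
Qed.

Lemma in_LpE x : in_Lp a b p x <-> Lp (Rez x) /\ Lp (Imz x).
Proof.
have E : (\int[mu]_(t in I) (Normc.normc (x t) `^ p)%:E)%E = Lpow a b p (nrm x).
  by rewrite LpowE; apply: eq_integral => t _; rewrite ger0_norm// normc_ge0.
rewrite /in_Lp E; split=> [[mr mi fx]|[Lr Li]].
  have Ln : Lp (nrm x) by split => //; exact: measurable_nrm.
  by split; [exact: (Lnm_Re mr Ln).1|exact: (Lnm_Im mi Ln).1].
split; [exact: Lp_measurable Lr|exact: Lp_measurable Li|].
exact: Lp_lty (Lnm_nrm Lr Li).1.
Qed.

Lemma Re_cderivn_pt j x t : complex.Re (cderivn a b j x t) = iter j D (Rez x) t.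
Proof. by rewrite -Re_cderivn. Qed.

Lemma Im_cderivn_pt j x t : complex.Im (cderivn a b j x t) = iter j D (Imz x) t.
Proof. by rewrite -Im_cderivn. Qed.

Lemma Re_cintegral x t : complex.Re (cintegral a t x) = pint a (Rez x) t.
Proof. by rewrite pintE. Qed.

Lemma Im_cintegral x t : complex.Im (cintegral a t x) = pint a (Imz x) t.
Proof. by rewrite pintE. Qed.

Lemma in_WE k x : in_W a b k p x <-> W k (Rez x) /\ W k (Imz x).
Proof.
have E j t : (cderivn a b j x t = cderivn a b j x a + cintegral a t (cderivn a b j.+1 x)) <->
    iter j D (Rez x) t = iter j D (Rez x) a + pint a (iter j.+1 D (Rez x)) t /\
    iter j D (Imz x) t = iter j D (Imz x) a + pint a (iter j.+1 D (Imz x)) t.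
  rewrite -!Re_cderivn_pt -!Im_cderivn_pt -Re_cderivn -Im_cderivn.
  rewrite -Re_cintegral -Im_cintegral -!raddfD; split=> [->//|[e1 e2]].
  by apply/eqP; rewrite eq_complex e1 e2 !eqxx.
rewrite !W_iter; split=> [[h1 h2]|[[hr1 hr2] [hi1 hi2]]].
  split; split=> j jk.
  - by have [] := (in_LpE _).1 (h1 j jk); rewrite Re_cderivn.
  - by move=> t /ItvP It; have [] := (E j t).1 (h2 j jk t It).
  - by have [] := (in_LpE _).1 (h1 j jk); rewrite Im_cderivn.
  - by move=> t /ItvP It; have [] := (E j t).1 (h2 j jk t It).
split=> j jk.
  by apply/in_LpE; rewrite Re_cderivn Im_cderivn; split; [exact: hr1|exact: hi1].
by move=> t /ItvP It; apply/E; split; [exact: hr2|exact: hi2].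
Qed.

Local Notation cj j x := (Lnm (nrm (cderivn a b j x))).

Lemma normWE k x : in_W a b k p x ->
  normW a b k p x = (\sum_(j < k.+1) cj j x `^ p) `^ p^-1.
Proof.
move=> [h _]; rewrite /normW big_mkord; congr (_ `^ _); apply: eq_bigr => j _.
have [Lr Li] := (in_LpE _).1 (h j (ltn_ord j)).
rewrite -[RHS]/(fine _%:E) (Lnm_powR p1 (Lnm_nrm Lr Li).1) LpowE /Rintegral.
by congr fine; apply: eq_integral => t _; rewrite (ger0_norm (normc_ge0 _)).
Qed.

Lemma cj_Re k j x : in_W a b k p x -> (j <= k)%N ->
  Lnm (iter j D (Rez x)) <= cj j x.
Proof.
move=> [h _] jk; have [Lr Li] := (in_LpE _).1 (h j jk).
by rewrite -Re_cderivn (Lnm_Re (Lp_measurable Lr) (Lnm_nrm Lr Li).1).2.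
Qed.

Lemma cj_Im k j x : in_W a b k p x -> (j <= k)%N ->
  Lnm (iter j D (Imz x)) <= cj j x.
Proof.
move=> [h _] jk; have [Lr Li] := (in_LpE _).1 (h j jk).
by rewrite -Im_cderivn (Lnm_Im (Lp_measurable Li) (Lnm_nrm Lr Li).1).2.
Qed.

Lemma cj_le k j x : in_W a b k p x -> (j <= k)%N ->
  cj j x <= Lnm (iter j D (Rez x)) + Lnm (iter j D (Imz x)).
Proof.
move=> [h _] jk; have [Lr Li] := (in_LpE _).1 (h j jk).
by rewrite -Im_cderivn -Re_cderivn (Lnm_nrm Lr Li).2.
Qed.

Lemma cj_normW k j x : in_W a b k p x -> (j <= k)%N -> cj j x <= normW a b k p x.
Proof.
move=> Wx jk; rewrite normWE//.
have pV0 : 0 <= p^-1 by rewrite invr_ge0 (le_trans ler01).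
have p0 : p != 0 by rewrite gt_eqF// (lt_le_trans ltr01).
rewrite -[leLHS]powRr1 ?Lnm_ge0// -(mulfV p0) powRrM ge0_ler_powR ?nnegrE ?powR_ge0//.
  by apply: sumr_ge0 => i _; exact: powR_ge0.
rewrite (bigD1 (Ordinal (jk : (j < k.+1)%N)))//= lerDl.
by apply: sumr_ge0 => i _; exact: powR_ge0.
Qed.

Lemma normW_cj k x : in_W a b k p x ->
  normW a b k p x <= k.+1%:R `^ p^-1 * \sum_(j < k.+1) cj j x.
Proof.
move=> Wx; rewrite normWE//; set S := \sum_(j < k.+1) cj j x.
have pV0 : 0 <= p^-1 by rewrite invr_ge0 (le_trans ler01).
have p0 : p != 0 by rewrite gt_eqF// (lt_le_trans ltr01).
have S0 : 0 <= S by apply: sumr_ge0 => i _; exact: Lnm_ge0.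
rewrite -[X in _ * X]powRr1// -[X in S `^ X](mulfV p0) powRrM -powRM ?powR_ge0//.
rewrite ge0_ler_powR ?nnegrE ?mulr_ge0 ?powR_ge0//.
  by apply: sumr_ge0 => i _; exact: powR_ge0.
rewrite -[k.+1 in leRHS]card_ord mulrC mulr_natr -sumr_const; apply: ler_sum => j _.
rewrite ge0_ler_powR ?nnegrE ?Lnm_ge0//; first by rewrite (le_trans ler01).
rewrite /S (bigD1 j)//= lerDl.
by apply: sumr_ge0 => i _; exact: Lnm_ge0.
Qed.

Lemma normW_ge0 k x : 0 <= normW a b k p x. Proof. exact: powR_ge0. Qed.

(** Three comparisons are combined: the p-th root of a sum of p-th powers with a plain sum over the
    orders, the modulus with real and imaginary parts, and the norms of all derivatives with
    [NW]. *)
Lemma normW_equiv k : exists2 C : R, 0 <= C & forall x, in_W a b k p x ->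
  normW a b k p x <= C * (NW k (Rez x) + NW k (Imz x)) /\
  NW k (Rez x) + NW k (Imz x) <= C * normW a b k p x.
Proof.
have [C1 C10 h1] := Lnm_iter_le k; have [C2 C20 h2] := NW_le_sum k.
pose K := (k.+1%:R `^ p^-1 : R) * (k.+1%:R * C1); pose K' := C2 * k.+1%:R *+ 2.
have K0 : 0 <= K by rewrite mulr_ge0 ?powR_ge0// mulr_ge0.
have K'0 : 0 <= K' by rewrite mulrn_wge0// mulr_ge0.
exists (K + K') => [|x Wx]; first by rewrite addr_ge0.
have [Wr Wi] := (in_WE k x).1 Wx.
set S := NW k (Rez x) + NW k (Imz x); have S0 : 0 <= S by rewrite addr_ge0 ?NW_ge0.
have N0 := normW_ge0 k x; split.
  apply: (@le_trans _ _ (K * S)); last by rewrite mulrDl lerDl mulr_ge0.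
  rewrite (le_trans (normW_cj Wx))// /K -mulrA ler_wpM2l ?powR_ge0//.
  rewrite -mulrA -[k.+1 in leRHS]card_ord mulr_natl -sumr_const; apply: ler_sum => j _.
  rewrite (le_trans (cj_le Wx (ltn_ord j)))// mulrDr lerD//; apply: h1 => //; exact: ltn_ord j.
apply: (@le_trans _ _ (K' * normW a b k p x)); last by rewrite [leRHS]mulrDl lerDr mulr_ge0.
have hS u : (forall j, (j <= k)%N -> Lnm (iter j D u) <= cj j x) -> W k u ->
    NW k u <= C2 * k.+1%:R * normW a b k p x.
  move=> hu Wu; rewrite (le_trans (h2 _ Wu))// -mulrA ler_wpM2l//.
  rewrite -[k.+1 in leRHS]card_ord mulr_natl -sumr_const; apply: ler_sum => j _.
  by rewrite (le_trans (hu j (ltn_ord j)))// cj_normW//; exact: ltn_ord j.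
rewrite /K' mulr2n mulrDl lerD//; apply: hS => // j jk;
  [exact: cj_Re Wx jk|exact: cj_Im Wx jk].
Qed.

End complex_scalar.

(** * Complex vectors and matrices in real coordinates *)

Section realification.
Variables (R : realType) (a b p : R).
Hypotheses (ab : a < b) (p1 : 1 <= p).
Local Notation I := `[a, b]%classic.
Local Notation D := (deriv_on a b).
Local Notation W := (W a b p).
Local Notation NW := (NW a b p).
Local Notation mW := (mW a b p).
Local Notation mN := (mN a b p).
Local Notation eqW := (eqW a b).
Local Notation mDn := (mDn a b).

Definition vec m (v : 'cV[R[i]]_m) : 'cV[R]_(m + m) :=
  col_mx (map_mx (@complex.Re R) v) (map_mx (@complex.Im R) v).

Definition cvec m (z : 'cV[R]_(m + m)) : 'cV[R[i]]_m :=
  \col_i (usubmx z i 0 +i* dsubmx z i 0)%C.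

(** The real matrix of multiplication by X in the coordinates given by [vec]. *)
Definition blk m (X : 'M[R[i]]_m) : 'M[R]_(m + m) :=
  block_mx (map_mx (@complex.Re R) X) (- map_mx (@complex.Im R) X)
           (map_mx (@complex.Im R) X) (map_mx (@complex.Re R) X).

Lemma vecK m : cancel (@vec m) (@cvec m).
Proof.
move=> v; apply/matrixP => i j; rewrite [LHS]mxE /vec col_mxKu col_mxKd !mxE ord1.
by case: (v i 0).
Qed.

Lemma cvecK m : cancel (@cvec m) (@vec m).
Proof.
move=> z; rewrite -[RHS]vsubmxK; congr col_mx; apply/matrixP => i j;
  by rewrite !mxE !ord1.
Qed.

Lemma vec_lin m (c : R) (v w : 'cV[R[i]]_m) :
  vec (c%:C%C *: v + w) = c *: vec v + vec w.
Proof.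
rewrite /vec scale_col_mx add_col_mx; congr col_mx; apply/matrixP => i j;
  by rewrite !mxE; case: (v i j) => x y; case: (w i j) => x' y' /=; ring.
Qed.

Lemma cvec_lin m (c : R) (v w : 'cV[R]_(m + m)) :
  cvec (c *: v + w) = c%:C%C *: cvec v + cvec w.
Proof. by apply: (can_inj (@vecK m)); rewrite vec_lin !cvecK. Qed.

Lemma vec_sub m (v w : 'cV[R[i]]_m) : vec (v - w) = vec v - vec w.
Proof.
by rewrite /vec opp_col_mx add_col_mx; congr col_mx; apply/matrixP => i j; rewrite !mxE raddfB.
Qed.

Lemma vec_add m (v w : 'cV[R[i]]_m) : vec (v + w) = vec v + vec w.
Proof.
by rewrite /vec add_col_mx; congr col_mx; apply/matrixP => i j; rewrite !mxE raddfD.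
Qed.

Lemma vec0 m : vec (0 : 'cV[R[i]]_m) = 0.
Proof. by rewrite -[X in vec X](subrr 0) vec_sub subrr. Qed.

Lemma vec_sum m (J : Type) (s : seq J) (F : J -> 'cV[R[i]]_m) :
  vec (\sum_(j <- s) F j) = \sum_(j <- s) vec (F j).
Proof. by elim: s => [|j s IH]; rewrite ?big_nil ?vec0// !big_cons vec_add IH. Qed.

Lemma vec_mul m (X : 'M[R[i]]_m) (v : 'cV[R[i]]_m) : vec (X *m v) = blk X *m vec v.
Proof.
rewrite /vec /blk mul_block_col; congr col_mx; apply/matrixP => i j.
  rewrite mxE [X in complex.Re X]mxE raddf_sum !mxE -big_split/=.
  apply: eq_bigr => k _; rewrite !mxE.
  by case: (X i k) => x y; case: (v k j) => x' y' /=; ring.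
rewrite mxE [X in complex.Im X]mxE raddf_sum !mxE -big_split/=.
apply: eq_bigr => k _; rewrite !mxE.
by case: (X i k) => x y; case: (v k j) => x' y' /=; ring.
Qed.

Lemma vecEl m (v : 'cV[R[i]]_m) i : vec v (lshift m i) 0 = complex.Re (v i 0).
Proof. by rewrite col_mxEu mxE. Qed.

Lemma vecEr m (v : 'cV[R[i]]_m) i : vec v (rshift m i) 0 = complex.Im (v i 0).
Proof. by rewrite col_mxEd mxE. Qed.

Lemma mW_vec k m (y : R -> 'cV[R[i]]_m) :
  mW k (fun t => vec (y t)) <-> in_mxW a b k p y.
Proof.
split=> [Wy i j|Wy i j].
  apply/(in_WE ab p1); rewrite (ord1 j); split.
    have := Wy (lshift m i) 0; congr W.
    by apply/funext => t; rewrite vecEl.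
  have := Wy (rshift m i) 0; congr W.
  by apply/funext => t; rewrite vecEr.
rewrite (ord1 j); have [i' ->|i' ->] := split_ordP i;
  have [Wr Wi] := (in_WE ab p1 _ _).1 (Wy i' 0).
  by move: Wr; congr W; apply/funext => t; rewrite vecEl.
by move: Wi; congr W; apply/funext => t; rewrite vecEr.
Qed.

Lemma mN_vec k m (y : R -> 'cV[R[i]]_m) : mN k (fun t => vec (y t)) =
  \sum_i (NW k (fun t => complex.Re (y t i 0)) + NW k (fun t => complex.Im (y t i 0))).
Proof.
rewrite /mN big_split_ord big_split/=; congr (_ + _); apply: eq_bigr => i _;
  rewrite big_ord1; congr NW; apply/funext => t; [exact: vecEl|exact: vecEr].
Qed.

Lemma mxnormW_vec k : exists2 C : R, 0 <= C & forall m (y : R -> 'cV[R[i]]_m),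
  in_mxW a b k p y -> mxnormW a b k p y <= C * mN k (fun t => vec (y t)) /\
  mN k (fun t => vec (y t)) <= C * mxnormW a b k p y.
Proof.
have [C C0 h] := normW_equiv ab p1 k; exists C => // m y Wy.
rewrite mN_vec /mxnormW !mulr_sumr; split; apply: ler_sum => i _;
  rewrite big_ord1; by have [] := h _ (Wy i 0).
Qed.

Lemma mW_blk k m (X : R -> 'M[R[i]]_m) : in_mxW a b k p X ->
  mW k (fun t => blk (X t)).
Proof.
move=> WX i j; have [i' ->|i' ->] := split_ordP i; have [j' ->|j' ->] := split_ordP j;
  have [Wr Wi] := (in_WE ab p1 _ _).1 (WX i' j').
- by move: Wr; congr W; apply/funext => t; rewrite block_mxEul mxE.
- rewrite (_ : (fun t => _) = (fun t => -1 * complex.Im (X t i' j'))).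
    exact: (W_scale ab p1 _ Wi).1.
  by apply/funext => t; rewrite block_mxEur !mxE mulN1r.
- by move: Wi; congr W; apply/funext => t; rewrite block_mxEdl mxE.
- by move: Wr; congr W; apply/funext => t; rewrite block_mxEdr mxE.
Qed.

(** The constant is doubled because the real and imaginary part of each entry occur twice in
    [blk]. *)
Lemma mxnormW_blk k : exists2 C : R, 0 <= C & forall m (X : R -> 'M[R[i]]_m),
  in_mxW a b k p X -> mxnormW a b k p X <= C * mN k (fun t => blk (X t)) /\
  mN k (fun t => blk (X t)) <= C * mxnormW a b k p X.
Proof.
have [C C0 h] := normW_equiv ab p1 k; exists (C + C); first by rewrite addr_ge0.
move=> m X WX.
pose r i j := NW k (fun t => complex.Re (X t i j)).
pose s i j := NW k (fun t => complex.Im (X t i j)).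
pose s' i j := NW k (fun t => - complex.Im (X t i j)).
have r0 i j : 0 <= r i j by exact: NW_ge0.
have s0 i j : 0 <= s i j by exact: NW_ge0.
have s'0 i j : 0 <= s' i j by exact: NW_ge0.
have s's i j : s' i j <= s i j.
  have [_ Wi] := (in_WE ab p1 _ _).1 (WX i j).
  have := (W_scale ab p1 (-1) Wi).2; rewrite normrN normr1 mul1r; apply: le_trans.
  rewrite /s' le_eqVlt; apply/orP; left; apply/eqP; congr NW.
  by apply/funext => t; rewrite mulN1r.
have E : mN k (fun t => blk (X t)) =
    \sum_i \sum_j ((r i j + s' i j) + (s i j + r i j)).
  rewrite /mN big_split_ord/= -big_split/=; apply: eq_bigr => i _.
  rewrite !big_split_ord/= -!big_split/=; apply: eq_bigr => j _.
  congr (_ + _ + (_ + _)); congr NW; apply/funext => t.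
  - by rewrite block_mxEul mxE.
  - by rewrite block_mxEur !mxE.
  - by rewrite block_mxEdl mxE.
  - by rewrite block_mxEdr mxE.
rewrite E /mxnormW !mulr_sumr; split; apply: ler_sum => i _; rewrite !mulr_sumr;
  apply: ler_sum => j _; have [h1 h2] := h _ (WX i j).
  rewrite (le_trans h1)// mulrDl -[leLHS]addr0 lerD ?mulr_ge0 ?addr_ge0//.
  apply: ler_wpM2l => //; rewrite -/(r i j) -/(s i j).
  by move: (r0 i j) (s'0 i j); lra.
rewrite mulrDl; apply: lerD; last by rewrite addrC.
by rewrite (le_trans _ h2)// lerD2l.
Qed.

End realification.

(** * The complex boundary-value problem in real form *)

Section complex_problem.
Variables (R : realType) (a b p : R).
Hypotheses (ab : a < b) (p1 : 1 <= p).
Local Notation I := `[a, b]%classic.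
Local Notation D := (deriv_on a b).
Local Notation mW := (mW a b p).
Local Notation mN := (mN a b p).
Local Notation eqW := (eqW a b).
Local Notation mDn := (mDn a b).
Local Notation blin := (blin a b p).

Lemma vanish_equiv (g h : R -> R) (C e1 : R) : 0 < e1 ->
  (forall e, 0 <= e < e1 -> [/\ 0 <= g e, 0 <= h e, g e <= C * h e & h e <= C * g e]) ->
  vanish g <-> vanish h.
Proof.
move=> e10 gh; have E : \forall e \near (0 : R)^'+, 0 <= e < e1.
  exact: near_right_le.
split=> v; apply: vanish_le (vanishZ C v); near=> e;
  have /gh[g0 h0 gh' hg'] : 0 <= e < e1 by [near: e; exact: E].
all: by rewrite ger0_norm.
Unshelve. all: by end_near. Qed.

Lemma in_mxW_sub k m (X Y : R -> 'cV[R[i]]_m) :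
  in_mxW a b k p X -> in_mxW a b k p Y -> in_mxW a b k p (fun t => X t - Y t).
Proof.
move=> /(mW_vec ab p1) WX /(mW_vec ab p1) WY; apply/(mW_vec ab p1).
rewrite (_ : (fun t => _) = (fun t => vec (X t) - vec (Y t))).
  exact: (mW_sub ab p1 WX WY).1.
by apply/funext => t; rewrite vec_sub.
Qed.

Lemma mxnormW_ge0 k m l (X : R -> 'M[R[i]]_(m, l)) : 0 <= mxnormW a b k p X.
Proof. by apply: sumr_ge0 => i _; apply: sumr_ge0 => j _; exact: normW_ge0. Qed.

Lemma cvgW_vec k m (X : R -> R -> 'cV[R[i]]_m) e1 : 0 < e1 ->
  (forall e, 0 <= e < e1 -> in_mxW a b k p (X e)) ->
  cvgW a b k p X <-> vanish (fun e => mN k (fun t => vec (X e t) - vec (X 0 t))).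
Proof.
move=> e10 WX; have [C C0 h] := mxnormW_vec ab p1 k.
apply: (@vanish_equiv _ _ C e1 e10) => e he.
have h0 : 0 <= (0 : R) < e1 by rewrite lexx.
have [n1 n2] := h _ _ (in_mxW_sub (WX e he) (WX 0 h0)).
rewrite (_ : (fun t => vec (X e t) - vec (X 0 t)) = (fun t => vec (X e t - X 0 t))).
  by split => //; [exact: mxnormW_ge0|exact: mN_ge0].
by apply/funext => t; rewrite vec_sub.
Qed.

Lemma in_mxW_sub_sq k m (X Y : R -> 'M[R[i]]_m) :
  in_mxW a b k p X -> in_mxW a b k p Y -> in_mxW a b k p (fun t => X t - Y t).
Proof.
move=> WX WY i j; apply/(in_WE ab p1).
have [Xr Xi] := (in_WE ab p1 _ _).1 (WX i j).
have [Yr Yi] := (in_WE ab p1 _ _).1 (WY i j).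
split; [have := (W_sub ab p1 Xr Yr).1|have := (W_sub ab p1 Xi Yi).1];
  congr W; apply/funext => t; by rewrite !mxE raddfB.
Qed.

Lemma blk_sub m (X Y : 'M[R[i]]_m) : blk (X - Y) = blk X - blk Y.
Proof.
rewrite /blk opp_block_mx add_block_mx; congr block_mx;
  apply/matrixP => i j; rewrite !mxE ?opprK raddfB ?opprB//.
by rewrite addrC.
Qed.

Lemma cvgW_blk k m (X : R -> R -> 'M[R[i]]_m) e1 : 0 < e1 ->
  (forall e, 0 <= e < e1 -> in_mxW a b k p (X e)) ->
  cvgW a b k p X <-> vanish (fun e => mN k (fun t => blk (X e t) - blk (X 0 t))).
Proof.
move=> e10 WX; have [C C0 h] := mxnormW_blk ab p1 k.
apply: (@vanish_equiv _ _ C e1 e10) => e he.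
have h0 : 0 <= (0 : R) < e1 by rewrite lexx.
have [n1 n2] := h _ _ (in_mxW_sub_sq (WX e he) (WX 0 h0)).
rewrite (_ : (fun t => blk (X e t) - blk (X 0 t)) = (fun t => blk (X e t - X 0 t))).
  by split => //; [exact: mxnormW_ge0|exact: mN_ge0].
by apply/funext => t; rewrite blk_sub.
Qed.

Section conditions.
Variables r m : nat.

(** Real coordinates of boundary data number r m + r m, while the real problem of size m + m expects
    r (m + m); the cast identifies the two dimensions. *)
Definition vecq (c : 'cV[R[i]]_(r * m)) : 'cV[R]_(r * (m + m)) :=
  castmx (esym (mulnDr r m m), erefl 1%N) (vec c).

Definition cvecq (z : 'cV[R]_(r * (m + m))) : 'cV[R[i]]_(r * m) :=
  cvec (castmx (mulnDr r m m, erefl 1%N) z).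

Lemma vecqK : cancel vecq cvecq.
Proof. by move=> c; rewrite /cvecq castmxKV vecK. Qed.

Lemma cvecqK : cancel cvecq vecq.
Proof. by move=> c; rewrite /vecq cvecK; exact: (castmxK (mulnDr r m m) (erefl 1%N)). Qed.

Lemma castmx_lin k l (e : k = l) (c : R) (v w : 'cV[R]_k) :
  castmx (e, erefl 1%N) (c *: v + w) =
  c *: castmx (e, erefl 1%N) v + castmx (e, erefl 1%N) w.
Proof. by subst l; rewrite !castmx_id. Qed.

Lemma absM_castmx k l (e : k = l) (v : 'cV[R]_k) :
  absM (castmx (e, erefl 1%N) v) = absM v.
Proof. by subst l; rewrite castmx_id. Qed.

Lemma vecq_lin c v w : vecq (c%:C%C *: v + w) = c *: vecq v + vecq w.
Proof. by rewrite /vecq vec_lin castmx_lin. Qed.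

Lemma vecq_sub v w : vecq (v - w) = vecq v - vecq w.
Proof.
have := vecq_lin (-1) w v.
by rewrite rmorphN1 !scaleN1r [- w + v]addrC [- vecq w + vecq v]addrC.
Qed.

Lemma vecq0 : vecq 0 = 0.
Proof. by rewrite -[X in vecq X](subrr 0) vecq_sub subrr. Qed.

Lemma absM_vecq c : absM (vecq c) =
  \sum_i (`|complex.Re (c i 0)| + `|complex.Im (c i 0)|).
Proof.
rewrite absM_castmx /absM big_split_ord big_split/=; congr (_ + _);
  apply: eq_bigr => i _; by rewrite big_ord1 ?vecEl ?vecEr.
Qed.

Lemma cvnorm_vecq c : cvnorm c <= 2 * absM (vecq c) /\ absM (vecq c) <= 2 * cvnorm c.
Proof.
rewrite absM_vecq /cvnorm !mulr_sumr; split; apply: ler_sum => i _.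
  rewrite (le_trans (normc_le _))// ler_peMl ?addr_ge0// ler1n//.
by rewrite mulr_natl mulr2n lerD ?Re_le_normc ?Im_le_normc.
Qed.

Lemma cvnorm_ge0 q (c : 'cV[R[i]]_q) : 0 <= cvnorm c.
Proof. by apply: sumr_ge0 => i _; exact: normc_ge0. Qed.

Lemma cvgC_vecq (c : R -> 'cV[R[i]]_(r * m)) :
  cvgC c <-> vanish (fun e => absM (vecq (c e) - vecq (c 0))).
Proof.
apply: (@vanish_equiv _ _ 2 1 ltr01) => e _; rewrite -vecq_sub.
have [h1 h2] := cvnorm_vecq (c e - c 0).
by split => //; [exact: cvnorm_ge0|exact: absM_ge0].
Qed.

End conditions.

Lemma mDn_entry j m l (X : R -> 'M[R]_(m, l)) t i k :
  mDn j X t i k = iter j D (fun s => X s i k) t.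
Proof.
elim: j t => [//|j IH] t; rewrite /= mxE; congr deriv_on.
by apply/funext => s; exact: IH.
Qed.

Lemma mDn_vec j m (y : R -> 'cV[R[i]]_m) t :
  mDn j (fun s => vec (y s)) t = vec (mxderivn a b j y t).
Proof.
apply/matrixP => i k; rewrite mDn_entry (ord1 k).
have [i' ->|i' ->] := split_ordP i; rewrite ?vecEl ?vecEr mxE.
  rewrite Re_cderivn_pt; congr (iter j D _ t); apply/funext => s; exact: vecEl.
rewrite Im_cderivn_pt; congr (iter j D _ t); apply/funext => s; exact: vecEr.
Qed.

Section problem.
Variables (r' m n : nat).
Local Notation r := r'.+1.
Local Notation rsolves := (@rsolves _ a b p r' (m + m) n).
Implicit Types (A : nat -> R -> 'M[R[i]]_m) (B : (R -> 'cV[R[i]]_m) -> 'cV[R[i]]_(r * m)).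

Definition rB B (z : R -> 'cV[R]_(m + m)) : 'cV[R]_(r * (m + m)) :=
  vecq (B (fun t => cvec (z t))).

Lemma Lop_vec A (y : R -> 'cV[R[i]]_m) t :
  @Lop _ a b r' (m + m) _ (fun i s => blk (A i s)) (fun s => vec (y s)) t =
  vec (diff_op a b r A y t).
Proof.
rewrite /Lop /diff_op vec_add mDn_vec vec_sum; congr (_ + _).
(* The sum over the coefficients of index r - j, j = 1, ..., r, is reversed into one over the
   indices i < r. *)
rewrite big_add1 big_mkord (reindex_inj rev_ord_inj); apply: eq_bigr => i _ /=.
rewrite vec_mul mDn_vec; congr (blk (A _ _) *m vec (mxderivn _ _ _ _ _));
  by rewrite subSS.
Qed.

Lemma eqn_onE (g h : R -> 'cV[R[i]]_m) :
  eqn_on a b n g h <-> eqW n (fun t => vec (g t)) (fun t => vec (h t)).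
Proof.
have E : eqn_on a b n g h <-> eqW n g h.
  case: n => [|k] /=; split.
  - by apply: leb_aeS => t gh /ItvP; exact: gh.
  - by apply: leb_aeS => t gh It; apply: gh; exact/ItvP.
  - by move=> gh t /ItvP; exact: gh.
  - by move=> gh t It; apply: gh; exact/ItvP.
apply: (iff_trans E); split=> [|e]; first exact: eqW_comp.
have := eqW_comp (@cvec R m) e.
by rewrite (funext (fun t => vecK (g t))) (funext (fun t => vecK (h t))).
Qed.

Lemma rB_vec B y : rB B (fun t => vec (y t)) = vecq (B y).
Proof. by rewrite /rB (funext (fun t => vecK (y t))). Qed.

Lemma solvesE A B f c y : solves a b n p A B f c y <->
  rsolves (fun i t => blk (A i t)) (rB B) (fun t => vec (f t)) (vecq c) (fun t => vec (y t)).
Proof.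
have L := funext (Lop_vec A y); split=> -[h1 h2 h3]; split.
- exact/(mW_vec ab p1).
- by rewrite L; exact/eqn_onE.
- by rewrite rB_vec h3.
- exact/(mW_vec ab p1).
- by move: h2; rewrite L => /eqn_onE.
- by move: h3; rewrite rB_vec => /(can_inj (@vecqK _ _)).
Qed.

(** Continuity at 0 with tolerance 1 bounds the image on a small ball, and homogeneity extends the
    bound. Complex linearity is used for real scalars, the ones that [vec] respects. *)
Lemma blin_rB B : continuous_linear_on_W a b (n + r) p B -> blin (n + r) (rB B).
Proof.
move=> [lin cont].
have cW (z : R -> 'cV[R]_(m + m)) : mW (n + r) z -> in_mxW a b (n + r) p (fun t => cvec (z t)).
  by move=> Wz; apply/(mW_vec ab p1); rewrite (funext (fun t => cvecK (z t))).
have rlin (c : R) y z : mW (n + r) y -> mW (n + r) z ->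
    rB B (fun t => c *: y t + z t) = c *: rB B y + rB B z.
  move=> Wy Wz; rewrite /rB -vecq_lin -lin; [|exact: cW..].
  by congr (vecq (B _)); apply/funext => t; rewrite cvec_lin.
split => //.
have W0 : mW (n + r) (fun=> 0 : 'cV[R]_(m + m)) by exact: mW_cst.
have B0 : rB B (fun=> 0) = 0.
  have := rlin (-1) _ _ W0 W0.
  rewrite (_ : -1 *: rB B _ + rB B _ = 0); last by rewrite scaleN1r addNr.
  by move=> E; rewrite -[RHS]E; congr rB; apply/funext => t; rewrite scaler0 addr0.
have [d d0 hd] := cont _ (cW _ W0) 1 ltr01.
have [C C0 hC] := mxnormW_vec ab p1 (n + r).
pose dl := d / (C + 1).
have C1 : 0 < C + 1 by rewrite ltr_wpDl.
have dl0 : 0 < dl by rewrite divr_gt0.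
have small z : mW (n + r) z -> mN (n + r) z < dl -> absM (rB B z) <= 2.
  move=> Wz Nz; have Wc := cW _ Wz.
  have B0' : B (fun=> cvec (0 : 'cV[R]_(m + m))) = 0.
    by apply: (can_inj (@vecqK r m)); rewrite vecq0 -B0.
  have := hd _ Wc; rewrite B0' subr0 => hz.
  rewrite (le_trans (cvnorm_vecq _).2)// -[leRHS]mulr1 ler_wpM2l// ltW// hz//.
  rewrite (_ : (fun t => _ - _) = (fun t => cvec (z t))); last first.
    apply/funext => t; rewrite -[RHS]subr0; congr (_ - _).
    by apply: (can_inj (@vecK R m)); rewrite cvecK vec0.
  rewrite (le_lt_trans (hC _ _ Wc).1)//.
  rewrite (funext (fun t => cvecK (z t))).
  rewrite (@le_lt_trans _ _ ((C + 1) * mN (n + r) z)) ?ler_wpM2r ?mN_ge0 ?lerDl//.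
  by rewrite mulrC -ltr_pdivlMr.
(* If the bound failed at z, rescaling z to an image of size 4 would bring it into the ball of
   radius [dl], where images have size at most 2. *)
exists (4 / dl) => [|z Wz]; first by rewrite divr_ge0 ?ltW.
rewrite leNgt; apply/negP => lt1.
have K0 : 0 < absM (rB B z).
  by rewrite (le_lt_trans _ lt1)// mulr_ge0 ?mN_ge0 ?divr_ge0 ?ltW.
have l0 : 0 <= 4 / absM (rB B z) by rewrite divr_ge0 ?ltW.
have := small _ (mW_scale ab p1 (4 / absM (rB B z)) Wz).1.
have -> : rB B (fun t => (4 / absM (rB B z)) *: z t) = (4 / absM (rB B z)) *: rB B z.
  rewrite -[RHS]addr0 -B0 -rlin//; congr rB; apply/funext => t; by rewrite addr0.
have -> : absM ((4 / absM (rB B z)) *: rB B z) = 4.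
  rewrite /absM; under eq_bigr do under eq_bigr do rewrite mxE normrM ger0_norm//.
  under eq_bigr do rewrite -mulr_sumr.
  by rewrite -mulr_sumr -/(absM (rB B z)) divfK ?gt_eqF.
rewrite (le_lt_trans (mW_scale ab p1 _ Wz).2)//.
  by move=> /(_ isT); lra.
rewrite ger0_norm// mulrAC ltr_pdivrMr// mulrC [dl * _]mulrC -ltr_pdivrMr//.
by rewrite mulrAC mulrC mulrA mulrAC.
Qed.

End problem.
End complex_problem.

(** * Transfer of the real theorem to the complex problem *)

Section continuous_dependence.
Variables (R : realType) (a b p : R).
Hypotheses (ab : a < b) (p1 : 1 <= p).
Local Notation I := `[a, b]%classic.
Local Notation mW := (mW a b p).
Local Notation mN := (mN a b p).
Variables (r' m n : nat).
Local Notation r := r'.+1.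
Variables (eps0 : R) (A : nat -> R -> R -> 'M[R[i]]_m)
  (B : R -> (R -> 'cV[R[i]]_m) -> 'cV[R[i]]_(r * m)).
Hypothesis eps0_gt0 : 0 < eps0.
Hypothesis WA : forall e, 0 <= e < eps0 -> forall j, (1 <= j <= r)%N ->
  in_mxW a b n p (A (r - j)%N e).
Hypothesis HB : forall e, 0 <= e < eps0 -> continuous_linear_on_W a b (n + r) p (B e).
Local Notation rA := (fun i e t => blk (A i e t)).
Local Notation rBB := (fun e => rB (B e)).
Local Notation sol e := (solves a b n p (fun k => A k e) (B e)).
Local Notation rsol e := (rsolves a b p n (fun i => rA i e) (rBB e)).

Lemma in_mxW_cvec k (z : R -> 'cV[R]_(m + m)) : mW k z ->
  in_mxW a b k p (fun t => cvec (z t)).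
Proof. by move=> Wz; apply/(mW_vec ab p1); rewrite (funext (fun t => cvecK (z t))). Qed.

Lemma solves_cvec e f c y : rsol e f c y ->
  sol e (fun t => cvec (f t)) (cvecq c) (fun t => cvec (y t)).
Proof.
move=> s; apply/(solvesE ab p1); rewrite cvecqK.
by rewrite (funext (fun t => cvecK (f t))) (funext (fun t => cvecK (y t))).
Qed.

Lemma cvgW_cvec k (X : R -> R -> 'cV[R]_(m + m)) e1 : 0 < e1 ->
  (forall e, 0 <= e < e1 -> mW k (X e)) ->
  cvgW a b k p (fun e t => cvec (X e t)) <->
  vanish (fun e => mN k (fun t => X e t - X 0 t)).
Proof.
move=> e10 WX; apply: (iff_trans (cvgW_vec ab p1 e10 _)).
  by move=> e /WX; exact: in_mxW_cvec.
rewrite (_ : (fun e => mN k (fun t => vec _ - _)) = (fun e => mN k (fun t => X e t - X 0 t)))//.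
by apply/funext => e; congr mN; apply/funext => t; rewrite !cvecK.
Qed.

(** [vec] and [cvec] are inverse to each other, as are [vecq] and [cvecq], so every family of real
    data or solutions comes from a complex one and the quantifiers correspond. *)
Lemma rdepends_of : depends_continuously a b n p eps0 A B ->
  rdepends a b p n eps0 rA rBB.
Proof.
move=> [eps1 [e1 ex cont]]; exists eps1; have /andP[e1_gt0 _] := e1.
split; [exact: e1| |].
  move=> e he f c Wf; have [y sy uy] := ex e he _ (cvecq c) (in_mxW_cvec Wf).
  exists (fun t => vec (y t)).
    move/(solvesE ab p1): sy.
    by rewrite cvecqK (funext (fun t => cvecK (f t))).
  move=> z /solves_cvec /uy h t /ItvP It.
  by rewrite -(h t It) cvecK.
move=> f c y Wf sy vf vc.
apply/(cvgW_cvec e1_gt0); first by move=> e /sy[].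
apply: (cont (fun e t => cvec (f e t)) (fun e => cvecq (c e))).
- by move=> e /Wf; exact: in_mxW_cvec.
- by move=> e /sy; exact: solves_cvec.
- exact/(cvgW_cvec eps0_gt0).
- apply/cvgC_vecq; rewrite (_ : (fun e => _) = (fun e => absM (c e - c 0)))//.
  by apply/funext => e; rewrite !cvecqK.
Qed.

Lemma depends_of : rdepends a b p n eps0 rA rBB ->
  depends_continuously a b n p eps0 A B.
Proof.
move=> [eps1 [e1 ex cont]]; exists eps1; have /andP[e1_gt0 _] := e1.
split; [exact: e1| |].
  move=> e he f c /(mW_vec ab p1) Wf; have [y sy uy] := ex e he _ (vecq c) Wf.
  exists (fun t => cvec (y t)).
    have := solves_cvec sy.
    by rewrite vecqK (funext (fun t => vecK (f t))).
  move=> z /(solvesE ab p1) /uy h t /ItvP It.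
  by rewrite -(h t It) vecK.
move=> f c y Wf sy vf vc.
apply/(cvgW_vec ab p1 e1_gt0); first by move=> e /sy[].
apply: (cont (fun e t => vec (f e t)) (fun e => vecq (c e))).
- by move=> e /Wf /(mW_vec ab p1).
- by move=> e /sy /(solvesE ab p1).
- exact/(cvgW_vec ab p1 eps0_gt0).
- exact/cvgC_vecq.
Qed.

Lemma order_index i : (i < r)%N -> (1 <= r - i <= r)%N /\ (r - (r - i) = i)%N.
Proof. by move=> ir; split; lia. Qed.

Lemma mW_rA e : 0 <= e < eps0 -> forall i, (i < r)%N -> mW n (rA i e).
Proof.
move=> he i /order_index[h1 h2]; apply: (mW_blk ab p1).
by have := WA he h1; rewrite h2.
Qed.

Lemma blin_rBB e : 0 <= e < eps0 -> blin a b p (n + r) (rBB e).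
Proof. by move=> /HB; exact: blin_rB. Qed.

Lemma continuous_dependence : depends_continuously a b n p eps0 A B <->
  [/\ forall y, sol 0 (fun=> 0) 0 y -> forall t, a <= t <= b -> y t = 0,
      forall j, (1 <= j <= r)%N -> cvgW a b n p (A (r - j)%N)
    & forall y, in_mxW a b (n + r) p y -> cvgC (fun e => B e y)].
Proof.
split=> [/rdepends_of dep|[inj vA vB]].
  split.
  - move=> y /(solvesE ab p1); rewrite vecq0 => sy t /ItvP It.
    have sy' : rsol 0 (fun=> 0) 0 (fun s => vec (y s)).
      by move: sy; rewrite (_ : (fun s => vec 0) = (fun=> 0))//; apply/funext => s; exact: vec0.
    apply: (can_inj (@vecK R m)); rewrite vec0.
    exact: (rdepends_inj ab p1 eps0_gt0 blin_rBB dep sy' It).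
  - move=> j jr; apply/(cvgW_blk ab p1 eps0_gt0).
      by move=> e he; exact: WA.
    apply: (rdepends_A ab p1 eps0_gt0 mW_rA blin_rBB dep).
    by case/andP: jr => j1 jr; rewrite ltn_subrL j1.
  - move=> y /(mW_vec ab p1) Wy; apply/cvgC_vecq.
    have := rdepends_B ab p1 eps0_gt0 mW_rA blin_rBB dep Wy.
    rewrite (_ : (fun e => absM (rB (B e) _ - _)) = (fun e => absM (vecq (B e y) - vecq (B 0 y))))//.
    by apply/funext => e; rewrite !rB_vec.
apply: depends_of; apply: (rdepends_sufficient ab p1 eps0_gt0 mW_rA blin_rBB).
- move=> y sy t /ItvP It; apply: (can_inj (@cvecK R m)).
  have c0 : cvec (0 : 'cV[R]_(m + m)) = 0.
    by apply: (can_inj (@vecK R m)); rewrite cvecK vec0.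
  have sy' : sol 0 (fun=> 0) 0 (fun s => cvec (y s)).
    have := solves_cvec sy.
    rewrite (_ : (fun t => cvec 0) = (fun=> 0)); last by apply/funext => s; exact: c0.
    by rewrite -[X in cvecq X](vecq0 R r m) vecqK.
  by rewrite c0; exact: (inj _ sy' t It).
- move=> i /order_index[h1 h2]; have := vA _ h1; rewrite h2.
  move=> /(cvgW_blk ab p1 eps0_gt0); apply=> e he.
  by have := WA he h1; rewrite h2.
- move=> y Wy; have := vB _ (in_mxW_cvec Wy) => /cvgC_vecq.
  exact.
Qed.

End continuous_dependence.

Theorem theorem2p3 (R : realType) (n m r : nat) (p a b eps0 : R)
    (A : nat -> R -> R -> 'M[R[i]]_m)
    (B : R -> (R -> 'cV[R[i]]_m) -> 'cV[R[i]]_(r * m))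
    (m_ge1 : (1 <= m)%N) (r_ge1 : (1 <= r)%N) (p_ge1 : 1 <= p)
    (a_lt_b : a < b) (eps0_gt0 : 0 < eps0)
    (A_in_W : forall eps : R, 0 <= eps < eps0 ->
       forall j : nat, (1 <= j <= r)%N -> in_mxW a b n p (A (r - j)%N eps))
    (B_cont_lin : forall eps : R, 0 <= eps < eps0 ->
       continuous_linear_on_W a b (n + r) p (B eps)) :
  depends_continuously a b n p eps0 A B <->
  [/\ forall y : R -> 'cV[R[i]]_m,
        solves a b n p (fun k => A k 0) (B 0) (fun=> 0) 0 y ->
        forall t : R, a <= t <= b -> y t = 0,
      forall j : nat, (1 <= j <= r)%N -> cvgW a b n p (A (r - j)%N)
    & forall y : R -> 'cV[R[i]]_m, in_mxW a b (n + r) p y ->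
        cvgC (fun eps => B eps y)].
Proof.
case: r B r_ge1 A_in_W B_cont_lin => [//|r'] B _ WA HB.
exact: continuous_dependence.
Qed.
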